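(* Let $L$ be a non-empty finite connected flag simplicial complex. Suppose that for every connected regular covering $M\to L$ with $\pi(M,L)$ finite, every $n>0$ and every $S\subseteq\mathbb{Z}$ with $S+n=S$, the group $G_L^M(S)\rtimes n\mathbb{Z}$ is virtually special. Then for every connected regular covering $M\to L$ and every $S\subseteq\mathbb{Z}$: (1) if $S$ is periodic and $\pi(M,L)$ is virtually torsion-free, then $G_L^M(S)$ is virtually torsion-free; (2) if $S$ is closed in the profinite topology on $\mathbb{Z}$ and $\pi(M,L)$ is residually finite, then $G_L^M(S)$ is residually finite.
   Context: A subset $S\subseteq\mathbb{Z}$ is periodic if there is $n>0$ with $S+n=S$. The profinite topology on $\mathbb{Z}$ is the topology having the periodic subsets as a basis of open sets. Groups. A flag complex is a simplicial complex in which every finite set of pairwise adjacent vertices spans a simplex. For a connected regular (possibly infinite) covering $M\to L$, triangulated so that the covering map is simplicial (so $M$ is flag), $\pi=\pi(M,L)$ denotes its group of deck transformations. For a flag complex $K$ with vertex set $K^0$, $A_K=\langle v\in K^0 : [v,w]=1 \text{ for every edge } \{v,w\}\rangle$; the height homomorphism $\mathrm{ht}:A_K\to\mathbb{Z}$ sends every vertex to $1$, and $BB_K=\ker(\mathrm{ht})$. The group $\pi$ acts on $A_M$ and $BB_M$ by permuting vertices of $M$; extend $\mathrm{ht}$ to $A_M\rtimes\pi$ by $\mathrm{ht}(\pi)=0$. For $S\subseteq\mathbb{Z}$ let $N(S)$ be the subgroup generated by all $b\pi b^{-1}$ with $b\in A_M$, $\mathrm{ht}(b)\in S$; it is normal in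 $BB_M\rtimes\pi$, and $G_L^M(S)=(BB_M\rtimes\pi)/N(S)$. If $S+n=S$ with $n>0$, then $N(S)$ is normal in $H_n=\mathrm{ht}^{-1}(n\mathbb{Z})\le A_M\rtimes\pi$, and $G_L^M(S)\rtimes n\mathbb{Z}$ denotes $H_n/N(S)$, a split extension of $n\mathbb{Z}$ by $G_L^M(S)$. Cube complexes. $X_M$ is the universal cover of the Salvetti complex of $A_M$: it has vertex set $A_M$ and, for each $a\in A_M$ and each simplex $\sigma$ of $M$ (including the empty one), a cube with vertex set $\{a\prod_{v\in\tau}v:\tau\subseteq\sigma\}$. The group $A_M\rtimes\pi$ acts on $X_M$ by $(a,g)\cdot b=a\,g(b)$. The stabilizer of the vertex $b$ is $b\pi b^{-1}$. Define $X_L^M(S)=X_M/N(S)$; it is a CAT(0) cube complex acted on by $G_L^M(S)$, and by $G_L^M(S)\rtimes n\mathbb{Z}$ when $S+n=S$. Special. In a non-positively curved cube complex, a hyperplane is an equivalence class of directed edges under the relation generated by being parallel, like-directed opposite edges of a square. It is 2-sided if it does not contain both orientations of an edge. Two hyperplanes intersect if they contain directed edges that are adjacent sides of a square; a hyperplane self-intersects if it contains two directed edges that are adjacent sides of a square. Two distinct directed edges directly osculate if they have the same terminal vertex and are not adjacent sides of a square with a corner at that vertex; a hyperplane directly self-osculates if it contains two directly osculating edges; two hyperplanes inter-osculate if they intersect and also contain a pair of directly osculating directed edges, one from each. The complex is special if no hyperplane self-intersects or directly self-osculates and no two inter-osculate, and A-special if moreover all hyperplanes are 2-sided (2-sidedness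 is automatic for quotients of $X_L^M(S)$ by subgroups of $G_L^M(S)$). When $\pi(M,L)$ is finite, $G_L^M(S)\rtimes n\mathbb{Z}$ is virtually special if it has a torsion-free finite-index subgroup $K$ such that $X_L^M(S)/K$ is special. *)

(* Defs.v *)
From HB Require Import structures.
From Stdlib Require Import Relation_Operators.
From mathcomp Require Import all_boot all_order all_algebra generic_quotient finmap.
From mathcomp Require Import boolp classical_sets functions cardinality topology.

Set Implicit Arguments.
Unset Strict Implicit.
Unset Printing Implicit Defensive.

Import GRing.Theory Num.Theory.

Local Open Scope classical_set_scope.
Local Open Scope quotient_scope.
Local Open Scope group_scope.

Lemma sig_eq (T : Type) (P : T -> Prop) (x y : {x | P x}) :
  sval x = sval y -> x = y.
Proof.
case: x y => [x hx] [y hy] /= e; rewrite e in hx *.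
by congr exist; exact: Prop_irrelevance.
Qed.

Section Groups.
Variable G : groupType.
Implicit Types H K : set G.

Definition subgroup H :=
  [/\ H 1, forall x y, H x -> H y -> H (x * y) & forall x, H x -> H x^-1].

Definition normal_subgroup H := subgroup H /\ forall x y, H x -> H (x ^ y).

Definition lcoset (x : G) H : set G := [set x * h | h in H].

Definition finite_index H := finite_set [set lcoset x H | x in [set: G]].

Definition torsion_free H :=
  forall x n, H x -> (0 < n)%N -> x ^+ n = 1 -> x = 1.

Definition virtually_torsion_free :=
  exists H, [/\ subgroup H, finite_index H & torsion_free H].

Definition residually_finite :=
  forall x : G, x <> 1 ->
    exists H, [/\ normal_subgroup H, finite_index H & ~ H x].

Definition setM H K : set G := [set z | exists x y, [/\ H x, K y & z = x * y]].

Lemma smallest_subgroup (A : set G) : subgroup (smallest subgroup A).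
Proof.
split=> [K [[K1 _ _] _] //|x y hx hy K hK|x hx K hK].
  by have [[_ KM _] _] := hK; apply: KM; [apply: hx | apply: hy].
by have [[_ _ KV] _] := hK; apply: KV; apply: hx.
Qed.

Lemma mem_lcoset x y H : lcoset x H y <-> H (x^-1 * y).
Proof.
split=> [[h Hh <-]|Hh]; first by rewrite mulKg.
by exists (x^-1 * y) => //; rewrite mulVKg.
Qed.

End Groups.

(** The data [N <= H <= G], with [N] normal in [H], of a quotient group
    [H / N]. *)
Record subquotient (G : groupType) := Subquotient {
  sq_num : set G;
  sq_den : set G;
  sq_num_subgroup : subgroup sq_num;
  sq_den_subgroup : subgroup sq_den;
  sq_den_sub : sq_den `<=` sq_num;
  sq_den_norm : forall x y, sq_num x -> sq_den y -> sq_den (y ^ x)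
}.

Section SubquotientGroup.
Variables (G : groupType) (Q : subquotient G).
Local Notation H := (sq_num Q).
Local Notation N := (sq_den Q).

Definition sq_coset : Type :=
  {C : set G | exists2 x, H x & C = lcoset x N}.

HB.instance Definition _ := gen_eqMixin sq_coset.
HB.instance Definition _ := gen_choiceMixin sq_coset.

Lemma sq_denJ x y : H x -> N y -> N (x * y / x).
Proof.
have [_ _ HV] := sq_num_subgroup Q => Hx Ny.
by have := sq_den_norm (HV _ Hx) Ny; rewrite conjgE invgK mulgA.
Qed.

Lemma lcosetM x y : H x -> H y ->
  setM (lcoset x N) (lcoset y N) = lcoset (x * y) N.
Proof.
have [N1 NM _] := sq_den_subgroup Q.
move=> Hx Hy; apply/seteqP; split=> z.
  move=> [_ [_ [[n Nn <-] [m Nm <-] ->]]]; exists (n ^ y * m).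
    by apply: NM => //; exact: sq_den_norm.
  by rewrite conjgE !mulgA mulgK.
move=> [n Nn <-]; exists x, (y * n); split; last by rewrite mulgA.
  by exists 1; rewrite ?mulg1.
by exists n.
Qed.

Lemma lcosetV x : H x ->
  [set z^-1 | z in lcoset x N] = lcoset x^-1 N.
Proof.
have [N1 NM NV] := sq_den_subgroup Q.
move=> Hx; apply/seteqP; split=> z.
  move=> [_ [n Nn <-] <-]; exists (x * n^-1 / x).
    by apply: sq_denJ => //; exact: NV.
  by rewrite invgM !mulgA mulVg mul1g.
move=> [n Nn <-]; exists (n^-1 * x); last by rewrite invgM invgK.
exists (n^-1 ^ x); first by apply: sq_den_norm => //; exact: NV.
by rewrite conjgE mulVKg.
Qed.

Lemma sq_one_subproof : exists2 x, H x & N = lcoset x N.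
Proof.
have [H1 _ _] := sq_num_subgroup Q.
exists 1 => //; apply/seteqP; split=> z; first by exists z; rewrite ?mul1g.
by move=> [n Nn <-]; rewrite mul1g.
Qed.

Lemma sq_mul_subproof (C D : sq_coset) :
  exists2 x, H x & setM (sval C) (sval D) = lcoset x N.
Proof.
have [_ HM _] := sq_num_subgroup Q.
case: C D => [C [x Hx eC]] [D [y Hy eD]] /=; exists (x * y); first exact: HM.
by rewrite eC eD; exact: lcosetM.
Qed.

Lemma sq_inv_subproof (C : sq_coset) :
  exists2 x, H x & [set z^-1 | z in sval C] = lcoset x N.
Proof.
have [_ _ HV] := sq_num_subgroup Q.
case: C => [C [x Hx e]] /=; exists x^-1; first exact: HV.
by rewrite e; exact: lcosetV.
Qed.

Definition sq_one : sq_coset := exist _ N sq_one_subproof.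
Definition sq_mul C D : sq_coset := exist _ _ (sq_mul_subproof C D).
Definition sq_inv C : sq_coset := exist _ _ (sq_inv_subproof C).

Definition sq_class x (Hx : H x) : sq_coset :=
  exist _ (lcoset x N) (ex_intro2 _ _ x Hx erefl).

Lemma sq_classP (C : sq_coset) : exists x (Hx : H x), C = sq_class Hx.
Proof. by case: C => [D [x Hx e]]; exists x, Hx; exact: sig_eq. Qed.

Lemma sq_mulE x y (Hx : H x) (Hy : H y) (Hxy : H (x * y)) :
  sq_mul (sq_class Hx) (sq_class Hy) = sq_class Hxy.
Proof. by apply: sig_eq; exact: lcosetM. Qed.

Lemma sq_invE x (Hx : H x) (Hx' : H x^-1) :
  sq_inv (sq_class Hx) = sq_class Hx'.
Proof. by apply: sig_eq; exact: lcosetV. Qed.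

Lemma sq_oneE (H1 : H 1) : sq_one = sq_class H1.
Proof.
apply: sig_eq => /=; apply/seteqP; split=> z.
  by exists z; rewrite ?mul1g.
by move=> [n Nn <-]; rewrite mul1g.
Qed.

Lemma sq_class_eq x y (Hx : H x) (Hy : H y) :
  x = y -> sq_class Hx = sq_class Hy.
Proof. by move=> e; apply: sig_eq; rewrite /= e. Qed.

Lemma sq_mulA : associative sq_mul.
Proof.
move=> C D E; apply: sig_eq; apply/seteqP; split=> z /=.
  move=> [x [_ [Cx [y [w [Dy Ew ->]]] ->]]]; exists (x * y), w.
  by split=> //; [exists x, y | rewrite mulgA].
move=> [_ [w [[x [y [Cx Dy ->]]] Ew ->]]]; exists x, (y * w).
by split=> //; [exists y, w | rewrite mulgA].
Qed.

Lemma sq_mul1 : left_id sq_one sq_mul.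
Proof.
have [H1 HM HV] := sq_num_subgroup Q.
move=> C; have [x [Hx ->]] := sq_classP C.
by rewrite (sq_oneE H1) (sq_mulE _ _ (HM _ _ H1 Hx)); apply/sq_class_eq/mul1g.
Qed.

Lemma sq_mulr1 : right_id sq_one sq_mul.
Proof.
have [H1 HM HV] := sq_num_subgroup Q.
move=> C; have [x [Hx ->]] := sq_classP C.
by rewrite (sq_oneE H1) (sq_mulE _ _ (HM _ _ Hx H1)); apply/sq_class_eq/mulg1.
Qed.

Lemma sq_mulV : left_inverse sq_one sq_inv sq_mul.
Proof.
have [H1 HM HV] := sq_num_subgroup Q.
move=> C; have [x [Hx ->]] := sq_classP C.
rewrite (sq_oneE H1) (sq_invE _ (HV _ Hx)) (sq_mulE _ _ (HM _ _ (HV _ Hx) Hx)).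
exact/sq_class_eq/mulVg.
Qed.

Lemma sq_mulrV : right_inverse sq_one sq_inv sq_mul.
Proof.
have [H1 HM HV] := sq_num_subgroup Q.
move=> C; have [x [Hx ->]] := sq_classP C.
rewrite (sq_oneE H1) (sq_invE _ (HV _ Hx)) (sq_mulE _ _ (HM _ _ Hx (HV _ Hx))).
exact/sq_class_eq/mulgV.
Qed.

HB.instance Definition _ :=
  isGroup.Build sq_coset sq_mulA sq_mul1 sq_mulr1 sq_mulV sq_mulrV.

End SubquotientGroup.

Section Presentation.
Variable T : choiceType.

(** The letters [(x, true)] and [(x, false)] stand for [x] and [x^-1]. *)
Definition word := seq (T * bool).

Definition word_inv (w : word) : word := rev [seq (l.1, ~~ l.2) | l <- w].

Variable R : set word.

Inductive word_eq : word -> word -> Prop :=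
| WordRefl w : word_eq w w
| WordSym u v : word_eq u v -> word_eq v u
| WordTrans v u w : word_eq u v -> word_eq v w -> word_eq u w
| WordCat u u' v v' :
    word_eq u u' -> word_eq v v' -> word_eq (u ++ v) (u' ++ v')
| WordCancel x b : word_eq [:: (x, b); (x, ~~ b)] [::]
| WordRel r : R r -> word_eq r [::].

Definition word_eqb (u v : word) := `[< word_eq u v >].

Lemma word_eqb_refl : reflexive word_eqb.
Proof. by move=> u; apply/asboolP/WordRefl. Qed.

Lemma word_eqb_sym : symmetric word_eqb.
Proof. by move=> u v; apply/asboolP/asboolP => /WordSym. Qed.

Lemma word_eqb_trans : transitive word_eqb.
Proof. by move=> v u w /asboolP uv /asboolP vw; apply/asboolP/(WordTrans uv). Qed.

Canonical word_equiv := EquivRel word_eqb word_eqb_refl word_eqb_sym word_eqb_trans.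

Definition presented : Type := {eq_quot word_equiv}.

HB.instance Definition _ := Choice.on presented.

Definition pclass (w : word) : presented := \pi_({eq_quot word_equiv})%qT w.
Definition prepr (a : presented) : word := repr (a : {eq_quot word_equiv}).

Lemma preprK a : pclass (prepr a) = a.
Proof. exact: reprK. Qed.

Lemma pclassP u v : pclass u = pclass v <-> word_eq u v.
Proof.
split; first by move/eqquotP/asboolP.
by move=> h; apply/eqquotP/asboolP.
Qed.

Lemma prepr_class w : word_eq (prepr (pclass w)) w.
Proof. by apply/pclassP; rewrite preprK. Qed.

Definition pres_one : presented := pclass [::].
Definition pres_mul (a b : presented) : presented :=
  pclass (prepr a ++ prepr b).
Definition pres_inv (a : presented) : presented := pclass (word_inv (prepr a)).

Lemma pres_mulE u v : pres_mul (pclass u) (pclass v) = pclass (u ++ v).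
Proof. by apply/pclassP; apply: WordCat; exact: prepr_class. Qed.

Lemma word_invV w : word_eq (word_inv w ++ w) [::].
Proof.
elim: w => [|[x b] w IH]; first exact: WordRefl.
rewrite /word_inv /= rev_cons -cats1 -catA /=.
apply: (WordTrans (v := word_inv w ++ w)) => //.
apply: WordCat; first exact: WordRefl.
rewrite -[in X in word_eq _ X](cat0s w) -(cat1s (x, b)) -cat_cons.
apply: WordCat; last exact: WordRefl.
by have := WordCancel x (~~ b); rewrite negbK.
Qed.

Lemma word_invK : involutive word_inv.
Proof.
move=> w; rewrite /word_inv map_rev revK -map_comp -[RHS]map_id.
by apply: eq_map => -[x b] /=; rewrite negbK.
Qed.

Lemma pres_mulA : associative pres_mul.
Proof.
move=> a b c; rewrite -(preprK a) -(preprK b) -(preprK c).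
by rewrite !pres_mulE catA.
Qed.

Lemma pres_mul1 : left_id pres_one pres_mul.
Proof. by move=> a; rewrite -(preprK a) pres_mulE. Qed.

Lemma pres_mulr1 : right_id pres_one pres_mul.
Proof. by move=> a; rewrite -(preprK a) pres_mulE cats0. Qed.

Lemma pres_mulV : left_inverse pres_one pres_inv pres_mul.
Proof.
move=> a; rewrite -[in X in pres_mul _ X](preprK a) pres_mulE.
by apply/pclassP; exact: word_invV.
Qed.

Lemma pres_mulrV : right_inverse pres_one pres_inv pres_mul.
Proof.
move=> a; rewrite -[in X in pres_mul X _](preprK a) pres_mulE.
apply/pclassP; have := word_invV (word_inv (prepr a)).
by rewrite word_invK.
Qed.

HB.instance Definition _ :=
  isGroup.Build presented pres_mulA pres_mul1 pres_mulr1 pres_mulV pres_mulrV.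

Lemma pclassM u v : pclass (u ++ v) = pclass u * pclass v.
Proof. by rewrite -pres_mulE. Qed.

End Presentation.

(** The empty simplex is included. *)
Record scomplex := SComplex {
  vertex :> choiceType;
  simplex : set {fset vertex};
  simplex1 : forall v, simplex [fset v]%fset;
  simplexS : forall s t, (t `<=` s)%fset -> simplex s -> simplex t
}.

Section Complexes.
Variable K : scomplex.

Definition adjacent (v w : K) := v <> w /\ simplex [fset v; w]%fset.

Definition flag := forall s : {fset K},
  {in s &, forall v w, v <> w -> adjacent v w} -> simplex s.

(** Edge-path connectedness; the empty complex is not excluded. *)
Definition sconnected := forall v w : K, clos_refl_trans K adjacent v w.

Definition raag_relators : set (word K) :=
  [set r | exists v w, adjacent v w /\
     r = [:: (v, false); (w, false); (v, true); (w, true)]].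

Definition raag := presented raag_relators.

HB.instance Definition _ := Group.on raag.

Definition raag_gen (v : K) : raag := pclass raag_relators [:: (v, true)].

Definition word_ht (w : word K) : int :=
  (\sum_(l <- w) if l.2 then 1 else - 1)%R.

Definition raag_ht (a : raag) : int := word_ht (prepr a).

Lemma word_ht_eq u v : word_eq raag_relators u v -> word_ht u = word_ht v.
Proof.
rewrite /word_ht; elim=> {u v} //.
- by move=> v u w _ -> _ ->.
- by move=> u u' v v' _ eu _ ev; rewrite !big_cat /= eu ev.
- by move=> x b; rewrite !big_cons big_nil /=; case: b.
- by move=> r [v [w [_ ->]]]; rewrite !big_cons big_nil.
Qed.

Lemma raag_htE w : raag_ht (pclass _ w) = word_ht w.
Proof. exact/word_ht_eq/prepr_class. Qed.

Lemma raag_htM a b : raag_ht (a * b) = (raag_ht a + raag_ht b)%R.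
Proof.
rewrite -(preprK a) -(preprK b) -pclassM !raag_htE.
by rewrite /word_ht big_cat.
Qed.

Lemma raag_ht_gen v : raag_ht (raag_gen v) = 1%R.
Proof. by rewrite raag_htE /word_ht big_seq1. Qed.

Definition bestvina_brady : set raag := [set a | raag_ht a = 0%R].

End Complexes.

(** A simplicial covering map: surjective, injective on simplices, and such
    that every simplex of [L] through [p x] lifts uniquely to a simplex of [M]
    through [x]. These are exactly the simplicial maps [p] whose geometric
    realization is a covering carrying the lifted triangulation. *)
Definition covering (M L : scomplex) (p : M -> L) :=
  [/\ forall v, exists x, p x = v,
      forall s, simplex s -> simplex [fset p x | x in s]%fset,
      forall s : {fset M}, simplex s -> {in s &, injective p} &
      forall (x : M) (t : {fset L}), simplex t -> p x \in t ->
        exists! s : {fset M},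
          [/\ simplex s, x \in s & [fset p y | y in s]%fset = t]].

(** Deck transformations. A homeomorphism of [M] over [L] maps simplices of the
    lifted triangulation to simplices, so it is determined by its effect on the
    vertices. *)
Record deck (M L : scomplex) (p : M -> L) := Deck {
  deck_fun :> M -> M;
  deck_finv : M -> M;
  deck_funK : cancel deck_fun deck_finv;
  deck_finvK : cancel deck_finv deck_fun;
  deck_simplex : forall s, simplex s -> simplex [fset deck_fun x | x in s]%fset;
  deck_simplexV :
    forall s, simplex s -> simplex [fset deck_finv x | x in s]%fset;
  deck_over : forall x, p (deck_fun x) = p x
}.

Definition regular_covering (M L : scomplex) (p : M -> L) :=
  covering p /\ forall x y, p x = p y -> exists g : deck p, g x = y.

Section DeckGroup.
Variables (M L : scomplex) (p : M -> L).
Local Notation deck := (deck p).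

HB.instance Definition _ := gen_eqMixin deck.
HB.instance Definition _ := gen_choiceMixin deck.

Lemma deck_eq (g h : deck) : g =1 h -> g = h.
Proof.
case: g h => [f f' fK f'K fS fS' fp] [g g' gK g'K gS gS' gp] /= /funext e.
have e' : f' = g' by apply/funext => x; apply: (can_inj fK); rewrite f'K e g'K.
move: e e' => e; subst g => e; subst g'.
by congr Deck; exact: Prop_irrelevance.
Qed.

Lemma deck_one_simplex (s : {fset M}) :
  simplex s -> simplex [fset idfun x | x in s]%fset.
Proof.
by apply: simplexS; apply/fsubsetP => _ /imfsetP[x /= xs ->].
Qed.

Definition deck_one : deck :=
  @Deck M L p idfun idfun (frefl _) (frefl _)
    deck_one_simplex deck_one_simplex (frefl _).

Lemma deck_comp_simplex (f g : M -> M) :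
  (forall s, simplex s -> simplex [fset f x | x in s]%fset) ->
  (forall s, simplex s -> simplex [fset g x | x in s]%fset) ->
  forall s, simplex s -> simplex [fset (f \o g) x | x in s]%fset.
Proof.
move=> hf hg s /hg /hf; apply: simplexS.
apply/fsubsetP => _ /imfsetP[x /= xs ->].
by apply: in_imfset; exact: in_imfset.
Qed.

Lemma deck_mul_over (g h : deck) x : p ((g \o h) x) = p x.
Proof. by rewrite /= !deck_over. Qed.

Definition deck_mul (g h : deck) : deck :=
  @Deck M L p (g \o h) (deck_finv h \o deck_finv g)
    (can_comp (@deck_funK _ _ _ g) (@deck_funK _ _ _ h))
    (can_comp (@deck_finvK _ _ _ h) (@deck_finvK _ _ _ g))
    (deck_comp_simplex (@deck_simplex _ _ _ g) (@deck_simplex _ _ _ h))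
    (deck_comp_simplex (@deck_simplexV _ _ _ h) (@deck_simplexV _ _ _ g))
    (deck_mul_over g h).

Lemma deck_inv_over (g : deck) x : p (deck_finv g x) = p x.
Proof. by rewrite -(deck_over g) deck_finvK. Qed.

Definition deck_inv (g : deck) : deck :=
  @Deck M L p (deck_finv g) g (@deck_finvK _ _ _ g) (@deck_funK _ _ _ g)
    (@deck_simplexV _ _ _ g) (@deck_simplex _ _ _ g) (deck_inv_over g).

Lemma deck_mulA : associative deck_mul.
Proof. by move=> f g h; apply: deck_eq. Qed.
Lemma deck_mul1 : left_id deck_one deck_mul.
Proof. by move=> g; apply: deck_eq. Qed.
Lemma deck_mulr1 : right_id deck_one deck_mul.
Proof. by move=> g; apply: deck_eq. Qed.
Lemma deck_mulV : left_inverse deck_one deck_inv deck_mul.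
Proof. by move=> g; apply: deck_eq => x; exact: deck_funK. Qed.
Lemma deck_mulrV : right_inverse deck_one deck_inv deck_mul.
Proof. by move=> g; apply: deck_eq => x; exact: deck_finvK. Qed.

HB.instance Definition _ :=
  isGroup.Build deck deck_mulA deck_mul1 deck_mulr1 deck_mulV deck_mulrV.

Lemma deckM (g h : deck) x : (g * h) x = g (h x).
Proof. by []. Qed.

(** The action of [pi(M, L)] on [A_M] permuting the generators. *)
Definition word_map (g : deck) (w : word M) : word M :=
  [seq (g l.1, l.2) | l <- w].

Definition deck_raag (g : deck) (a : raag M) : raag M :=
  pclass _ (word_map g (prepr a)).

Lemma word_map_eq g u v : word_eq (@raag_relators M) u v ->
  word_eq (@raag_relators M) (word_map g u) (word_map g v).
Proof.
elim=> {u v} /=.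
- by move=> w; exact: WordRefl.
- by move=> u v _; exact: WordSym.
- by move=> v u w _ h _; exact: WordTrans.
- by move=> u u' v v' _ hu _ hv; rewrite /word_map !map_cat; exact: WordCat.
- by move=> x b; exact: WordCancel.
- move=> r [v [w [[nvw svw] ->]]]; apply: WordRel.
  exists (g v), (g w); split=> //; split; first by move/(can_inj (deck_funK g)).
  have := deck_simplex g svw; apply: simplexS.
  apply/fsubsetP => z; rewrite !inE => /orP[] /eqP ->; apply: in_imfset;
    by rewrite !inE eqxx ?orbT.
Qed.

Lemma deck_raagE g w : deck_raag g (pclass _ w) = pclass _ (word_map g w).
Proof. by apply/pclassP/word_map_eq/prepr_class. Qed.

Lemma deck_raag_gen g v : deck_raag g (raag_gen v) = raag_gen (g v).
Proof. exact: deck_raagE. Qed.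

Lemma deck_raagM g : {morph deck_raag g : a b / a * b}.
Proof.
move=> a b; rewrite -(preprK a) -(preprK b) -pclassM !deck_raagE.
by rewrite /word_map map_cat pclassM.
Qed.

Lemma deck_raag1 g : deck_raag g 1 = 1.
Proof. exact: (deck_raagE g [::]). Qed.

Lemma deck_raag_one a : deck_raag 1 a = a.
Proof.
rewrite -(preprK a) deck_raagE; congr pclass.
by rewrite /word_map -[RHS]map_id; apply: eq_map => -[].
Qed.

Lemma deck_raag_mul g h a : deck_raag (g * h) a = deck_raag g (deck_raag h a).
Proof.
by rewrite -(preprK a) !deck_raagE /word_map -map_comp.
Qed.

Lemma deck_raag_ht g a : raag_ht (deck_raag g a) = raag_ht a.
Proof.
by rewrite -(preprK a) deck_raagE !raag_htE /word_ht /word_map big_map.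
Qed.

(** [A_M ><| pi(M, L)]; the pair [(a, g)] stands for the product [a g]. *)
Record raag_deck := RaagDeck { rd_raag : raag M; rd_deck : deck }.

HB.instance Definition _ := gen_eqMixin raag_deck.
HB.instance Definition _ := gen_choiceMixin raag_deck.

Definition rd_one := RaagDeck 1 1.
Definition rd_mul x y :=
  RaagDeck (rd_raag x * deck_raag (rd_deck x) (rd_raag y))
           (rd_deck x * rd_deck y).
Definition rd_inv x :=
  RaagDeck (deck_raag (rd_deck x)^-1 (rd_raag x)^-1) (rd_deck x)^-1.

Lemma rd_mulA : associative rd_mul.
Proof.
move=> [a f] [b g] [c h]; rewrite /rd_mul /=.
by rewrite deck_raagM deck_raag_mul !mulgA.
Qed.
Lemma rd_mul1 : left_id rd_one rd_mul.
Proof. by move=> [a g]; rewrite /rd_mul /= deck_raag_one !mul1g. Qed.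
Lemma rd_mulr1 : right_id rd_one rd_mul.
Proof. by move=> [a g]; rewrite /rd_mul /= deck_raag1 !mulg1. Qed.
Lemma rd_mulV : left_inverse rd_one rd_inv rd_mul.
Proof.
by move=> [a g]; rewrite /rd_mul /= -deck_raagM !mulVg deck_raag1.
Qed.
Lemma rd_mulrV : right_inverse rd_one rd_inv rd_mul.
Proof.
by move=> [a g]; rewrite /rd_mul /= -deck_raag_mul !mulgV deck_raag_one mulgV.
Qed.

HB.instance Definition _ :=
  isGroup.Build raag_deck rd_mulA rd_mul1 rd_mulr1 rd_mulV rd_mulrV.

Lemma rdM x y : x * y =
  RaagDeck (rd_raag x * deck_raag (rd_deck x) (rd_raag y))
           (rd_deck x * rd_deck y).
Proof. by []. Qed.

Definition of_raag (a : raag M) : raag_deck := RaagDeck a 1.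
Definition of_deck (g : deck) : raag_deck := RaagDeck 1 g.

Definition rd_ht (x : raag_deck) : int := raag_ht (rd_raag x).

Lemma rd_htM x y : rd_ht (x * y) = (rd_ht x + rd_ht y)%R.
Proof. by rewrite /rd_ht rdM /= raag_htM deck_raag_ht. Qed.

Lemma rd_ht1 : rd_ht 1 = 0%R.
Proof. by apply: (@addrI _ (rd_ht 1)); rewrite -rd_htM mulg1 addr0. Qed.

Lemma rd_htV x : rd_ht x^-1 = (- rd_ht x)%R.
Proof. by apply: (@addrI _ (rd_ht x)); rewrite -rd_htM mulgV rd_ht1 subrr. Qed.

Definition NS_generators (S : set int) : set raag_deck :=
  [set x | exists (b : raag M) (g : deck),
     S (raag_ht b) /\ x = of_raag b * of_deck g * (of_raag b)^-1].

Definition NS (S : set int) : set raag_deck :=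
  smallest (@subgroup raag_deck) (NS_generators S).

Definition BB_deck : set raag_deck := [set x | bestvina_brady (rd_raag x)].

Definition Hn (n : int) : set raag_deck := [set x | (n %| rd_ht x)%Z].

Definition shift_invariant (S : set int) (n : int) :=
  [set (s + n)%R | s in S] = S.

Lemma NS_ht S x : NS S x -> rd_ht x = 0%R.
Proof.
move=> /(_ [set x | rd_ht x = 0%R]); apply; split.
  split=> [|y z|y] /=; first exact: rd_ht1.
    by move=> hy hz; rewrite rd_htM hy hz addr0.
  by move=> hy; rewrite rd_htV hy oppr0.
move=> _ [b [g [_ ->]]] /=; rewrite !rd_htM rd_htV.
by rewrite {2}/rd_ht /= (rd_ht1 : raag_ht 1 = _) addr0 subrr.
Qed.

Lemma NS_norm (S : set int) x y :
  (forall s, S s -> S (s - rd_ht x)%R) -> NS S y -> NS S (y ^ x).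
Proof.
move=> hS Ny; apply: (Ny [set y | NS S (y ^ x)]); split.
  have [N1 NM NV] := smallest_subgroup (NS_generators S).
  split=> [|u v|u] /=; first by rewrite conj1g.
    by move=> hu hv; rewrite conjMg; apply: NM.
  by move=> hu; rewrite conjVg; apply: NV.
move=> _ [b [g [Sb ->]]] /= K [_ sK]; apply: sK.
pose c := x^-1 * of_raag b.
exists (rd_raag c), (rd_deck c * g / rd_deck c); split.
  have -> : raag_ht (rd_raag c) = (raag_ht b - rd_ht x)%R.
    by rewrite -/(rd_ht c) rd_htM rd_htV addrC.
  exact: hS.
have ec : c = of_raag (rd_raag c) * of_deck (rd_deck c).
  by case: (c) => u v; rewrite rdM /= deck_raag1 mulg1 mul1g.
have em u v : of_deck u * of_deck v = of_deck (u * v).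
  by rewrite rdM /= deck_raag1 mulg1.
have ev u : (of_deck u)^-1 = of_deck u^-1.
  by apply: (@mulgI _ (of_deck u)); rewrite em !mulgV.
rewrite -(em (rd_deck c * g)) -(em (rd_deck c)) -ev conjgE.
have -> : x^-1 * (of_raag b * of_deck g / of_raag b * x) =
          c * of_deck g / c by rewrite /c invgM invgK !mulgA.
have es (u v w h : raag_deck) : w = u * v -> w * h / w = u * (v * h / v) / u.
  by move=> ->; rewrite invgM !mulgA.
exact: es.
Qed.

Lemma shift_invariantM (S : set int) (n k : int) s :
  shift_invariant S n -> S s -> S (s + k * n)%R.
Proof.
move=> hS; have hp (m : nat) t : S t -> S (t + m%:Z * n)%R.
  elim: m t => [|m IH] t St; first by rewrite mul0r addr0.
  rewrite intS mulrDl mul1r addrA; apply: IH.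
  by rewrite -hS; exists t.
have hn (m : nat) t : S t -> S (t - m%:Z * n)%R.
  elim: m t => [|m IH] t St; first by rewrite mul0r subr0.
  rewrite intS mulrDl mul1r opprD addrA; apply: IH.
  by move: St; rewrite -{1}hS => -[u Su <-]; rewrite addrK.
case: k => m Ss; first exact: hp.
by rewrite NegzE mulNr; apply: hn.
Qed.

Lemma ht_subgroup (n : int) : subgroup (Hn n).
Proof.
split=> [|x y|x]; rewrite /Hn /=.
- by rewrite rd_ht1 dvdz0.
- by move=> hx hy; rewrite rd_htM rpredD.
- by move=> hx; rewrite rd_htV rpredN.
Qed.

Lemma BB_deck_subgroup : subgroup BB_deck.
Proof.
split=> [|x y hx hy|x hx]; first exact: rd_ht1.
  by change (rd_ht (x * y) = 0%R); rewrite rd_htM [rd_ht x]hx [rd_ht y]hy addr0.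
by change (rd_ht x^-1 = 0%R); rewrite rd_htV [rd_ht x]hx oppr0.
Qed.

Lemma NS_sub_BB S : NS S `<=` BB_deck.
Proof. by move=> x; exact: NS_ht. Qed.

Lemma NS_sub_Hn S n : NS S `<=` Hn n.
Proof. by move=> x /NS_ht; rewrite /Hn /= => ->; exact: dvdz0. Qed.

Lemma NS_norm_BB S x y : BB_deck x -> NS S y -> NS S (y ^ x).
Proof.
by move=> hx; apply: NS_norm => s; rewrite (hx : rd_ht x = 0%R) subr0.
Qed.

Lemma NS_norm_Hn S n x y :
  shift_invariant S n -> Hn n x -> NS S y -> NS S (y ^ x).
Proof.
move=> hS /dvdzP[k hk]; apply: NS_norm => s Ss.
by rewrite hk -mulNr; exact: shift_invariantM.
Qed.

Definition GLM_sq S : subquotient raag_deck :=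
  Subquotient BB_deck_subgroup (smallest_subgroup _)
    (@NS_sub_BB S) (@NS_norm_BB S).

Definition GLMZ_sq S n (hS : shift_invariant S n) : subquotient raag_deck :=
  Subquotient (ht_subgroup n) (smallest_subgroup _)
    (@NS_sub_Hn S n) (fun x y => @NS_norm_Hn S n x y hS).

Definition GLM S : groupType := sq_coset (GLM_sq S).

Definition GLMZ S n (hS : shift_invariant S n) : groupType :=
  sq_coset (GLMZ_sq hS).

End DeckGroup.

Arguments NS {M L} p S.
Arguments Hn {M L} p n.
Arguments GLM_sq {M L} p S.
Arguments GLMZ_sq {M L} p {S n} hS.
Arguments GLM {M L} p S.
Arguments GLMZ {M L} p {S n} hS.

Definition hcube k := {ffun 'I_k -> bool}.

Definition hamming k (x y : hcube k) := #|[pred i | x i != y i]|.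

(** The isometric embeddings of the k-cube in the m-cube: the symmetries of
    cubes, the inclusions of faces, and their composites. *)
Record cube_map k m := CubeMap {
  cube_fun :> hcube k -> hcube m;
  cube_isom : forall x y, hamming (cube_fun x) (cube_fun y) = hamming x y
}.

Definition cube_id k : cube_map k k := @CubeMap k k id (fun x y => erefl).

Lemma cube_comp_isom k m n (f : cube_map m n) (g : cube_map k m) x y :
  hamming ((f \o g) x) ((f \o g) y) = hamming x y.
Proof. by rewrite /= !cube_isom. Qed.

Definition cube_comp k m n (f : cube_map m n) (g : cube_map k m) :
  cube_map k n := CubeMap (cube_comp_isom f g).

Definition face_fun k (i : 'I_k.+1) (b : bool) (x : hcube k) : hcube k.+1 :=
  [ffun j => if unlift i j is Some j' then x j' else b].

Lemma face_isom k (i : 'I_k.+1) b x y :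
  hamming (face_fun i b x) (face_fun i b y) = hamming x y.
Proof.
rewrite /hamming -!sum1_card !big_mkcond /= (bigD1_ord i) //=.
rewrite !inE !ffunE unlift_none eqxx add0n.
by rewrite [RHS]big_mkcond /=; apply: eq_bigr => j _; rewrite !inE !ffunE liftK.
Qed.

(** The face of the (k+1)-cube on which the coordinate [i] is [b]. *)
Definition face k (i : 'I_k.+1) b : cube_map k k.+1 :=
  CubeMap (@face_isom k i b).

(** A cube complex is given by its parametrized k-cubes [[0, 1]^k -> X], for all
    k, together with their restrictions along cube maps. A k-cube is thus an
    orbit of elements of [cell X k] under the symmetries of [[0, 1]^k], a vertex
    is an element of [cell X 0] and a directed edge an element of [cell X 1].
    In a genuine cube complex the symmetries act freely on [cell X k]; this is
    not required here, but it holds for [X_M] and its quotients by subgroups of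
    [A_M ><| pi(M, L)], where a cube is fixed pointwise by its stabilizer. *)
Record cube_complex := CubeComplex {
  cell : nat -> Type;
  restr : forall k m, cube_map k m -> cell m -> cell k;
  restr_id : forall k (c : cell k), restr (cube_id k) c = c;
  restr_comp : forall k m n (f : cube_map m n) (g : cube_map k m) (c : cell n),
    restr (cube_comp f g) c = restr g (restr f c)
}.

Section Special.
Variable X : cube_complex.
Local Notation edge := (cell X 1).
Local Notation square := (cell X 2).

(** The side of [q] on which the coordinate [i] is [b], directed along the other
    coordinate. *)
Definition side (q : square) (i : 'I_2) (b : bool) : edge := restr (face i b) q.

Definition terminal (e : edge) : cell X 0 := restr (face ord0 true) e.

Definition opposite_sides (e e' : edge) :=
  exists (q : square) i, e = side q i false /\ e' = side q i true.

Definition parallel : edge -> edge -> Prop := clos_refl_sym_trans edge opposite_sides.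

Definition hyperplane (H : set edge) := exists e, H = [set e' | parallel e e'].

(** Both orientations of each side occur here, since [q] may be reparametrized. *)
Definition adjacent_sides (e e' : edge) :=
  exists (q : square) i j (b b' : bool),
    [/\ i != j, e = side q i b & e' = side q j b'].

(** [e] and [e'] both end at the common corner [(1, 1)] of [q]. *)
Definition adjacent_at_terminal (e e' : edge) :=
  exists (q : square) i j, [/\ i != j, e = side q i true & e' = side q j true].

Definition directly_osculate (e e' : edge) :=
  [/\ e <> e', terminal e = terminal e' & ~ adjacent_at_terminal e e'].

Definition intersect (H H' : set edge) :=
  exists e e', [/\ H e, H' e' & adjacent_sides e e'].

Definition self_intersects (H : set edge) := intersect H H.

Definition contain_osculating (H H' : set edge) :=
  exists e e', [/\ H e, H' e' & directly_osculate e e'].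

Definition directly_self_osculates (H : set edge) := contain_osculating H H.

Definition inter_osculate (H H' : set edge) :=
  intersect H H' /\ contain_osculating H H'.

Definition special :=
  (forall H, hyperplane H -> ~ self_intersects H /\ ~ directly_self_osculates H)
  /\ (forall H H', hyperplane H -> hyperplane H' -> ~ inter_osculate H H').

End Special.

Record cube_action (G : groupType) (X : cube_complex) := CubeAction {
  cact : forall k, G -> cell X k -> cell X k;
  cact1 : forall k (c : cell X k), cact 1 c = c;
  cactM : forall k g h (c : cell X k), cact (g * h) c = cact g (cact h c);
  cact_restr : forall k m (f : cube_map k m) g (c : cell X m),
    restr f (cact g c) = cact g (restr f c)
}.

Section Quotient.
Variables (G : groupType) (X : cube_complex) (a : cube_action G X).

Definition orbit (K : set G) k (c : cell X k) : set (cell X k) :=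
  [set cact a g c | g in K].

Variable K : set G.

Definition quot_cell k : Type :=
  {O : set (cell X k) | exists c, O = orbit K c}.

Lemma restr_orbit k m (f : cube_map k m) (c : cell X m) :
  [set restr f d | d in orbit K c] = orbit K (restr f c).
Proof.
apply/seteqP; split=> d.
  by move=> [_ [g Kg <-] <-]; exists g => //; rewrite cact_restr.
by move=> [g Kg <-]; exists (cact a g c); [exists g | rewrite cact_restr].
Qed.

Lemma quot_restr_subproof k m (f : cube_map k m) (O : quot_cell m) :
  exists c, [set restr f d | d in sval O] = orbit K c.
Proof. by case: O => [O [c e]] /=; exists (restr f c); rewrite e restr_orbit. Qed.

Definition quot_restr k m (f : cube_map k m) (O : quot_cell m) : quot_cell k :=
  exist _ _ (quot_restr_subproof f O).

Lemma quot_restr_id k (O : quot_cell k) : quot_restr (cube_id k) O = O.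
Proof.
apply: sig_eq; rewrite /= -[RHS]image_id.
by apply: eq_imagel => d _; exact: restr_id.
Qed.

Lemma quot_restr_comp k m n (f : cube_map m n) (g : cube_map k m)
    (O : quot_cell n) :
  quot_restr (cube_comp f g) O = quot_restr g (quot_restr f O).
Proof.
apply: sig_eq; rewrite /= image_comp.
by apply: eq_imagel => d _; exact: restr_comp.
Qed.

Definition quot_complex : cube_complex :=
  CubeComplex quot_restr_id quot_restr_comp.

End Quotient.

Section InducedAction.
Variables (G : groupType) (X : cube_complex) (a : cube_action G X).
Variable Q : subquotient G.
Local Notation H := (sq_num Q).
Local Notation N := (sq_den Q).
Local Notation XN := (quot_complex a N).

Definition set_act (C : set G) k (O : set (cell X k)) : set (cell X k) :=
  [set d | exists x c, [/\ C x, O c & d = cact a x c]].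

Lemma set_act_coset x k (c : cell X k) : H x ->
  set_act (lcoset x N) (orbit a N c) = orbit a N (cact a x c).
Proof.
have [N1 NM NV] := sq_den_subgroup Q.
move=> Hx; apply/seteqP; split=> d.
  move=> [_ [_ [[n Nn <-] [m Nm <-] ->]]]; exists (x * (n * m) / x).
    by apply: sq_denJ => //; exact: NM.
  by rewrite -!cactM mulgVK !mulgA.
move=> [n Nn <-]; exists (x * n ^ x), c; split.
- by exists (n ^ x) => //; exact: sq_den_norm.
- by exists 1; rewrite ?cact1.
- by rewrite -cactM conjgE mulVKg.
Qed.

Lemma sq_act_subproof k (C : sq_coset Q) (O : cell XN k) :
  exists c, set_act (sval C) (sval O) = orbit a N c.
Proof.
case: C O => [C [x Hx eC]] [O [c eO]] /=.
by exists (cact a x c); rewrite eC eO set_act_coset.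
Qed.

Definition sq_act k (C : sq_coset Q) (O : cell XN k) : cell XN k :=
  exist _ _ (sq_act_subproof C O).

Lemma sq_act1 k (O : cell XN k) : sq_act 1 O = O.
Proof.
have [H1 _ _] := sq_num_subgroup Q.
have -> : (1 : sq_coset Q) = sq_class H1 by exact: sq_oneE.
case: O => [O [c e]]; apply: sig_eq; rewrite /= e.
by rewrite set_act_coset // cact1.
Qed.

Lemma sq_actM k (C D : sq_coset Q) (O : cell XN k) :
  sq_act (C * D) O = sq_act C (sq_act D O).
Proof.
have [_ HM _] := sq_num_subgroup Q.
have [x [Hx ->]] := sq_classP C; have [y [Hy ->]] := sq_classP D.
have -> : sq_class Hx * sq_class Hy = sq_class (HM _ _ Hx Hy) by exact: sq_mulE.
case: O => [O [c e]]; apply: sig_eq; rewrite /= e.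
by rewrite !set_act_coset ?cactM //; exact: HM.
Qed.

Lemma sq_act_restr k m (f : cube_map k m) (C : sq_coset Q) (O : cell XN m) :
  restr f (sq_act C O) = sq_act C (restr f O).
Proof.
have [x [Hx ->]] := sq_classP C.
case: O => [O [c e]]; apply: sig_eq; rewrite /= e.
by rewrite set_act_coset // !restr_orbit set_act_coset // cact_restr.
Qed.

Definition sq_action : cube_action (sq_coset Q) XN :=
  CubeAction sq_act1 sq_actM sq_act_restr.

End InducedAction.

Section XM.
Variable M : scomplex.

(** The vertex [a * \prod_(v in tau) v] of the cube [(a, sigma)], where [s] is an
    enumeration of [sigma] and [x] the indicator of [tau]. *)
Definition cube_vertex (a : raag M) m (s : 'I_m -> M) (x : hcube m) : raag M :=
  a * \prod_(i < m | x i) raag_gen (s i).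

(** Cubes of [X_M] are determined by their vertices, so a parametrized k-cube is
    encoded by the images of the vertices of [[0, 1]^k]: it parametrizes a face
    of some cube [(a, sigma)]. *)
Definition is_cube k (phi : hcube k -> raag M) :=
  exists a m (s : 'I_m -> M) (f : cube_map k m),
    [/\ injective s, simplex [fset s i | i in 'I_m]%fset &
        phi = cube_vertex a s \o f].

Definition XM_cell k : Type := {phi : hcube k -> raag M | is_cube phi}.

Lemma XM_restr_subproof k m (f : cube_map k m) (c : XM_cell m) :
  is_cube (sval c \o f).
Proof.
case: c => c [a [n [s [g [sI sS e]]]]] /=; rewrite e.
by exists a, n, s, (cube_comp g f).
Qed.

Definition XM_restr k m (f : cube_map k m) (c : XM_cell m) : XM_cell k :=
  exist _ _ (XM_restr_subproof f c).

Lemma XM_restr_id k (c : XM_cell k) : XM_restr (cube_id k) c = c.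
Proof. exact: sig_eq. Qed.

Lemma XM_restr_comp k m n (f : cube_map m n) (g : cube_map k m)
    (c : XM_cell n) :
  XM_restr (cube_comp f g) c = XM_restr g (XM_restr f c).
Proof. exact: sig_eq. Qed.

Definition XM : cube_complex := CubeComplex XM_restr_id XM_restr_comp.

Variables (L : scomplex) (p : M -> L).

Definition vertex_act (h : raag_deck p) (b : raag M) : raag M :=
  rd_raag h * deck_raag (rd_deck h) b.

Lemma XM_act_subproof k (h : raag_deck p) (c : XM_cell k) :
  is_cube (vertex_act h \o sval c).
Proof.
case: h c => [b g] [c [a [m [s [f [sI sS e]]]]]] /=; rewrite {}e.
exists (b * deck_raag g a), m, (g \o s), f; split.
- by apply: inj_comp => //; exact: can_inj (deck_funK g).
- have := deck_simplex g sS; apply: simplexS.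
  apply/fsubsetP => _ /imfsetP[i _ ->] /=.
  by apply: in_imfset; exact: in_imfset.
- apply/funext => x; rewrite /vertex_act /cube_vertex /= deck_raagM mulgA.
  congr (_ * _).
  rewrite (big_morph _ (deck_raagM g) (deck_raag1 g)).
  by apply: eq_bigr => i _; rewrite deck_raag_gen.
Qed.

Definition XM_act k (h : raag_deck p) (c : XM_cell k) : XM_cell k :=
  exist _ _ (XM_act_subproof h c).

Lemma XM_act1 k (c : XM_cell k) : XM_act 1 c = c.
Proof.
apply: sig_eq; apply/funext => x.
by rewrite /= /vertex_act deck_raag_one mul1g.
Qed.

Lemma XM_actM k (g h : raag_deck p) (c : XM_cell k) :
  XM_act (g * h) c = XM_act g (XM_act h c).
Proof.
apply: sig_eq; apply/funext => x.
by rewrite /= /vertex_act /= deck_raag_mul deck_raagM mulgA.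
Qed.

Lemma XM_act_restr k m (f : cube_map k m) (h : raag_deck p) (c : cell XM m) :
  restr f (XM_act h c : cell XM m) = XM_act h (restr f c).
Proof. exact: sig_eq. Qed.

Definition XM_action : cube_action (raag_deck p) XM :=
  @CubeAction _ XM XM_act XM_act1 XM_actM XM_act_restr.

Definition XLM (S : set int) : cube_complex := quot_complex XM_action (NS p S).

Definition XLM_action S n (hS : shift_invariant S n) :
    cube_action (GLMZ p hS) (XLM S) :=
  sq_action XM_action (GLMZ_sq p hS).

Definition virtually_special S n (hS : shift_invariant S n) :=
  exists K : set (GLMZ p hS),
    [/\ subgroup K, torsion_free K, finite_index K &
        special (quot_complex (XLM_action hS) K)].

End XM.

Arguments XM_action {M L} p.
Arguments XLM {M L} p S.
Arguments XLM_action {M L} p {S n} hS.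
Arguments virtually_special {M L} p {S n} hS.

Definition periodic (S : set int) :=
  exists n : int, (0 < n)%R /\ shift_invariant S n.

Definition profinite_int : Type := int.

HB.instance Definition _ := Choice.on profinite_int.

Lemma periodic_cover : \bigcup_(S in periodic) S = [set: profinite_int].
Proof.
apply/seteqP; split=> // x _; exists setT => //.
by exists 1%R; split=> //; apply/seteqP; split=> // y _; exists (y - 1)%R; rewrite ?subrK.
Qed.

Lemma periodic_join (A B : set int) (x : profinite_int) :
  periodic A -> periodic B -> A x -> B x ->
  exists C, [/\ periodic C, C x & C `<=` A `&` B].
Proof.
move=> [n [n0 hA]] [m [m0 hB]] Ax Bx; exists (A `&` B); split=> //.
exists (m * n)%R; split; first exact: mulr_gt0.
apply/seteqP; split=> [_ [y [Ay By] <-]|y [Ay By]].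
  by split; [exact: shift_invariantM|rewrite mulrC; exact: shift_invariantM].
exists (y - m * n)%R; last by rewrite subrK.
split; first by rewrite -mulNr; exact: shift_invariantM.
by rewrite mulrC -mulNr; exact: shift_invariantM.
Qed.

HB.instance Definition _ :=
  isBaseTopological.Build profinite_int periodic_cover periodic_join.

(* Main.v *)
From HB Require Import structures.
Require Import Defs.
From Stdlib Require Import Relation_Operators.
From mathcomp Require Import all_boot all_order all_algebra finmap zify.
From mathcomp Require Import boolp classical_sets functions cardinality topology.

Set Implicit Arguments.
Unset Strict Implicit.
Unset Printing Implicit Defensive.

Import Order.TTheory GRing.Theory Num.Theory.

Local Open Scope classical_set_scope.
Local Open Scope ring_scope.

(** Write [G] for [A_M ><| pi] and [N(S)] for the subgroup [NS p S]. The
    elements of [G_L^M(S)] act on the complex [X_M / N(S)], and everything rests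
    on a normal form theorem for the cosets of [N(S)], in the style of the
    solution of the word problem for right-angled Artin groups. An element of
    [G] is a word in the letters [v^+-1], with [v] a vertex of [M], preceded by
    a deck transformation. Modulo [N(S)] one may, besides exchanging adjacent
    letters and cancelling, twist a word by a deck transformation at every
    vertex whose height is in [S]. A word without possible cancellation is
    determined, up to exchanges and twists, by its coset ([normal_form]).
    Exchanges and twists do not interfere because [L] is a flag complex and deck
    transformations act freely ([adjacent_deck_triangle]). The theorem has four
    consequences.

    First, [pi] injects into the stabilizers of the vertices at heights outside
    [S] ([stabilizer_NS]). Second, an element of finite order is, modulo [N(S)],
    a conjugate of a deck transformation ([torsion_elliptic]): otherwise the
    powers of a shortest conjugate would be reduced words. Third, being reduced
    is an open condition: it survives in the quotient of [M] by a normal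
    subgroup of [pi] that avoids finitely many elements, and when [S] is
    replaced by a set with the same elements in a bounded interval ([NS_open]).
    Fourth, the distance to a vertex is additive on squares ([len_square]), so
    that intervals are closed under completing squares.

    For virtual torsion-freeness, take a torsion-free normal subgroup [N] of
    finite index in [pi]. The covering [M / N] of [L] is finite and regular, and
    its group has by hypothesis a torsion-free subgroup of finite index. The
    preimage of that subgroup is torsion-free: a torsion element is conjugate to
    a deck transformation, which must lie in [N] by the first consequence,
    applied to [M / N].

    For residual finiteness, the third consequence moves a given non-trivial
    element to the group of a finite covering and of a periodic set containing
    [S]. There a special quotient by [K] labels the edges of the complex by
    hyperplanes, refined by a parity. In the interval between the base vertex
    and its image under the element, which is finite, each label acts by
    exchanging the ends of the edges that carry it; specialness says that each
    label occurs at most once at a vertex, and that labels which cross commute.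
    A subgroup of finite index in [K] thus acts on a finite set, through the
    labels read along paths, and the given element moves one end of the interval
    to the other ([special_separates]). *)

(** * Coverings of flag complexes and deck transformations *)

Section Covering.
Local Open Scope group_scope.
Variables (M L : scomplex) (p : M -> L).

Lemma adjacentC (K : scomplex) (v w : K) : adjacent v w -> adjacent w v.
Proof.
move=> [nvw svw]; split; first by move=> e; apply: nvw.
by rewrite fsetUC.
Qed.

Lemma fset2_sub (T : choiceType) (s : {fset T}) x y :
  x \in s -> y \in s -> ([fset x; y] `<=` s)%fset.
Proof. by move=> xs ys; apply/fsubsetP => z; rewrite !inE => /orP[]/eqP->. Qed.

Lemma simplex_adjacent (K : scomplex) (s : {fset K}) v w :
  simplex s -> v \in s -> w \in s -> v <> w -> adjacent v w.
Proof.
by move=> ss vs ws nvw; split=> //; apply: simplexS ss; exact: fset2_sub.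
Qed.

Lemma imfset_fset2 (T U : choiceType) (f : T -> U) x y :
  [fset f z | z in [fset x; y]]%fset = [fset f x; f y]%fset.
Proof.
apply/fsetP => u; rewrite !inE; apply/imfsetP/idP => [[z /=]|].
  by rewrite !inE => /orP[]/eqP-> ->; rewrite eqxx ?orbT.
by move=> /orP[]/eqP->; [exists x|exists y]; rewrite //= !inE eqxx ?orbT.
Qed.

Lemma deck_adjacent (g : deck p) x y : adjacent x y -> adjacent (g x) (g y).
Proof.
move=> [nxy sxy]; split; first by move=> /(can_inj (deck_funK g)).
by have := deck_simplex g sxy; rewrite imfset_fset2.
Qed.

Hypothesis cov : covering p.

Lemma covering_adjacent x y : adjacent x y -> adjacent (p x) (p y).
Proof.
have [_ sp ip _] := cov => -[nxy sxy]; split.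
  by move=> e; apply: nxy; apply: (ip _ sxy) => //; rewrite !inE eqxx ?orbT.
by have := sp _ sxy; rewrite imfset_fset2.
Qed.

Lemma adjacent_lift_unique x y z :
  adjacent x y -> adjacent x z -> p y = p z -> y = z.
Proof.
have [_ sp ip lp] := cov => axy axz e.
have [nxy sxy] := axy; have [nxz sxz] := axz.
have [_ spxy] := covering_adjacent axy.
have pxin : p x \in [fset p x; p y]%fset by rewrite !inE eqxx.
have [s [_ us]] := lp x _ spxy pxin.
have exy : s = [fset x; y]%fset.
  by apply: us; split; rewrite ?imfset_fset2 // !inE eqxx.
have exz : s = [fset x; z]%fset.
  by apply: us; split; rewrite ?imfset_fset2 ?e // !inE eqxx.
have: y \in [fset x; z]%fset by rewrite -exz exy !inE eqxx orbT.
by rewrite !inE => /orP[]/eqP // exy'; case: nxy.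
Qed.

Lemma adjacent_deckN x (g : deck p) : ~ adjacent x (g x).
Proof. by move=> /covering_adjacent[]; rewrite deck_over. Qed.

Hypothesis conn : sconnected M.

(** A deck transformation is determined along edge paths, since an edge lifts
    uniquely at a given end. *)
Lemma deck_free (g : deck p) x : g x = x -> g = 1.
Proof.
move=> gx; apply: deck_eq => y; have: clos_refl_trans M (@adjacent M) x y.
  exact: conn.
move=> xy; elim: xy gx => // {x y} [x y axy gx|x y z _ IHxy _ IHyz gx].
  apply: (@adjacent_lift_unique x _ _ _ axy); last by rewrite deck_over.
  by rewrite -[x in adjacent x _]gx; exact: deck_adjacent.
by apply: IHyz; exact: IHxy.
Qed.

Lemma adjacent_deck_edge x y (g : deck p) :
  adjacent x y -> adjacent x (g y) -> g = 1.
Proof.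
move=> axy axgy; apply: (@deck_free g y).
by apply: adjacent_lift_unique axgy axy _; rewrite deck_over.
Qed.

Hypothesis L_flag : flag L.

(** The three vertices have pairwise adjacent images, so, [L] being a flag
    complex, they lift to a triangle through [y], whose other two vertices can
    only be [x] and [z]. This is the cube condition of the normal form theory
    below. *)
Lemma adjacent_deck_triangle x y z (g : deck p) :
  adjacent x y -> adjacent y z -> adjacent x (g z) -> g = 1.
Proof.
move=> axy ayz axgz.
have [_ sp ip lp] := cov.
have pxy := covering_adjacent axy; have pyz := covering_adjacent ayz.
have pxz := covering_adjacent axgz; rewrite deck_over in pxz.
have st : simplex [fset p x; p y; p z]%fset.
  apply: L_flag => u v; rewrite !inE => /orP[/orP[]|]/eqP-> /orP[/orP[]|]/eqP-> //;
  by move=> _ //; exact: adjacentC.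
have yin : p y \in [fset p x; p y; p z]%fset by rewrite !inE eqxx orbT.
have [s [[ss ys es] _]] := lp y _ st yin.
have lift u : adjacent y u -> p u \in [fset p x; p y; p z]%fset -> u \in s.
  move=> ayu; rewrite -es => /imfsetP[u' /= u's eu].
  suff -> : u = u' by [].
  apply: (adjacent_lift_unique ayu _ eu).
  apply: (simplex_adjacent ss) => // e.
  by have [] := covering_adjacent ayu; rewrite eu -e.
have xs : x \in s by apply: lift; [exact: adjacentC|rewrite !inE eqxx].
have zs : z \in s by apply: lift => //; rewrite !inE eqxx !orbT.
apply: (@adjacent_deck_edge x z) => //; apply: (simplex_adjacent ss) => // e.
by have [] := pxz; rewrite e.
Qed.

End Covering.

(** * Framed words *)

Section Letters.
Local Open Scope group_scope.
Variables (M L : scomplex) (p : M -> L).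
Local Notation letter := (M * bool)%type.
Local Notation deck := (deck p).
Implicit Types (x y z : letter) (g k : deck) (u w : word M).

Definition linv x : letter := (x.1, ~~ x.2).
Definition lact g x : letter := (g x.1, x.2).
(** The letters [x] and [y] are sides of a square, whatever their signs. *)
Definition ladj x y := adjacent x.1 y.1.
Definition lelt x : raag M := pclass _ [:: x].

Lemma linvK : involutive linv.
Proof. by case=> v b; rewrite /linv /= negbK. Qed.

Lemma lact1 x : lact 1 x = x. Proof. by case: x. Qed.
Lemma lactM g k x : lact (g * k) x = lact g (lact k x). Proof. by []. Qed.
Lemma lactK g : cancel (lact g) (lact g^-1).
Proof. by move=> x; rewrite -lactM mulVg lact1. Qed.
Lemma lactVK g : cancel (lact g^-1) (lact g).
Proof. by move=> x; rewrite -lactM mulgV lact1. Qed.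
Lemma lact_inv g x : lact g (linv x) = linv (lact g x). Proof. by []. Qed.

Lemma ladjC x y : ladj x y -> ladj y x. Proof. exact: adjacentC. Qed.
Lemma ladj_act g x y : ladj x y -> ladj (lact g x) (lact g y).
Proof. exact: deck_adjacent. Qed.
(** The framed word [(g, u)] stands for the element [g * u_n * ... * u_1] of
    [A_M ><| pi], where [u = [:: u_1; ...; u_n]]: the letters are stored from the
    last one to the first one, and each is written in the frame reached at the
    end of the word, so that appending a letter is a right multiplication and
    leaves the others unchanged. *)
Definition framed : Type := (deck * word M)%type.
Implicit Types s t r q : framed.

Definition app s x : framed := (s.1, x :: s.2).
(** Multiplication on the right by [k^-1]. *)
Definition reframe k s : framed := (s.1 * k^-1, [seq lact k x | x <- s.2]).
Definition fht s : int := word_ht s.2.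

Lemma reframe1 s : reframe 1 s = s.
Proof.
case: s => g u; rewrite /reframe /= invg1 mulg1; congr pair.
by rewrite -[RHS]map_id; apply: eq_map => x; rewrite lact1.
Qed.

Lemma reframeM g k s : reframe (g * k) s = reframe g (reframe k s).
Proof.
case: s => h u; rewrite /reframe /= invgM mulgA; congr pair.
by rewrite -map_comp; apply: eq_map.
Qed.

Lemma reframeK g : cancel (reframe g) (reframe g^-1).
Proof. by move=> s; rewrite -reframeM mulVg reframe1. Qed.
Lemma reframeVK g : cancel (reframe g^-1) (reframe g).
Proof. by move=> s; rewrite -reframeM mulgV reframe1. Qed.

Lemma reframe_app k s x : reframe k (app s x) = app (reframe k s) (lact k x).
Proof. by []. Qed.

Lemma size_reframe k s : size (reframe k s).2 = size s.2.
Proof. by rewrite size_map. Qed.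

Lemma fht_reframe k s : fht (reframe k s) = fht s.
Proof. by rewrite /fht /word_ht big_map. Qed.

Lemma fht_app s x : fht (app s x) = (word_ht [:: x] + fht s)%R.
Proof. by rewrite /fht /word_ht !big_cons big_nil addr0. Qed.

Lemma fht_appC s x y : fht (app (app s x) y) = fht (app (app s y) x).
Proof. by rewrite !fht_app addrCA. Qed.

Lemma app_inj s t x y : app s x = app t y -> s = t /\ x = y.
Proof. by case: s t => [g u] [h v] [-> -> ->]. Qed.

Lemma framedP s : (exists g, s = (g, [::])) \/ exists s' x, s = app s' x.
Proof. by case: s => g [|x u]; [left; exists g|right; exists (g, u), x]. Qed.

End Letters.

(** * Equivalence of framed words *)

Section NormalForm.
Local Open Scope group_scope.
Variables (M L : scomplex) (p : M -> L).
Local Notation letter := (M * bool)%type.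
Local Notation deck := (deck p).
Local Notation framed := (framed p).
Implicit Types (x y z : letter) (g k : deck) (s t r q : framed).

Hypothesis cov : covering p.
Hypothesis conn : sconnected M.
Hypothesis L_flag : flag L.

Lemma lact_free k x : lact k x = x -> k = 1.
Proof. by case: x => v b [] /(deck_free cov conn). Qed.
Lemma ladj_actN k x : ~ ladj x (lact k x).
Proof. exact: adjacent_deckN. Qed.
Lemma ladj_act_edge k x y : ladj x y -> ladj x (lact k y) -> k = 1.
Proof. exact: adjacent_deck_edge. Qed.
Lemma ladj_act_triangle k x y z :
  ladj x y -> ladj y z -> ladj x (lact k z) -> k = 1.
Proof. exact: adjacent_deck_triangle. Qed.

Variable S : set int.

(** The deck transformations by which a word may be twisted at a vertex of
    height [h]: [b pi b^-1] lies in [NS p S] when the height of [b] is in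
    [S]. *)
Definition frame_change (h : int) k := k = 1 \/ S h.

Lemma frame_change1 h : frame_change h 1. Proof. by left. Qed.
Lemma frame_changeM h g k :
  frame_change h g -> frame_change h k -> frame_change h (g * k).
Proof. by move=> [->|?]; [rewrite mul1g|right]. Qed.
Lemma frame_changeV h k : frame_change h k -> frame_change h k^-1.
Proof. by move=> [->|?]; [rewrite invg1; left|right]. Qed.
Lemma frame_changeJ h g k : frame_change h k -> frame_change h (k ^ g).
Proof. by move=> [->|?]; [rewrite conj1g; left|right]. Qed.

(** The equivalence generated by exchanging adjacent letters and by twisting the
    part of a word before a vertex whose height is in [S], presented by
    recursion on the last letter: two words are equivalent when, up to a twist
    at their end, they have the same last letter, or commuting last letters that
    both can be stripped off down to a common word [q]. In this form right
    cancellation holds by inspection and the content of the theory is in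
    transitivity. *)
Inductive fequiv : framed -> framed -> Prop :=
| FNil g g' : g = g' \/ S 0%R -> fequiv (g, [::]) (g', [::])
| FSame s s' x k : frame_change (fht (app s x)) k -> fequiv s s' ->
    fequiv (app s x) (reframe k (app s' x))
| FSwap q s s' x y k : frame_change (fht (app s x)) k -> ladj x y ->
    fequiv s (app q y) -> fequiv s' (app q x) ->
    fequiv (app s x) (reframe k (app s' y)).

Definition same_end s x s' x' :=
  (x = x' /\ fequiv s s') \/
  (ladj x x' /\ exists q, fequiv s (app q x') /\ fequiv s' (app q x)).

Lemma fequiv_appP s x t : fequiv (app s x) t ->
  exists s' x' k, [/\ frame_change (fht (app s x)) k,
    t = reframe k (app s' x') & same_end s x s' x'].
Proof.
move e : (app s x) => r h; case: h e => {r t}.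
- by move=> g g' _; case: s.
- move=> r r' y k hk h /app_inj[er ey]; subst r y.
  by exists r', x, k; split=> //; left.
- move=> q r r' y z k hk yz h h' /app_inj[er ey]; subst r y.
  by exists r', z, k; split=> //; right; split=> //; exists q.
Qed.

Lemma same_endP s x s' x' k : frame_change (fht (app s x)) k ->
  same_end s x s' x' -> fequiv (app s x) (reframe k (app s' x')).
Proof.
move=> hk [[<- h]|[xx' [q [h h']]]]; first exact: FSame.
exact: FSwap h h'.
Qed.

Lemma fequiv_size s t : fequiv s t -> size s.2 = size t.2.
Proof.
elim=> [//|r r' x k _ _ e|q r r' x y k _ _ _ e _ e'].
  by rewrite size_reframe /= e.
by rewrite size_reframe /= e e'.
Qed.

Lemma fequiv_fht s t : fequiv s t -> fht s = fht t.
Proof.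
elim=> // {s t}.
  by move=> s s' x k _ _ e; rewrite fht_reframe !fht_app e.
by move=> q s s' x y k _ _ _ e _ e'; rewrite fht_reframe !fht_app e e' !fht_app addrCA.
Qed.

Lemma fequiv_reframe k s t : fequiv s t -> fequiv (reframe k s) (reframe k t).
Proof.
elim=> {s t}.
- by move=> g g' [->|S0]; apply: FNil; [left|right].
- move=> s s' x g hg h IH; rewrite -reframeM conjgCV.
  rewrite reframeM [reframe k (app s' x)]reframe_app reframe_app.
  by apply: FSame => //; rewrite -reframe_app fht_reframe; exact: frame_changeJ.
- move=> q s s' x y g hg xy h IH h' IH'; rewrite -reframeM conjgCV.
  rewrite reframeM [reframe k (app s' y)]reframe_app reframe_app.
  apply: (FSwap (q := reframe k q)) => //; last exact: ladj_act.
  by rewrite -reframe_app fht_reframe; exact: frame_changeJ.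
Qed.

Lemma fequiv_refl s : fequiv s s.
Proof.
case: s => g; elim=> [|x u IH]; first by apply: FNil; left.
have := @FSame (g, u) (g, u) x 1 (frame_change1 _) IH.
by rewrite reframe1.
Qed.

Lemma fequiv_sym s t : fequiv s t -> fequiv t s.
Proof.
elim=> {s t}.
- by move=> g g' [->|S0]; apply: FNil; [left|right].
- move=> s s' x k hk h IH; rewrite -[app s x](reframeK k) [reframe k (app s x)]reframe_app.
  rewrite reframe_app; apply: FSame; last exact: fequiv_reframe.
  by rewrite -reframe_app fht_reframe fht_app -(fequiv_fht h) -fht_app; exact: frame_changeV.
- move=> q s s' x y k hk xy h IH h' IH'.
  rewrite -[app s x](reframeK k) [reframe k (app s x)]reframe_app reframe_app.
  apply: (FSwap (q := reframe k q)).
  + rewrite -reframe_app fht_reframe fht_app (fequiv_fht h') -fht_app -fht_appC fht_app.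
    by rewrite -(fequiv_fht h) -fht_app; exact: frame_changeV.
  + exact/ladj_act/ladjC.
  + by have := fequiv_reframe k h'.
  + by have := fequiv_reframe k h.
Qed.

Lemma fequiv_same s t x : fequiv s t -> fequiv (app s x) (app t x).
Proof.
by move=> h; rewrite -[app t x]reframe1; apply: FSame => //; exact: frame_change1.
Qed.

Lemma fequiv_swap s x y :
  ladj x y -> fequiv (app (app s x) y) (app (app s y) x).
Proof.
move=> xy; rewrite -[X in fequiv _ X]reframe1.
apply: (FSwap (q := s)); [exact: frame_change1|exact: ladjC| |];
  exact: fequiv_refl.
Qed.

Lemma fequiv_frame s k : frame_change (fht s) k -> fequiv s (reframe k s).
Proof.
case: s => g [|x u] hk.
  case: hk => [->|hS]; first by rewrite reframe1; exact: fequiv_refl.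
  by apply: FNil; right; move: hS; rewrite /fht /word_ht big_nil.
by rewrite -[(g, x :: u)]/(app (g, u) x); apply: FSame => //; exact: fequiv_refl.
Qed.

(** The essential case is a sequence of exchanges of last letters [x], [y], [z],
    where [q x] and [q' z] are equivalent to a common word. By induction these
    end in turn with [z] and [x], and [adjacent_deck_triangle] shows that no
    twist intervenes: this is the coherence of the three squares around a corner
    of a cube. *)
Lemma fequiv_trans : forall t s r, fequiv s t -> fequiv t r -> fequiv s r.
Proof.
move=> t; move: {2}(size t.2) (leqnn (size t.2)) => n.
elim: n t => [|n IH] t tn s r st tr.
  have e : size t.2 = 0%N by case: (size t.2) tn.
  have [es er] := (fequiv_size st, fequiv_size tr).
  case: tr e st er es {tn} => {t r}; first last.
  - by [].
  - by [].
  move=> g g' h _ st _ _; case: s st => g'' u st.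
  move: (st) => /fequiv_size /=; case: u st => // st _.
  inversion st as [a b h' e1 e2| |]; subst.
  by apply: FNil; case: h h' => [->|?] [->|?]; [left|right|right|right].
have nt0 : (size t.2 < n.+1)%N \/ size t.2 = n.+1.
  by move: tn; rewrite leq_eqVlt => /orP[/eqP|]; [right|left].
case: nt0 => [tn'|en]; first exact: (IH t).
have es := fequiv_size st; rewrite en in es.
case: (framedP s) es st => [[g -> //]|[s' [x -> /=]]] {s} [sn] st; move: s' sn st => s sn st.
have [t' [y [k [hk et core1]]]] := fequiv_appP st; subst t.
have tr' : fequiv (app t' y) (reframe k^-1 r).
  by rewrite -(reframeK k (app t' y)); exact: fequiv_reframe.
have [r' [z [g [hg er core2]]]] := fequiv_appP tr'.
have {er} er : r = reframe (k * g) (app r' z) by rewrite reframeM -er reframeVK.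
rewrite {r}er in tr tr' *; apply: same_endP.
  apply: frame_changeM => //; move: (fequiv_fht st); rewrite fht_reframe => ->.
  exact: hg.
have t'n : (size t'.2 <= n)%N by move: tn; rewrite size_reframe.
have hsz q v : fequiv t' (app q v) -> (size q.2 < n)%N.
  by move=> /fequiv_size e; move: t'n; rewrite e.
case: core1 => [[ex h1]|[xy [q [h1 h1']]]].
  subst y; case: core2 => [[ez h2]|[xz [q' [h2 h2']]]].
    by left; split=> //; exact: (IH t').
  by right; split=> //; exists q'; split=> //; exact: (IH t').
case: core2 => [[ez h2]|[yz [q' [h2 h2']]]].
  subst z; right; split=> //; exists q; split=> //.
  by apply: (IH t') => //; exact: fequiv_sym.
have hq := hsz _ _ h1'; have hq' := hsz _ _ h2.
have qq' : fequiv (app q x) (app q' z) by apply: (IH t') => //; exact: fequiv_sym.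
have qq'' : (size (app q' y).2 <= n)%N by [].
(* Two exchanges in a row: compare the common words [q] and [q']. *)
have [a [b [m [hm em core]]]] := fequiv_appP qq'.
have {em} [em ez] : q' = reframe m a /\ z = lact m b by apply: app_inj.
have ea : a = reframe m^-1 q' by rewrite em reframeK.
have eb : b = lact m^-1 z by rewrite ez lactK.
subst a b; case: core => [[exz hqq]|[xz [c [hqc hqc']]]].
  have m1 : m = 1.
    apply: (@ladj_act_edge m y x); first exact: ladjC.
    by rewrite exz lactVK.
  rewrite m1 invg1 in hqq exz; rewrite reframe1 in hqq; rewrite lact1 in exz.
  left; split=> //; subst z.
  apply: (IH (app q y)) => //; apply: (IH (app q' y)) => //; last exact: fequiv_sym.
  exact: fequiv_same.
have m1 : m = 1.
  apply: invg_inj; rewrite invg1.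
  exact: (@ladj_act_triangle m^-1 x y z).
rewrite m1 invg1 lact1 in xz hqc hqc'; rewrite reframe1 in hqc'.
right; split=> //; exists (app c y); split.
  apply: (IH (app q y)) => //; apply: (IH (app (app c z) y)).
  - by have := fequiv_size hqc => /= <-.
  - exact: fequiv_same.
  - exact/fequiv_swap/ladjC.
apply: (IH (app q' y)) => //; apply: (IH (app (app c x) y)).
- by have := fequiv_size hqc' => /= <-.
- exact: fequiv_same.
- exact/fequiv_swap.
Qed.

Lemma fequiv_cancel s t x : fequiv (app s x) (app t x) -> fequiv s t.
Proof.
move=> /fequiv_appP[t' [y [k [hk e core]]]].
have [-> ex] : t = reframe k t' /\ x = lact k y by exact: app_inj.
case: core => [[exy h]|[xy _]]; last first.
  by case: (@ladj_actN k y); rewrite -[lact k y]ex; exact: ladjC.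
have k1 : k = 1 by apply: (@lact_free k x); rewrite {1}exy -ex.
by rewrite k1 reframe1.
Qed.

Definition last_letter s y := exists r, fequiv s (app r y).

Lemma last_letter_equiv s t y : fequiv s t -> last_letter s y -> last_letter t y.
Proof.
by move=> st [r h]; exists r; apply: fequiv_trans h; exact: fequiv_sym.
Qed.

Lemma last_letter_reframe k s y : last_letter s y -> last_letter (reframe k s) (lact k y).
Proof. by move=> [r h]; exists (reframe k r); have := fequiv_reframe k h. Qed.

Lemma last_letter_nil g y : ~ last_letter (g, [::]) y.
Proof. by move=> [r /fequiv_size]. Qed.

Lemma last_letter_app s x y : last_letter (app s x) y <->
  exists k, frame_change (fht (app s x)) k /\
    (lact k y = x \/ (ladj x (lact k y) /\ last_letter s (lact k y))).
Proof.
split=> [[r /fequiv_appP[s' [x' [k [hk e core]]]]]|[k [hk h]]].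
  have [er ey] : r = reframe k s' /\ y = lact k x' by exact: app_inj.
  exists k^-1; split; first exact: frame_changeV.
  rewrite ey lactK; case: core => [[-> _]|[xx' [q [h h']]]]; first by left.
  by right; split=> //; exists q.
suff [r h'] : exists r, same_end s x r (lact k y).
  exists (reframe k^-1 r); rewrite -[y](lactK k) -reframe_app.
  by apply: same_endP => //; exact: frame_changeV.
case: h => [->|[xy [q hq]]].
  by exists s; left; split=> //; exact: fequiv_refl.
exists (app q x); right; split=> //; exists q; split=> //; exact: fequiv_refl.
Qed.

(** The square spanned by [x] and [y] identifies the edges labelled [y] at both
    ends of [x], and no twist can intervene by [adjacent_deck_edge]. *)
Lemma last_letter_adj s x y :
  ladj x y -> last_letter (app s x) y <-> last_letter s y.
Proof.
move=> xy; rewrite last_letter_app; split=> [[k [_ [e|[axy h]]]]|h].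
- by case: (@ladj_actN k y); rewrite e; exact: ladjC.
- by move: h; rewrite (ladj_act_edge xy axy) lact1.
- by exists 1; rewrite lact1; split; [exact: frame_change1|right].
Qed.

Fixpoint reduced_word g (u : word M) : Prop :=
  if u is x :: v then reduced_word g v /\ ~ last_letter (g, v) (linv x) else True.
Definition reduced s := reduced_word s.1 s.2.

Lemma reduced_app s x :
  reduced (app s x) <-> reduced s /\ ~ last_letter s (linv x).
Proof. by case: s. Qed.

Lemma reduced_reframe k s : reduced s -> reduced (reframe k s).
Proof.
case: s => g; elim=> [//|x u IH] [/IH h nD]; split=> // /(last_letter_reframe k^-1).
rewrite -lact_inv lactK -[(_, map _ u)]/(reframe k (g, u)) reframeK; exact: nD.
Qed.

Lemma ladj_linv x y : ladj x (linv y) <-> ladj x y. Proof. by []. Qed.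

Lemma reduced_equiv s t : fequiv s t -> reduced s <-> reduced t.
Proof.
have redE k r : reduced (reframe k r) <-> reduced r.
  by split=> [/(reduced_reframe k^-1)|/(reduced_reframe k)]; rewrite ?reframeK.
have lastE r r' y : fequiv r r' -> last_letter r y <-> last_letter r' y.
  by move=> h; split; apply: last_letter_equiv => //; exact: fequiv_sym.
elim=> {s t} [//|s s' x k hk h IH|q s s' x y k hk xy h IH h' IH'].
  by rewrite redE !reduced_app IH (lastE _ _ _ h).
rewrite redE !reduced_app IH IH' !reduced_app (lastE _ _ _ h) (lastE _ _ _ h').
by rewrite !last_letter_adj // ?ladj_linv; [tauto|exact: ladjC].
Qed.

End NormalForm.

(** * Framed words as elements of the group *)

Section RaagDeck.
Local Open Scope group_scope.
Variables (M L : scomplex) (p : M -> L).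
Local Notation letter := (M * bool)%type.
Local Notation deck := (deck p).
Local Notation framed := (framed p).
Implicit Types (x y z : letter) (g k : deck) (s t r q : framed).
Implicit Types (c d : raag_deck p) (a b : raag M).

Definition relt x : raag_deck p := of_raag p (lelt x).

Lemma of_raagM a b : of_raag p (a * b) = of_raag p a * of_raag p b.
Proof. by rewrite rdM /= deck_raag_one mulg1. Qed.
Lemma of_raagV a : of_raag p a^-1 = (of_raag p a)^-1.
Proof. by apply: (@mulgI _ (of_raag p a)); rewrite -of_raagM !mulgV. Qed.
Lemma of_deckM g k : of_deck (g * k) = of_deck g * of_deck k.
Proof. by rewrite rdM /= deck_raag1 mulg1. Qed.
Lemma of_deckV g : of_deck g^-1 = (of_deck g)^-1.
Proof. by apply: (@mulgI _ (of_deck g)); rewrite -of_deckM !mulgV. Qed.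
Lemma of_deck_raag g a : of_deck g * of_raag p a = of_raag p (deck_raag g a) * of_deck g.
Proof. by rewrite !rdM /= mul1g mulg1 deck_raag1 mulg1 mul1g. Qed.
Lemma rd_split c : c = of_raag p (rd_raag c) * of_deck (rd_deck c).
Proof. by case: c => a g; rewrite rdM /= deck_raag1 mulg1 mul1g. Qed.
Lemma rd_ht_deck g : rd_ht (of_deck g) = 0%R.
Proof. exact: (rd_ht1 p). Qed.
Lemma lelt_linv x : lelt x * lelt (linv x) = 1.
Proof. by rewrite -pclassM; apply/pclassP; case: x => v b; exact: WordCancel. Qed.
Lemma lelt_linvV x : lelt (linv x) = (lelt x)^-1.
Proof. by apply: (@mulgI _ (lelt x)); rewrite lelt_linv mulgV. Qed.
Lemma relt_linv x : relt (linv x) = (relt x)^-1.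
Proof. by rewrite /relt lelt_linvV of_raagV. Qed.

Lemma deck_raag_lelt g x : deck_raag g (lelt x) = lelt (lact g x).
Proof. by rewrite deck_raagE; case: x. Qed.
Lemma of_deck_relt g x : of_deck g * relt x = relt (lact g x) * of_deck g.
Proof. by rewrite of_deck_raag deck_raag_lelt. Qed.

Lemma lelt_comm x y : ladj x y -> lelt x * lelt y = lelt y * lelt x.
Proof.
have commV (G : groupType) (u v : G) : u * v = v * u -> u^-1 * v = v * u^-1.
  by move=> e; apply: (@mulgI _ u); rewrite mulVKg mulgA e mulgK.
have pos (v w : M) : adjacent v w ->
    lelt (v, true) * lelt (w, true) = lelt (w, true) * lelt (v, true).
  move=> vw; have h : (lelt (v, true))^-1 * ((lelt (w, true))^-1 *
      (lelt (v, true) * lelt (w, true))) = 1.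
    rewrite -(lelt_linvV (v, true)) -(lelt_linvV (w, true)).
    rewrite -(pclassM _ [:: (v, true)]) -(pclassM _ [:: (w, false)]).
    rewrite -(pclassM _ [:: (v, false)]).
    by apply/(pclassP (@raag_relators M) _ [::])/WordRel; exists v, w.
  apply: (@mulgI _ ((lelt (v, true))^-1 * (lelt (w, true))^-1)).
  by rewrite -mulgA h mulgA mulgVK mulVg.
have neg (v : M) : lelt (v, false) = (lelt (v, true))^-1 by exact: (lelt_linvV (v, true)).
case: x y => [v []] [w []] /pos h; rewrite ?neg //.
- by symmetry; apply: commV.
- exact: commV.
- by apply: (commV); symmetry; apply: (commV).
Qed.

Lemma relt_comm x y : ladj x y -> relt x * relt y = relt y * relt x.
Proof. by move=> h; rewrite /relt -!of_raagM lelt_comm. Qed.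

(** The value of a framed word in [A_M ><| pi]. *)
Definition ev s : raag_deck p := of_deck s.1 * of_raag p (pclass _ (rev s.2)).

Lemma ev_app s x : ev (app s x) = ev s * relt x.
Proof. by rewrite /ev /= rev_cons -cats1 pclassM of_raagM mulgA. Qed.

Lemma ev_reframe k s : ev (reframe k s) = ev s * of_deck k^-1.
Proof.
rewrite /ev /= of_deckM -!mulgA; congr (_ * _).
rewrite of_deck_raag deck_raagE; congr (of_raag p (pclass _ _) * _).
rewrite -map_rev /word_map -map_comp -[RHS]map_id; apply: eq_map => x.
exact: (lactK k x).
Qed.

Lemma rd_ht_ev s : rd_ht (ev s) = fht s.
Proof.
rewrite rd_htM rd_ht_deck add0r /rd_ht /= raag_htE /fht /word_ht.
exact/perm_big/permPl/perm_rev.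
Qed.

Section RightCosets.
Variable S : set int.

Lemma NS_gen c g : S (rd_ht c) -> NS p S (c * of_deck g * c^-1).
Proof.
move=> Sc H [_]; apply; exists (rd_raag c), (rd_deck c * g / rd_deck c); split=> //.
rewrite {1 2}(rd_split c) of_deckM of_deckV of_deckM.
by rewrite invgM !mulgA.
Qed.

Lemma NS_subgroup : subgroup (NS p S). Proof. exact: smallest_subgroup. Qed.

(** Equality of right cosets of [NS p S], which are preserved by multiplication
    on the right. *)
Definition NSeq c d := NS p S (c * d^-1).

Lemma NSeq_refl c : NSeq c c.
Proof. by rewrite /NSeq mulgV; have [] := NS_subgroup. Qed.
Lemma NSeq_sym c d : NSeq c d -> NSeq d c.
Proof.
by have [_ _ NV] := NS_subgroup => /NV; rewrite invgM invgK.
Qed.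
Lemma NSeq_trans d c e : NSeq c d -> NSeq d e -> NSeq c e.
Proof.
by have [_ NM _] := NS_subgroup => /NM h /h; rewrite mulgA mulgVK.
Qed.
Lemma NSeq_mulr e c d : NSeq c d -> NSeq (c * e) (d * e).
Proof. by rewrite /NSeq mulgKA. Qed.
Lemma NSeq_mull c d : NS p S d -> NSeq (d * c) c.
Proof. by rewrite /NSeq mulgK. Qed.
Lemma NSeq1 c : NSeq c 1 <-> NS p S c.
Proof. by rewrite /NSeq invg1 mulg1. Qed.

Lemma NSeq_frame c k : frame_change S (rd_ht c) k -> NSeq c (c * of_deck k).
Proof.
move=> [->|Sc]; first by rewrite mulg1; exact: NSeq_refl.
by rewrite /NSeq invgM -of_deckV mulgA; exact: NS_gen.
Qed.

(** Each elementary move multiplies the value on the left by an element of [NS p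
    S]: an exchange by [1], a twist after [b] by a conjugate [b k b^-1]. *)
Lemma ev_equiv s t : fequiv S s t -> NSeq (ev s) (ev t).
Proof.
have tw r k : frame_change S (fht r) k -> NSeq (ev r) (ev (reframe k r)).
  move=> hk; rewrite ev_reframe; apply: NSeq_frame; rewrite rd_ht_ev.
  exact: frame_changeV.
elim=> {s t} [g g' [->|S0]|s s' x k hk h IH|q s s' x y k hk xy h IH h' IH'].
- exact: NSeq_refl.
- rewrite /ev /= mulg1 mulg1; have := @NS_gen 1 (g * g'^-1).
  by rewrite rd_ht1 => /(_ S0); rewrite mul1g invg1 mulg1 of_deckM of_deckV.
- apply: NSeq_trans (tw _ _ _).
    by rewrite !ev_app; exact: NSeq_mulr.
  by rewrite fht_app -(fequiv_fht h) -fht_app.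
- apply: NSeq_trans (tw _ _ _); last first.
    rewrite fht_app (fequiv_fht h') -fht_app fht_appC fht_app -(fequiv_fht h).
    by rewrite -fht_app.
  rewrite !ev_app; apply: NSeq_trans (NSeq_mulr _ IH) _.
  rewrite ev_app -mulgA -relt_comm // mulgA -[ev q * _]ev_app.
  by apply: NSeq_mulr; apply: NSeq_sym.
Qed.

End RightCosets.

Lemma NS_conj S c d : NS p S d -> NS p [set h | S (h + rd_ht c)%R] (d ^ c).
Proof.
move=> Nd; apply: (Nd [set d | NS p [set h | S (h + rd_ht c)%R] (d ^ c)]); split.
  have [N1 NM NV] := NS_subgroup [set h | S (h + rd_ht c)%R].
  split=> [|u v|u] /=; first by rewrite conj1g.
    by move=> hu hv; rewrite conjMg; apply: NM.
  by move=> hu; rewrite conjVg; apply: NV.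
move=> _ [b [g [Sb ->]]] /=.
have := @NS_gen [set h | S (h + rd_ht c)%R] (c^-1 * of_raag p b) g.
rewrite conjgE invgM invgK !mulgA; apply.
by rewrite /= rd_htM rd_htV addrAC addNr add0r.
Qed.

Lemma NS_sub S S' c : (S `<=` S')%classic -> NS p S c -> NS p S' c.
Proof.
move=> SS'; apply; split; first exact: NS_subgroup.
by move=> _ [b [g [Sb ->]]]; apply: NS_gen; apply: SS'.
Qed.

End RaagDeck.

(** * The normal form theorem *)

Section NormalFormTheorem.
Local Open Scope group_scope.
Variables (M L : scomplex) (p : M -> L).
Local Notation letter := (M * bool)%type.
Local Notation deck := (deck p).
Local Notation framed := (framed p).
Implicit Types (x y z : letter) (g k : deck) (s t r q : framed) (w : word M).
Implicit Types (c d : raag_deck p) (a b : raag M).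

Hypothesis cov : covering p.
Hypothesis conn : sconnected M.
Hypothesis L_flag : flag L.
Variable S : set int.
Local Notation fequiv := (fequiv S).
Local Notation last_letter := (last_letter S).
Local Notation reduced := (reduced S).
Local Notation fequiv_trans := (fequiv_trans cov conn L_flag).
Local Notation last_letter_equiv := (last_letter_equiv cov conn L_flag).
Local Notation reduced_equiv := (reduced_equiv cov conn L_flag).
Local Notation last_letter_adj := (last_letter_adj cov conn).

(** Right multiplication by a letter on reduced words, in the manner of van der
    Waerden: the letter cancels against a last letter [x^-1] if there is one,
    and is appended otherwise. *)
Definition fmul s x : framed :=
  if pselect (last_letter s (linv x)) is left h then projT1 (cid h) else app s x.

Lemma fmul_last s x : last_letter s (linv x) -> fequiv s (app (fmul s x) (linv x)).
Proof. by move=> h; rewrite /fmul; case: pselect => // h'; case: cid. Qed.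

Lemma fmul_app s x : ~ last_letter s (linv x) -> fmul s x = app s x.
Proof. by move=> h; rewrite /fmul; case: pselect. Qed.

Lemma fmul_uniq s x r : fequiv s (app r (linv x)) -> fequiv (fmul s x) r.
Proof.
move=> h; apply: (fequiv_cancel cov conn (x := linv x)).
by apply: (fequiv_trans _ h); apply/fequiv_sym/fmul_last; exists r.
Qed.

Lemma fmul_equiv s t x : fequiv s t -> fequiv (fmul s x) (fmul t x).
Proof.
move=> st; have [h|h] := pselect (last_letter s (linv x)).
  apply: fmul_uniq; apply: (fequiv_trans st); apply: fmul_last.
  exact: (last_letter_equiv st h).
rewrite !fmul_app //; first exact: fequiv_same.
by move=> h'; apply: h; exact: (last_letter_equiv (fequiv_sym st) h').
Qed.

Lemma last_letter_actE k s y : last_letter (reframe k s) (lact k y) <-> last_letter s y.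
Proof.
split; last exact: last_letter_reframe.
by move=> /(last_letter_reframe k^-1); rewrite reframeK lactK.
Qed.

Lemma fmul_reframe k s x : fequiv (fmul (reframe k s) (lact k x)) (reframe k (fmul s x)).
Proof.
have [h|h] := pselect (last_letter s (linv x)).
  by apply: fmul_uniq; have := fequiv_reframe k (fmul_last h).
rewrite !fmul_app //; first exact: fequiv_refl.
by rewrite -lact_inv => /last_letter_actE.
Qed.

Lemma fmul_reduced s x : reduced s -> reduced (fmul s x).
Proof.
have [h|h] := pselect (last_letter s (linv x)).
  by move=> /(reduced_equiv (fmul_last h)) /reduced_app[].
by rewrite fmul_app // reduced_app.
Qed.

Lemma fmul_linv s x : reduced s -> fequiv (fmul (fmul s x) (linv x)) s.
Proof.
have [h|h] := pselect (last_letter s (linv x)).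
  move=> /(reduced_equiv (fmul_last h)) /reduced_app[_ nD].
  by rewrite [X in fequiv X]fmul_app //; exact/fequiv_sym/fmul_last.
by move=> _; apply: fmul_uniq; rewrite fmul_app // linvK; exact: fequiv_refl.
Qed.

(** Crossing the edge [x] does not change whether a letter adjacent to [x]
    cancels. Both the commutation of the moves [fmul] and the additivity of
    distances on squares come from this. *)
Lemma last_letter_fmul s x y :
  ladj x y -> last_letter (fmul s x) y <-> last_letter s y.
Proof.
move=> xy; have [h|h] := pselect (last_letter s (linv x)); last first.
  by rewrite fmul_app // last_letter_adj.
rewrite -(last_letter_adj _ _ (x := linv x)) //.
by split; apply: last_letter_equiv; [apply: fequiv_sym|]; exact: fmul_last.
Qed.

Lemma fmulC s x y : ladj x y -> fequiv (fmul (fmul s x) y) (fmul (fmul s y) x).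
Proof.
have half x' y' : ladj x' y' -> last_letter s (linv x') -> ~ last_letter s (linv y') ->
    fequiv (fmul (fmul s y') x') (fmul (fmul s x') y').
  move=> xy hx hy; rewrite [fmul (fmul s x') y']fmul_app; last first.
    by move/(last_letter_fmul _ (y := linv y') xy).
  apply: fmul_uniq; rewrite fmul_app //.
  apply: fequiv_trans (fequiv_same _ (fmul_last hx)) _.
  exact: (fequiv_swap S _ (x := linv x')).
move=> xy; have yx := ladjC xy.
have [hx|hx] := pselect (last_letter s (linv x));
  have [hy|hy] := pselect (last_letter s (linv y)).
- apply: fequiv_sym; apply: fmul_uniq; apply: fmul_uniq.
  have hxy : last_letter (fmul s x) (linv y) by apply/last_letter_fmul.
  apply: fequiv_trans (fmul_last hx) _.
  apply: fequiv_trans (fequiv_same _ (fmul_last hxy)) _.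
  exact: (fequiv_swap S _ (x := linv y)).
- by apply: fequiv_sym; exact: half.
- exact: half.
- rewrite fmul_app; last by move/(last_letter_fmul _ (y := linv y) xy).
  rewrite [X in fequiv _ X]fmul_app; last by move/(last_letter_fmul _ (y := linv x) yx).
  rewrite !fmul_app //; exact: fequiv_swap.
Qed.

Lemma word_ht_linv x : word_ht [:: linv x] = (- word_ht [:: x])%R.
Proof. by case: x => v []; rewrite /word_ht !big_seq1 //= opprK. Qed.

Lemma fht_fmul s x : fht (fmul s x) = (fht s + word_ht [:: x])%R.
Proof.
have [h|h] := pselect (last_letter s (linv x)).
  rewrite (fequiv_fht (fmul_last h)) fht_app word_ht_linv.
  by rewrite addrAC addNr add0r.
by rewrite fmul_app // fht_app addrC.
Qed.

Lemma size_fmul s x : size (fmul s x).2 =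
  if `[< last_letter s (linv x) >] then (size s.2).-1 else (size s.2).+1.
Proof.
case: asboolP => h; last by rewrite fmul_app.
by rewrite (fequiv_size (fmul_last h)).
Qed.

Definition wact s w := foldl fmul s w.

Lemma wact_cat s w w' : wact s (w ++ w') = wact (wact s w) w'.
Proof. exact: foldl_cat. Qed.

Lemma wact_reduced s w : reduced s -> reduced (wact s w).
Proof. by elim: w s => //= x w IH s /(fmul_reduced x) /IH. Qed.

Lemma wact_equiv s t w : fequiv s t -> fequiv (wact s w) (wact t w).
Proof. by elim: w s t => //= x w IH s t /(fmul_equiv x) /IH. Qed.

Lemma wact_reframe k s w : fequiv (wact (reframe k s) (word_map k w)) (reframe k (wact s w)).
Proof.
elim: w s => [|x w IH] s /=; first exact: fequiv_refl.
by apply: fequiv_trans (IH _); apply: wact_equiv; exact: fmul_reframe.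
Qed.

Lemma fht_wact s w : fht (wact s w) = (fht s + word_ht w)%R.
Proof.
elim: w s => [|x w IH] s /=; first by rewrite /word_ht big_nil addr0.
by rewrite IH fht_fmul -addrA /word_ht !big_cons big_nil addr0.
Qed.

Lemma size_wact s w : (size (wact s w).2 <= size s.2 + size w)%N.
Proof.
elim: w s => [|x w IH] s /=; first by rewrite addn0.
apply: leq_trans (IH _) _; rewrite addnS -addSn leq_add2r size_fmul.
by case: asboolP => // _; rewrite ltnW // ltnS leq_pred.
Qed.

Lemma wact_word_eq w w' : word_eq (@raag_relators M) w w' ->
  forall s, reduced s -> fequiv (wact s w) (wact s w').
Proof.
elim=> {w w'}.
- by move=> w s _; exact: fequiv_refl.
- by move=> u v _ IH s rs; apply: fequiv_sym; exact: IH.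
- by move=> v u w _ IH _ IH' s rs; apply: fequiv_trans (IH _ rs) (IH' _ rs).
- move=> u u' v v' _ IH _ IH' s rs; rewrite !wact_cat.
  by apply: fequiv_trans (IH' _ (wact_reduced _ rs)); apply: wact_equiv; exact: IH.
- by move=> x b s rs /=; exact: (fmul_linv (x, b)).
- move=> _ [v [w [vw ->]]] s rs /=.
  apply: fequiv_trans (fmul_linv (w, false) rs); apply: fmul_equiv.
  apply: fequiv_trans (fmul_linv (v, false) (fmul_reduced (w, false) rs)).
  by apply: fmul_equiv; apply: fmulC.
Qed.

(** The right action of [A_M ><| pi] on classes of reduced words; it is a
    homomorphism because [fmul] respects the relators. *)
Definition gact s c := reframe (rd_deck c)^-1 (wact s (prepr (rd_raag c))).

Lemma gact_reduced s c : reduced s -> reduced (gact s c).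
Proof. by move=> rs; apply: reduced_reframe; exact: wact_reduced. Qed.

Lemma gact_equiv s t c : fequiv s t -> fequiv (gact s c) (gact t c).
Proof. by move=> st; apply: fequiv_reframe; exact: wact_equiv. Qed.

Lemma gact_word s w g : reduced s ->
  fequiv (gact s (RaagDeck (pclass _ w) g)) (reframe g^-1 (wact s w)).
Proof.
by move=> rs; apply: fequiv_reframe; apply: wact_word_eq => //; exact: prepr_class.
Qed.

Lemma gactM s c d : reduced s -> fequiv (gact s (c * d)) (gact (gact s c) d).
Proof.
move=> rs; case: c d => [a g] [b h]; rewrite rdM /=.
rewrite -(preprK a) /deck_raag -pclassM preprK.
apply: fequiv_trans (gact_word _ _ rs) _.
rewrite wact_cat invgM reframeM; apply: fequiv_reframe => /=.
set u := wact s _; have := wact_reframe g^-1 u (word_map g (prepr b)).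
have -> : word_map g^-1 (word_map g (prepr b)) = prepr b.
  by rewrite /word_map -map_comp -[RHS]map_id; apply: eq_map => x; exact: (lactK g x).
exact: fequiv_sym.
Qed.

Lemma fht_gact s c : fht (gact s c) = (fht s + rd_ht c)%R.
Proof. by rewrite fht_reframe fht_wact. Qed.

Definition base : framed := (1, [::]).

Lemma base_reduced : reduced base. Proof. by []. Qed.

Lemma gact1 s : reduced s -> fequiv (gact s 1) s.
Proof.
move=> rs; have := gact_word [::] 1 rs; rewrite invg1 reframe1; exact.
Qed.

(** A generator [b g b^-1] fixes the empty word, since after [b] the frame may
    be changed by [g] and the letters of [b^-1] then cancel those of [b]. *)
Lemma gact_NS c : NS p S c -> fequiv (gact base c) base.
Proof.
have rb := base_reduced.
move=> /(_ [set c | fequiv (gact base c) base]); apply; split.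
  split=> [|d e|d] /=; first exact: gact1.
    move=> hc hd; apply: fequiv_trans (gactM _ _ rb) _.
    by apply: fequiv_trans hd; exact: gact_equiv.
  move=> hc; apply: fequiv_trans (gact_equiv _ (fequiv_sym hc)) _.
  apply: fequiv_trans (fequiv_sym (gactM _ _ rb)) _.
  by rewrite mulgV; exact: gact1.
move=> _ [b [g [Sb ->]]] /=.
have rbb := gact_reduced (of_raag p b) rb.
apply: fequiv_trans (gactM _ _ rb) _.
apply: (fequiv_trans (t := gact (gact base (of_raag p b)) (of_raag p b)^-1)); last first.
  by apply: fequiv_trans (fequiv_sym (gactM _ _ rb)) _; rewrite mulgV; exact: gact1.
apply: gact_equiv; apply: fequiv_trans (gactM _ _ rb) _.
apply: fequiv_trans (gact_word [::] g rbb) _; apply: fequiv_sym.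
apply: fequiv_frame; right; rewrite fht_gact.
by rewrite [fht base]big_nil add0r.
Qed.

Lemma ev_fmul s x : NSeq S (ev (fmul s x)) (ev s * relt p x).
Proof.
have [h|h] := pselect (last_letter s (linv x)).
  have := NSeq_mulr (relt p x) (ev_equiv (fmul_last h)).
  by rewrite ev_app relt_linv mulgVK; exact: NSeq_sym.
by rewrite fmul_app // ev_app; exact: NSeq_refl.
Qed.

Lemma ev_wact s w : NSeq S (ev (wact s w)) (ev s * of_raag p (pclass _ w)).
Proof.
elim: w s => [|x w IH] s /=.
  by rewrite -[pclass _ _]/(1 : raag M) mulg1; exact: NSeq_refl.
apply: NSeq_trans (IH _) _; rewrite -cat1s pclassM of_raagM mulgA.
by apply: NSeq_mulr; exact: ev_fmul.
Qed.

Lemma ev_gact s c : NSeq S (ev (gact s c)) (ev s * c).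
Proof.
rewrite {2}(rd_split c) ev_reframe invgK mulgA; apply: NSeq_mulr.
by have := ev_wact s (prepr (rd_raag c)); rewrite preprK.
Qed.

Lemma ev_base : ev base = 1.
Proof. by rewrite /ev /= mul1g. Qed.

Lemma ev_nf c : NSeq S c (ev (gact base c)).
Proof. by apply: NSeq_sym; have := ev_gact base c; rewrite ev_base mul1g. Qed.

Lemma nf_ev s : reduced s -> fequiv (gact base (ev s)) s.
Proof.
move=> rs; have rb := base_reduced.
apply: fequiv_trans (gactM _ _ rb) _.
have h : fequiv (gact base (of_deck s.1)) (s.1, [::]).
  by have := gact_word [::] s.1 rb; rewrite /reframe /= invgK mul1g.
apply: fequiv_trans (gact_equiv _ h) _.
have rs1 : reduced (s.1, [::]) by [].
apply: fequiv_trans (gact_word _ _ rs1) _; rewrite invg1 reframe1.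
case: s rs {h rs1} => g u /=; elim: u => [|x u IH]; first by move=> _; exact: fequiv_refl.
move=> [ru nD]; rewrite rev_cons -cats1 wact_cat /=.
apply: fequiv_trans (fmul_equiv _ (IH ru)) _; rewrite fmul_app //.
exact: fequiv_refl.
Qed.

Lemma gact_NSeq c d : NSeq S c d -> fequiv (gact base c) (gact base d).
Proof.
move=> h; rewrite -[c](mulgVK d).
apply: fequiv_trans (gactM _ _ base_reduced) _; apply: gact_equiv.
exact: gact_NS.
Qed.

(** The orbit of the empty word is the set of cosets: by [gact_NS] the elements
    of one coset move it alike, and by [nf_ev] a reduced word is its image under
    its own value. *)
Theorem normal_form s t : reduced s -> reduced t ->
  NSeq S (ev s) (ev t) -> fequiv s t.
Proof.
move=> rs rt /gact_NSeq h; apply: fequiv_trans (fequiv_sym (nf_ev rs)) _.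
by apply: fequiv_trans h _; exact: nf_ev.
Qed.

(** The deck transformations inject into the stabilizers of the vertices of [X_M
    / N(S)] whose height is not in [S]. *)
Lemma stabilizer_NS c k : NS p S (c * of_deck k * c^-1) -> frame_change S (rd_ht c) k.
Proof.
move=> /(NSeq_mull c); rewrite mulgVK => /gact_NSeq h.
have {h} : fequiv (reframe k^-1 (gact base c)) (gact base c).
  apply: fequiv_trans h; apply: fequiv_sym.
  apply: fequiv_trans (gactM _ _ base_reduced) _.
  exact: (gact_word [::] k (gact_reduced _ base_reduced)).
have -> : rd_ht c = fht (gact base c) by rewrite fht_gact [fht base]big_nil add0r.
move: (gact base c) => t h; rewrite -[k]invgK; apply: frame_changeV.
move/fequiv_sym: h; have [[g ->] h|[s [x ->]]] := framedP t.
  have [e|S0] : g = g * k^-1^-1 \/ S 0%R by inversion h.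
    left; apply: (@mulgI _ g); rewrite mulg1 {1}e invgK.
    by rewrite mulgK.
  by right; rewrite /fht /word_ht big_nil.
move=> /fequiv_appP[s' [x' [m [hm e core]]]].
have {e} [_ ex] : reframe k^-1 s = reframe m s' /\ lact k^-1 x = lact m x' by exact: app_inj.
have ex' : x' = lact (m^-1 * k^-1) x by rewrite lactM ex lactK.
case: core => [[exx _]|[xx _]]; last first.
  by move: xx; rewrite ex' => /(ladj_actN cov).
have e1 : m^-1 * k^-1 = 1 by apply: (lact_free cov conn (x := x)); rewrite -ex'.
suff -> : k^-1 = m by [].
by apply: (@mulgI _ m^-1); rewrite e1 mulVg.
Qed.

(** The combinatorial distance from the base vertex in [X_M / N(S)]. *)
Definition len c := size (gact base c).2.

Lemma len_NSeq c d : NSeq S c d -> len c = len d.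
Proof. by move=> /gact_NSeq /fequiv_size. Qed.

Lemma len_ev s : reduced s -> len (ev s) = size s.2.
Proof. by move=> /nf_ev /fequiv_size. Qed.

Lemma size_gactM s c d : reduced s -> size (gact s (c * d)).2 = size (gact (gact s c) d).2.
Proof. by move=> rs; apply/fequiv_size/gactM. Qed.

Lemma size_gact_ev s t : reduced s -> (size (gact s (ev t)).2 <= size s.2 + size t.2)%N.
Proof.
move=> rs; rewrite /ev size_gactM //.
have h : fequiv (gact s (of_deck t.1)) (reframe t.1^-1 s) by exact: (gact_word [::]).
have rs1 := gact_reduced (of_deck t.1) rs.
rewrite (fequiv_size (gact_word _ _ rs1)) size_reframe.
apply: leq_trans (size_wact _ _) _.
by rewrite (fequiv_size h) size_reframe size_rev.
Qed.

Lemma len_deckr c k : len (c * of_deck k) = len c.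
Proof.
rewrite /len size_gactM // (fequiv_size (gact_word [::] k _)) ?size_reframe //.
exact: gact_reduced.
Qed.

Lemma len_relt c x : len (c * relt p x) = size (fmul (gact base c) x).2.
Proof.
rewrite /len size_gactM //; have rc := gact_reduced c base_reduced.
by rewrite (fequiv_size (gact_word [:: x] 1 rc)) invg1 reframe1.
Qed.

(** Distances along the two pairs of parallel sides change alike, by
    [last_letter_fmul]. This is the form in which the non-positive curvature of
    the complex controls intervals. *)
Lemma len_square c x y : ladj x y ->
  (len c + len (c * relt p x * relt p y)%g =
   len (c * relt p x)%g + len (c * relt p y)%g)%N.
Proof.
move=> xy; have rc := gact_reduced c base_reduced.
have -> : len (c * relt p x * relt p y) = size (fmul (fmul (gact base c) x) y).2.
  rewrite len_relt; apply/fequiv_size/fmul_equiv.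
  apply: fequiv_trans (gactM _ _ base_reduced) _.
  by have := gact_word [:: x] 1 rc; rewrite invg1 reframe1.
rewrite !len_relt /len; move: (gact base c) => s; rewrite !(size_fmul _ y).
have -> : `[< last_letter (fmul s x) (linv y) >] = `[< last_letter s (linv y) >].
  by apply: asbool_equiv_eq; exact: last_letter_fmul.
have sz z : last_letter s z -> (0 < size s.2)%N by move=> [r /fequiv_size ->].
case: asboolP => [/[dup] /sz s0 hy|hy]; last by rewrite !addnS addnC.
have : (0 < size (fmul s x).2)%N.
  by have [r /fequiv_size ->] : last_letter (fmul s x) (linv y) by apply/last_letter_fmul.
by case: (size _) => // a _; case: (size s.2) s0 => // b _ /=; rewrite addSn addnC.
Qed.

End NormalFormTheorem.

(** * Elements of finite order *)

Section Torsion.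
Local Open Scope group_scope.
Variables (M L : scomplex) (p : M -> L).
Local Notation letter := (M * bool)%type.
Local Notation deck := (deck p).
Local Notation framed := (framed p).
Implicit Types (x y : letter) (g k : deck) (s t r : framed) (u v w : word M).
Implicit Types (c d e : raag_deck p) (S : set int).

(** Moving the base point to height [h] replaces [S] by [shiftS S h]. *)
Definition shiftS S (h : int) : set int := [set m | S (m + h)%R].

Lemma shiftSD S a b : shiftS (shiftS S a) b = shiftS S (a + b)%R.
Proof. by apply/funext => m; rewrite /shiftS /= -addrA (addrC b). Qed.

Lemma shiftS0 S : shiftS S 0%R = S.
Proof. by apply/funext => m; rewrite /shiftS /= addr0. Qed.

Lemma NS_conjE S c d : NS p (shiftS S (rd_ht c)) (d ^ c) <-> NS p S d.
Proof.
split; last exact: NS_conj.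
move=> /(NS_conj (c := c^-1)); rewrite -/(shiftS _ _) shiftSD rd_htV addrN shiftS0.
by rewrite -conjgM mulgV conjg1.
Qed.

Lemma NSeq_conj S c d e : NSeq S c d -> NSeq (shiftS S (rd_ht e)) (c ^ e) (d ^ e).
Proof. by move=> h; rewrite /NSeq -conjVg -conjMg; apply/NS_conjE. Qed.

Lemma rd_ht_conj c d : rd_ht (c ^ d) = rd_ht c.
Proof. by rewrite conjgE !rd_htM rd_htV addrCA addNr addr0. Qed.

Lemma rd_htX c n : rd_ht c = 0%R -> rd_ht (c ^+ n) = 0%R.
Proof.
by move=> h; elim: n => [|n IH]; rewrite ?expg0 ?rd_ht1 // expgS rd_htM h IH addr0.
Qed.

Lemma of_deckX g n : of_deck (g ^+ n) = of_deck g ^+ n.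
Proof. by elim: n => [|n IH]; rewrite ?expg0 // !expgS of_deckM IH. Qed.

Lemma NSeqX S c d n : rd_ht d = 0%R -> NSeq S c d -> NSeq S (c ^+ n) (d ^+ n).
Proof.
move=> hd cd; elim: n => [|n IH]; first by rewrite !expg0; exact: NSeq_refl.
rewrite !expgSr; apply: NSeq_trans (NSeq_mulr _ IH) _.
rewrite /NSeq invgM mulgA.
have := @NS_norm_BB _ _ _ S (d ^+ n)^-1 _ _ cd.
rewrite conjgE invgK !mulgA; apply.
have [_ _] := BB_deck_subgroup p.
by apply; exact: rd_htX.
Qed.

Hypothesis cov : covering p.
Hypothesis conn : sconnected M.
Hypothesis L_flag : flag L.

Lemma last_letter_frame S g g' u y :
  last_letter S (g, u) y -> last_letter S (g', u) y.
Proof.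
elim: u y => [y /last_letter_nil //|x u IH y].
rewrite -[(g, _)]/(app (g, u) x) -[(g', _)]/(app (g', u) x).
move=> /last_letter_app [k [hk h]].
apply/last_letter_app; exists k; split=> //.
by case: h => [|[xy /IH]]; [left|right].
Qed.

Lemma reduced_frame S g g' u : reduced S (g, u) -> reduced S (g', u).
Proof.
rewrite /reduced /=; elim: u => //= x u IH [/IH h nD]; split=> //.
by move/(last_letter_frame g).
Qed.

Lemma word_ht_cat u v : word_ht (u ++ v) = (word_ht u + word_ht v)%R.
Proof. by rewrite /word_ht big_cat. Qed.

(** The moves inside a final segment do not depend on the letters before it,
    except through the height at which it starts. *)
Lemma last_letter_extend S g g' v u y :
  last_letter (shiftS S (word_ht u)) (g, v) y -> last_letter S (g', v ++ u) y.
Proof.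
elim: v y => [y /last_letter_nil //|x v IH y] /=.
rewrite -[(g, _)]/(app (g, v) x) -[(g', _)]/(app (g', v ++ u) x).
move=> /last_letter_app [k [hk h]].
apply/last_letter_app; exists k; split.
  move: hk; rewrite /frame_change /shiftS /= !fht_app.
  by rewrite /fht /= word_ht_cat addrA.
by case: h => [|[xy /IH]]; [left|right].
Qed.

(** A letter that can be moved to the end of a word commutes with all the
    letters that follow it, so their images in [L] differ from its own. *)
Lemma last_letter_window S g u y : last_letter S (g, u) y ->
  exists v z u0, [/\ u = v ++ z :: u0, p z.1 = p y.1, z.2 = y.2,
    forall l : letter, l \in v -> p l.1 <> p y.1 &
    last_letter (shiftS S (word_ht u0)) (1 : deck, rcons v z) y].
Proof.
elim: u y => [y /last_letter_nil //|x u IH y].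
rewrite -[(g, _)]/(app (g, u) x) => /last_letter_app [k [hk h]].
have shift v u0 : u = v ++ u0 ->
    frame_change (shiftS S (word_ht u0)) (fht (app (1 : deck, v) x : framed)) k.
  move=> eu; move: hk; rewrite /frame_change /shiftS /= !fht_app.
  by rewrite /fht /= eu word_ht_cat addrA.
case: h => [e|[xy /IH [v [z [u0 [eu ez ez' hv h]]]]]].
  exists [::], x, u; split=> //=.
  - by rewrite -e /= deck_over.
  - by rewrite -e.
  - rewrite -[(1 : deck, _)]/(app (1 : deck, [::]) x); apply/last_letter_app.
    by exists k; split; [exact: (shift [::])|left].
exists (x :: v), z, u0; split.
- by rewrite eu.
- by rewrite ez /= deck_over.
- by rewrite ez'.
- move=> l; rewrite inE => /orP[/eqP->|/hv]; last by rewrite /= deck_over.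
  have [] := covering_adjacent cov xy; rewrite /= deck_over; congruence.
- rewrite rcons_cons -[(1 : deck, _)]/(app (1 : deck, rcons v z) x).
  apply/last_letter_app; exists k; split; last by right.
  move: (shift (rcons v z) u0); rewrite eu cat_rcons => /(_ erefl).
  by [].
Qed.

Lemma reduced_prefix S g v u : reduced S (g, v ++ u) -> reduced S (g, u).
Proof. by elim: v => //= x v IH [/IH]. Qed.

(** A word that is not reduced has a letter that cancels, so the length of its
    value drops. *)
Lemma not_reduced_len S s : ~ reduced S s -> (len S (ev s) < size s.2)%N.
Proof.
case: s => g; elim=> [|x u IH]; first by case.
rewrite -[(g, x :: u)]/(app (g, u) x) => nr.
rewrite ev_app (len_relt cov conn L_flag).
have [ru|nru] := pselect (reduced S (g, u)); last first.
  rewrite size_fmul /=; case: ifP => _; last exact: IH.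
  by apply: leq_ltn_trans (leq_pred _) _; apply: ltnW; rewrite ltnS; exact: IH.
have D : last_letter S (g, u) (linv x).
  by apply: contrapT => nD; apply: nr; apply/reduced_app.
rewrite (fequiv_size (fmul_equiv cov conn L_flag _ (nf_ev cov conn L_flag ru))).
rewrite size_fmul; case: asboolP => // _ /=.
by rewrite ltnS leq_pred.
Qed.

Section Sequence.
Variable z : nat -> letter.

(** The letters [z i, ..., z (i + m - 1)], stored as in a framed word. *)
Fixpoint segment i m : word M := if m is m'.+1 then z (i + m')%N :: segment i m' else [::].

Lemma size_segment i m : size (segment i m) = m.
Proof. by elim: m => //= m ->. Qed.

Lemma segmentD i m m' : segment i (m + m') = segment (i + m) m' ++ segment i m.
Proof. by elim: m' => [|m' IH]; rewrite ?addn0 // addnS /= IH addnA. Qed.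

Lemma segment_split i m v x u : segment i m = v ++ x :: u ->
  [/\ x = z (i + size u), u = segment i (size u), v = segment (i + size u).+1 (size v) &
      m = (size u + (size v).+1)%N].
Proof.
move=> e; have em : m = (size u + (size v).+1)%N.
  by rewrite -(size_segment i m) e size_cat addnC /= addSnnS.
move: e; rewrite em -addSnnS segmentD /= addnS => /eqP.
rewrite eqseq_cat ?size_segment // => /andP[/eqP <- /eqP[<- <-]].
by rewrite !size_segment.
Qed.

Lemma mem_segment i m j : (i <= j < i + m)%N -> z j \in segment i m.
Proof.
elim: m => [|m IH] /=; first by rewrite addn0; lia.
rewrite addnS ltnS inE => /andP[ij]; rewrite leq_eqVlt => /orP[/eqP->|jm].
  by rewrite eqxx.
by rewrite IH ?orbT // ij.
Qed.

(** A cancelling pair is confined to a window shorter than a period, because the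
    letters with the same image in [L] recur with that period and the same sign. *)
Lemma reduced_windows S n : (0 < n)%N ->
  (forall i, p (z (i + n)).1 = p (z i).1 /\ (z (i + n)).2 = (z i).2) ->
  (forall i, reduced (shiftS S (word_ht (segment 0 i))) (1 : deck, segment i n)) ->
  forall m, reduced S (1 : deck, segment 0 m).
Proof.
move=> n0 per win; elim=> [//|m IH]; split=> //.
move=> D; have [v [x [u [e ep es hv h]]]] := last_letter_window D.
have [ex eu ev em] := segment_split e; rewrite add0n in ex ev.
move: ep es hv h; rewrite /= add0n => ep es hv h.
set i := size u in ex eu ev em.
have im : (i < m)%N by rewrite em -addSnnS leq_addr.
have lt : (m < i + n)%N.
  rewrite ltnNge; apply/negP; rewrite leq_eqVlt => /orP[/eqP e1|lt].
    have [_] := per i; rewrite e1 -ex es => h1.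
    by move: h1; case: (z m).2.
  have /hv : z (i + n)%N \in v.
    rewrite ev; apply: mem_segment; rewrite em in lt; lia.
  by have [-> _] := per i; rewrite -ex ep.
(* The window of length [n] that ends with [z m] contains the cancelling pair;
   [a] is [0] when [m] is too small for a full window. *)
pose a := (m.+1 - n)%N.
have ai : (a <= i)%N by rewrite /a; lia.
have : reduced (shiftS S (word_ht (segment 0 a))) (1 : deck, segment a (m - a).+1).
  have en : n = ((m - a).+1 + (n - (m - a).+1))%N by rewrite /a; lia.
  by move: (win a); rewrite {1}en segmentD => /reduced_prefix.
have am : (a + (m - a) = m)%N by lia.
case=> _; rewrite am; apply.
change (last_letter (shiftS S (word_ht (segment 0 a))) (1 : deck, segment a (m - a))
  (linv (z m))).
have -> : (m - a = (i - a) + (size v).+1)%N by lia.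
have -> : segment a (i - a + (size v).+1) = rcons v x ++ segment a (i - a).
  rewrite -addSnnS segmentD /= addnS.
  have ai' : (a + (i - a) = i)%N by lia.
  by rewrite ai' -ex -ev cat_rcons.
apply: (last_letter_extend (g := 1)); rewrite shiftSD.
suff -> : (word_ht (segment 0 a) + word_ht (segment a (i - a)) = word_ht u)%R by [].
rewrite eu addrC -word_ht_cat; congr word_ht.
have {2}-> : i = (a + (i - a))%N by lia.
by rewrite segmentD add0n.
Qed.

Definition seg_elt i : raag_deck p := ev (1 : deck, segment 0 i).

Lemma seg_eltD i m : seg_elt (i + m) = seg_elt i * ev (1 : deck, segment i m).
Proof.
elim: m => [|m IH]; first by rewrite addn0 [ev _](ev_base p) mulg1.
rewrite addnS /seg_elt /= -[(1 : deck, _)]/(app (1 : deck, segment 0 (i + m)) _) ev_app.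
rewrite -/(seg_elt _) IH -mulgA; congr (_ * _).
by rewrite -[(1 : deck, z (i + m) :: _)]/(app (1 : deck, segment i m) _) ev_app.
Qed.

Lemma rd_ht_seg i : rd_ht (seg_elt i) = word_ht (segment 0 i).
Proof. exact: rd_ht_ev. Qed.

Lemma seg_elt_period g n i : (forall j, z (j + n)%N = lact g (z j)) ->
  seg_elt (n + i) = seg_elt n * (of_deck g * seg_elt i * (of_deck g)^-1).
Proof.
move=> per; elim: i => [|i IH].
  by rewrite addn0 [seg_elt 0](ev_base p) mulg1 mulgV mulg1.
have S1 j : seg_elt j.+1 = seg_elt j * relt p (z j).
  by rewrite -addn1 seg_eltD /ev /= mul1g addn0.
rewrite addnS !S1 IH (addnC n) per -!mulgA; do 3 congr (_ * _).
rewrite -of_deckV; have := of_deck_relt g^-1 (lact g (z i)).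
by rewrite lactK => ->.
Qed.

End Sequence.

(** Among the conjugates of [c], one of minimal length is either in [pi] or has
    a positive length [m]. In the second case its powers spell a periodic
    sequence of letters, each window of [m] letters is the word of a conjugate
    and hence reduced by minimality, and [reduced_windows] shows that all the
    powers are reduced: they have positive length. This is the counterpart of
    the fixed point theorem for finite groups acting on CAT(0) spaces. *)
Theorem torsion_elliptic S c n : rd_ht c = 0%R -> (0 < n)%N ->
  NS p S (c ^+ n) -> exists d k, NSeq S c (d * of_deck k * d^-1).
Proof.
move=> hc n0 cn.
(* [m] is the least length of a conjugate, each measured from its own base
   height. *)
pose P m := `[< exists d, len (shiftS S (rd_ht d)) (c ^ d) = m >].
have exP : exists m, P m.
  by exists (len (shiftS S (rd_ht c)) (c ^ c)); apply/asboolP; exists c.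
case: (ex_minnP exP) => m /asboolP[d dm] minm.
set S1 := shiftS S (rd_ht d) in dm; pose c1 := c ^ d.
have min1 e : (m <= len (shiftS S1 (rd_ht e)) (c1 ^ e)%g)%N.
  apply: minm; apply/asboolP; exists (d * e).
  by rewrite rd_htM -shiftSD conjgM.
have hc1 : rd_ht c1 = 0%R by rewrite rd_ht_conj.
have c1n : NS p S1 (c1 ^+ n) by rewrite -conjXg; exact: NS_conj.
pose s := gact S1 (base p) c1.
have rs : reduced S1 s by apply: gact_reduced => //.
have cs : NSeq S1 c1 (ev s) by exact: ev_nf.
have sm : size s.2 = m by exact: dm.
case: m {exP minm dm} => [|m] in min1 sm *.
  exists d, s.1; have es : ev s = of_deck s.1.
    by rewrite /ev; case: (s.2) sm => //= _; rewrite mulg1.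
  rewrite -es; apply/(NS_conjE _ d); rewrite conjMg conjVg.
  by have -> : (d * ev s * d^-1) ^ d = ev s by rewrite conjgE mulgVK mulKg.
exfalso; pose g := s.1; pose w := rev s.2.
have sw : size w = m.+1 by rewrite size_rev.
have x0 : letter by case: (s.2) sm => // x.
(* The value of [s] is [g w]; moving the powers of [g] to the left in the powers
   of [g w] gives the sequence [z], in which a shift by [m.+1] acts as [g]. *)
pose z i := lact (g ^+ (i %/ m.+1)) (nth x0 w (i %% m.+1)).
have per i : z (i + m.+1)%N = lact g (z i).
  by rewrite /z divnDr // divnn /= modnDr addn1 expgS lactM.
have eW : segment z 0 m.+1 = s.2.
  rewrite -[s.2]revK -/w.
  have : forall k : nat, (k <= m.+1)%N -> segment z 0 k = rev (take k w).
    elim=> [|k IH] km; first by rewrite take0.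
    rewrite /= add0n IH ?(ltnW km) // (take_nth x0) ?sw // rev_rcons.
    by rewrite /z divn_small // modn_small // expg0 lact1.
  by move=> /(_ _ (leqnn _)); rewrite -sw take_size.
have es : ev s = of_deck g * seg_elt z m.+1.
  by rewrite /seg_elt eW /ev /= mul1g.
pose e (i : nat) : raag_deck p := of_deck g * seg_elt z i.
(* Conjugation by [e i] turns [g w] into the window that starts at [i], times
   [g]. *)
have ge i : ev s * e i = e (m.+1 + i)%N * of_deck g.
  by rewrite es /e (seg_elt_period _ per) !mulgA mulgVK.
have ht_e i : rd_ht (e i) = word_ht (segment z 0 i).
  by rewrite rd_htM rd_ht_deck add0r rd_ht_seg.
have win i : reduced (shiftS S1 (word_ht (segment z 0 i))) (1 : deck, segment z i m.+1).
  apply: contrapT => /not_reduced_len; rewrite size_segment.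
  apply/negP; rewrite -leqNgt; apply: leq_trans (min1 (e i)) _; rewrite ht_e.
  rewrite -[X in (_ <= X)%N](len_deckr cov conn L_flag _ _ g).
  apply: eq_leq; apply: (len_NSeq cov conn L_flag).
  rewrite -ht_e; have := NSeq_conj (e := e i) cs; congr NSeq.
  rewrite conjgE ge /e addnC seg_eltD.
  have eq3 (G : groupType) (u a b : G) : (u * a)^-1 * (u * (a * b) * u) = b * u.
    by rewrite invgM !mulgA mulgVK mulVg mul1g.
  exact: eq3.
have rW (k : nat) : reduced S1 (g, segment z 0 k).
  apply: (reduced_frame (g := 1)); apply: (reduced_windows _ _ win) => // i.
  by rewrite per; split=> //; exact: deck_over.
have pw (k : nat) : ev s ^+ k * e 0 = e (k * m.+1)%N * of_deck g ^+ k.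
  elim: k => [|k IH]; first by rewrite !expg0 mul1g mulg1.
  by rewrite expgS -mulgA IH mulgA ge -mulgA -expgS mulSn.
have hs : rd_ht (ev s) = 0%R.
  have := NS_ht cs; rewrite rd_htM rd_htV hc1 add0r => h.
  by rewrite -[rd_ht _]opprK h oppr0.
have : len S1 (ev s ^+ n * e 0) = (n * m.+1)%N.
  rewrite pw -of_deckX.
  rewrite (len_deckr cov conn L_flag).
  have -> : e (n * m.+1)%N = ev (g, segment z 0 (n * m.+1)).
    by rewrite /e /seg_elt /ev /= mul1g.
  by rewrite (len_ev cov conn L_flag) // size_segment.
have -> : e 0 = of_deck g by rewrite /e [seg_elt _ _](ev_base p) mulg1.
rewrite (len_deckr cov conn L_flag).
have -> : len S1 (ev s ^+ n) = len S1 (ev (base p)).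
  apply: (len_NSeq cov conn L_flag); rewrite ev_base.
  apply: (NSeq_trans (d := c1 ^+ n)); last exact/NSeq1.
  by apply: NSeqX => //; exact: NSeq_sym.
by rewrite (len_ev cov conn L_flag) // mulnS; case: (n) n0.
Qed.

End Torsion.

(** * The quotient of a covering by a normal subgroup *)

Section RaagMap.
Local Open Scope group_scope.
Variables (K K' : scomplex) (f : K -> K').
Hypothesis adj_f : forall v w, adjacent v w -> adjacent (f v) (f w).

Definition letter_map (x : K * bool) : K' * bool := (f x.1, x.2).
Definition raag_map (a : raag K) : raag K' := pclass _ (map letter_map (prepr a)).

Lemma raag_mapE w : raag_map (pclass _ w) = pclass _ (map letter_map w).
Proof.
apply/pclassP; move: (prepr_class (@raag_relators K) w).
move: (prepr _) => w'; elim=> {w w'} /=.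
- by move=> w; exact: WordRefl.
- by move=> u v _; exact: WordSym.
- by move=> v u w _ h _; exact: WordTrans.
- by move=> u u' v v' _ hu _ hv; rewrite !map_cat; exact: WordCat.
- by move=> x b; exact: WordCancel.
- move=> _ [v [w [vw ->]]]; apply: WordRel.
  by exists (f v), (f w); split=> //; exact: adj_f.
Qed.

Lemma raag_mapM a b : raag_map (a * b) = raag_map a * raag_map b.
Proof.
rewrite -(preprK a) -(preprK b) -pclassM !raag_mapE map_cat.
by rewrite pclassM.
Qed.

Lemma raag_map_lelt x : raag_map (lelt x) = lelt (letter_map x).
Proof. exact: raag_mapE. Qed.

Lemma raag_map_ht a : raag_ht (raag_map a) = raag_ht a.
Proof. by rewrite -(preprK a) raag_mapE !raag_htE /word_ht big_map. Qed.

End RaagMap.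

Section QuotientCover.
Local Open Scope group_scope.
Variables (M L : scomplex) (p : M -> L) (N : set (deck p)).
Hypothesis nN : normal_subgroup N.

Let N1 : N 1. Proof. by have [[]] := nN. Qed.
Let NM g h : N g -> N h -> N (g * h). Proof. by have [[_ + _] _] := nN; apply. Qed.
Let NV g : N g -> N g^-1. Proof. by have [[_ _ +] _] := nN; apply. Qed.
Let NJ g h : N g -> N (h * g * h^-1).
Proof. by have [_ /(_ g h^-1)] := nN; rewrite conjgE invgK mulgA. Qed.

Definition qvertex : Type := {C : set M | exists x, C = [set (g : deck p) x | g in N]}.
HB.instance Definition _ := gen_eqMixin qvertex.
HB.instance Definition _ := gen_choiceMixin qvertex.

Definition qv (x : M) : qvertex := exist _ _ (ex_intro _ x erefl).

Lemma qvP x y : qv x = qv y <-> exists2 g, N g & y = g x.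
Proof.
split=> [[e]|[g Ng ->]].
  have : [set (g : deck p) y | g in N] y by exists 1.
  by rewrite -e => -[g Ng <-]; exists g.
apply: sig_eq => /=; apply/seteqP; split=> z [h Nh <-].
  by exists (h * g^-1); [exact: NM Nh (NV Ng)|rewrite deckM /= deck_funK].
by exists (h * g) => //; exact: NM.
Qed.

Lemma qv_surj (C : qvertex) : exists x, C = qv x.
Proof. by case: C => C [x e]; exists x; exact: sig_eq. Qed.

Definition qrep (C : qvertex) : M := projT1 (cid (qv_surj C)).

Lemma qrepK C : qv (qrep C) = C.
Proof. by rewrite /qrep; case: cid. Qed.

Lemma qrep_qv x : exists2 g, N g & qrep (qv x) = g x.
Proof. by apply/qvP; rewrite qrepK. Qed.

(** The simplices of the quotient are the images of simplices; as [p] is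
    injective on simplices, so is the projection [qv]. *)
Definition qsimplex : set {fset qvertex} :=
  [set s | exists2 t : {fset M}, simplex t & s = [fset qv x | x in t]%fset].

Lemma qsimplex1 C : qsimplex [fset C]%fset.
Proof.
exists [fset qrep C]%fset; first exact: simplex1.
by rewrite imfset_fset1 qrepK.
Qed.

Lemma qsimplexS s t : (t `<=` s)%fset -> qsimplex s -> qsimplex t.
Proof.
move=> /fsubsetP ts [r sr es]; exists [fset x in r | qv x \in t]%fset.
  by apply: simplexS sr; apply/fsubsetP => x; rewrite !inE => /andP[].
apply/fsetP => C; apply/idP/imfsetP => [Ct|[x /=]].
  move: (ts _ Ct); rewrite es => /imfsetP[x /= xr e].
  by exists x => //; rewrite !inE /= xr -e.
by rewrite !inE => /andP[_ h] ->.
Qed.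

Definition quotient_cover : scomplex := SComplex qsimplex1 qsimplexS.

Definition qp (C : quotient_cover) : L := p (qrep C).

Lemma qpE x : qp (qv x) = p x.
Proof. by rewrite /qp; have [g _ ->] := qrep_qv x; rewrite deck_over. Qed.

Hypothesis cov : covering p.

Lemma qv_adjacent (x y : M) : adjacent x y -> adjacent (qv x : quotient_cover) (qv y).
Proof.
move=> xy; split.
  by move=> /qvP[g _ e]; by apply: (adjacent_deckN cov (x := x) (g := g)); rewrite -e.
exists [fset x; y]%fset; first by case: xy.
by rewrite imfset_fset2.
Qed.

Lemma adjacent_qv (x y : M) : adjacent (qv x : quotient_cover) (qv y) ->
  exists2 g : deck p, N g & adjacent x (g y).
Proof.
move=> [nxy [t st e]].
have : qv x \in [fset qv z | z in t]%fset by rewrite -e !inE eqxx.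
move=> /imfsetP[x' /= x't /qvP[g Ng ex]].
have : qv y \in [fset qv z | z in t]%fset by rewrite -e !inE eqxx orbT.
move=> /imfsetP[y' /= y't /qvP[h Nh ey]].
exists (g^-1 * h); first exact: NM (NV Ng) Nh.
rewrite -[x](deck_funK g) -[deck_finv g _]/(g^-1 _) -ex deckM; apply: deck_adjacent.
rewrite -ey; apply: (simplex_adjacent st) => // exy.
apply: nxy; apply/qvP; exists (h^-1 * g); first exact: NM (NV Nh) Ng.
by rewrite deckM -ex exy ey /= deck_funK.
Qed.

Definition qact (g : deck p) (C : quotient_cover) : quotient_cover := qv (g (qrep C)).

Lemma qactE g x : qact g (qv x) = qv (g x).
Proof.
have [h Nh e] := qrep_qv x; rewrite /qact e; apply/esym/qvP.
by exists (g * h * g^-1); [exact: NJ|rewrite !deckM /= deck_funK].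
Qed.

Lemma qact_simplex g (s : {fset quotient_cover}) :
  simplex s -> simplex [fset qact g x | x in s]%fset.
Proof.
move=> [t st ->]; exists [fset g x | x in t]%fset; first exact: deck_simplex.
apply/fsetP => C; apply/imfsetP/imfsetP => /= -[D].
  move=> /imfsetP[x /= xt ->] ->; rewrite qactE; exists (g x) => //.
  exact: in_imfset.
move=> /imfsetP[x /= xt ->] ->; exists (qv x); last by rewrite qactE.
exact: in_imfset.
Qed.

Lemma qactK g : cancel (qact g) (qact g^-1).
Proof. by move=> C; have [x ->] := qv_surj C; rewrite !qactE /= deck_funK. Qed.
Lemma qactVK g : cancel (qact g^-1) (qact g).
Proof. by move=> C; have [x ->] := qv_surj C; rewrite !qactE /= deck_finvK. Qed.
Lemma qact_over g C : qp (qact g C) = qp C.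
Proof. by have [x ->] := qv_surj C; rewrite qactE !qpE deck_over. Qed.

Definition qdeck (g : deck p) : deck qp :=
  @Deck _ _ qp (qact g) (qact g^-1) (qactK g) (qactVK g)
    (@qact_simplex g) (@qact_simplex g^-1) (qact_over g).

Lemma qdeckE g x : qdeck g (qv x) = qv (g x).
Proof. exact: qactE. Qed.

Lemma qdeckM g h : qdeck (g * h) = qdeck g * qdeck h.
Proof.
by apply: deck_eq => C; have [x ->] := qv_surj C; rewrite deckM !qdeckE.
Qed.

Lemma qdeck1 : qdeck 1 = 1.
Proof. by apply: (@mulgI _ (qdeck 1)); rewrite -qdeckM !mulg1. Qed.

Lemma qdeck_N g : N g -> qdeck g = 1.
Proof.
move=> Ng; apply: deck_eq => C; have [x ->] := qv_surj C; rewrite qdeckE /=.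
by apply/esym/qvP; exists g.
Qed.

Hypothesis conn : sconnected M.

Lemma qconnected : sconnected quotient_cover.
Proof.
move=> C D; have [x ->] := qv_surj C; have [y ->] := qv_surj D.
elim: (conn x y) => {C D x y} [x y xy|x|x y z _ h _ h'].
- exact/rt_step/qv_adjacent.
- exact: rt_refl.
- exact: rt_trans h h'.
Qed.

Lemma qcovering : covering qp.
Proof.
have [sp hp ip lp] := cov; split.
- by move=> v; have [x <-] := sp v; exists (qv x); rewrite qpE.
- move=> s [t st ->]; have := hp _ st; apply: simplexS.
  apply/fsubsetP => _ /imfsetP[C /= /imfsetP[x /= xt ->] ->]; rewrite qpE.
  exact: in_imfset.
- move=> s [t st ->] C D /imfsetP[x /= xt ->] /imfsetP[y /= yt ->]; rewrite !qpE.
  by move/(ip _ st _ _ xt yt) ->.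
- move=> C t st; have [x ->] := qv_surj C; rewrite qpE => xt.
  have im (r : {fset M}) : [fset qp y | y in [fset qv y | y in r]]%fset = [fset p y | y in r]%fset.
    apply/fsetP => v; apply/imfsetP/imfsetP => /= -[D].
      by move=> /imfsetP[y /= yr ->] ->; exists y; rewrite ?qpE.
    by move=> Dr ->; exists (qv D); rewrite ?qpE //; exact: in_imfset.
  have [r [[sr xr er] ur]] := lp x t st xt.
  exists [fset qv y | y in r]%fset; split.
    by split; [exists r|exact: in_imfset|rewrite im].
  move=> _ [[r' sr' ->] /imfsetP[x' /= x'r' /qvP[g Ng ex']] er'].
  have -> : r = [fset (g^-1 : deck p) y | y in r']%fset.
    apply: ur; split; first exact: deck_simplex.
      apply/imfsetP; exists x' => //=; by rewrite ex' /= deck_funK.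
    rewrite -er' im; apply/fsetP => v; apply/imfsetP/imfsetP => /= -[y].
      by move=> /imfsetP[z /= zr ->] ->; exists z => //; exact: (deck_over g^-1).
    move=> yr ->; exists ((g^-1 : deck p) y); last by symmetry; exact: (deck_over g^-1).
    exact: in_imfset.
  apply/fsetP => C'; apply/imfsetP/imfsetP => /= -[y].
    move=> /imfsetP[z /= zr ->] ->; exists z => //; apply/esym/qvP.
    by exists g^-1 => //; exact: NV.
  move=> yr ->; exists ((g^-1 : deck p) y); first exact: in_imfset.
  by apply/qvP; exists g^-1 => //; exact: NV.
Qed.

Lemma deck_eq_at (K K' : scomplex) (r : K -> K') (covr : covering r) (connr : sconnected K)
  (g h : deck r) x : g x = h x -> g = h.
Proof.
move=> e; apply: (@mulgI _ h^-1); rewrite mulVg.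
by apply: (deck_free covr connr (x := x)); rewrite deckM e /= deck_funK.
Qed.

Hypothesis reg : regular_covering p.

(** Every deck transformation [g] descends because [N] is normal, and the
    transformations [qdeck g] already act transitively on the fibers. *)
Lemma qregular : regular_covering qp.
Proof.
split; first exact: qcovering.
move=> C D; have [x ->] := qv_surj C; have [y ->] := qv_surj D.
rewrite !qpE => /(proj2 reg)[g e]; exists (qdeck g); by rewrite qdeckE e.
Qed.

(** A deck transformation of a connected covering is determined by the image of
    one vertex. *)
Lemma qdeck_surj (d : deck qp) : inhabited M -> exists g, d = qdeck g.
Proof.
move=> [x]; have [y ey] := qv_surj (d (qv x)).
have /(proj2 reg)[g e] : p x = p y by rewrite -(qpE x) -(qpE y) -ey deck_over.
exists g; apply: (deck_eq_at qcovering qconnected (x := qv x)).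
by rewrite qdeckE ey e.
Qed.

Lemma qdeck_inj g : inhabited M -> qdeck g = 1 -> N g.
Proof.
move=> [x] e; have /qvP[h Nh ex] : qv (g x) = qv x by rewrite -qdeckE e.
suff -> : g = h^-1 by exact: NV.
apply: (deck_eq_at cov conn (x := x)); rewrite {2}ex.
by rewrite -deckM mulVg.
Qed.

Lemma qfinite : inhabited M -> finite_index N -> finite_set [set: deck qp].
Proof.
move=> iM fN; pose f (C : set (deck p)) : deck qp :=
  if pselect (exists g, C = lcoset g N) is left e then qdeck (projT1 (cid e)) else 1.
apply: (sub_finite_set _ (finite_image f fN)) => d _.
have [g ->] := qdeck_surj d iM; exists (lcoset g N); first by exists g.
rewrite /f; case: pselect => [e|]; last by case; exists g.
case: cid => h /= eh.
have : lcoset g N h by rewrite eh; apply/mem_lcoset; rewrite mulVg.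
move=> /mem_lcoset Ngh; rewrite -[h](mulVKg g) qdeckM (qdeck_N Ngh).
by rewrite mulg1.
Qed.

Definition qraag : raag M -> raag quotient_cover := raag_map (fun x => qv x : quotient_cover).
Definition qmap (c : raag_deck p) : raag_deck qp :=
  RaagDeck (qraag (rd_raag c)) (qdeck (rd_deck c)).
Definition qletter : M * bool -> quotient_cover * bool :=
  letter_map (fun x => qv x : quotient_cover).

Lemma qletter_act g x : qletter (lact g x) = lact (qdeck g) (qletter x).
Proof. by rewrite /qletter /letter_map /lact qdeckE. Qed.

Lemma qraag_deck g a : qraag (deck_raag g a) = deck_raag (qdeck g) (qraag a).
Proof.
rewrite -(preprK a) deck_raagE /qraag !(raag_mapE qv_adjacent) deck_raagE; congr pclass.
rewrite /word_map -!map_comp; apply: eq_map => x; exact: qletter_act.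
Qed.

Lemma qmapM c d : qmap (c * d) = qmap c * qmap d.
Proof. by rewrite /qmap !rdM /= qdeckM /qraag (raag_mapM qv_adjacent) -qraag_deck. Qed.

Lemma qmap1 : qmap 1 = 1.
Proof. by apply: (@mulgI _ (qmap 1)); rewrite -qmapM !mulg1. Qed.
Lemma qmapV c : qmap c^-1 = (qmap c)^-1.
Proof. by apply: (@mulgI _ (qmap c)); rewrite -qmapM !mulgV qmap1. Qed.
Lemma qmap_deck g : qmap (of_deck g) = of_deck (qdeck g).
Proof. by rewrite /qmap /of_deck /= /qraag (raag_mapE qv_adjacent [::]). Qed.
Lemma qmap_relt x : qmap (relt p x) = relt qp (qletter x).
Proof. by rewrite /qmap /relt /of_raag /= qdeck1 /qraag (raag_map_lelt qv_adjacent). Qed.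
Lemma qmap_ht c : rd_ht (qmap c) = rd_ht c.
Proof. by rewrite /rd_ht /= /qraag (raag_map_ht qv_adjacent). Qed.

Lemma qmap_NS S c : NS p S c -> NS qp S (qmap c).
Proof.
have [H1 HM HV] := NS_subgroup qp S.
move=> /(_ [set c | NS qp S (qmap c)]); apply; split.
  split=> [|d e|d] /=; first by rewrite qmap1.
    by rewrite qmapM; exact: HM.
  by rewrite qmapV; exact: HV.
move=> _ [b [g [Sb ->]]] /=; rewrite !qmapM qmapV qmap_deck.
by apply: NS_gen; rewrite qmap_ht.
Qed.

End QuotientCover.
Arguments qp {M L p} N _.

(** * Stability of reduced words under quotients *)

Section Openness.
Local Open Scope group_scope.
Variables (M L : scomplex) (p : M -> L).
Local Notation letter := (M * bool)%type.
Local Notation deck := (deck p).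
Implicit Types (x y : letter) (g h k : deck) (u v w : word M) (C : seq deck).
Implicit Types (N : set deck) (S : set int).
Hypothesis conn : sconnected M.
Hypothesis reg : regular_covering p.
Hypothesis M_inhabited : inhabited M.
Let cov : covering p := proj1 reg.

Definition nontrivial_seq C := forall g, g \in C -> g <> 1.
Definition avoids C N := forall g, g \in C -> ~ N g.
Definition agree_upto (n : nat) S S' := forall m : int, (`|m| <= n%:Z)%R -> S m <-> S' m.

Lemma nontrivial_cat C C' : nontrivial_seq C -> nontrivial_seq C' -> nontrivial_seq (C ++ C').
Proof. by move=> h h' g; rewrite mem_cat => /orP[/h|/h']. Qed.

Lemma avoids_cat C C' N : avoids (C ++ C') N -> avoids C N /\ avoids C' N.
Proof. by move=> h; split=> g gC; apply: h; rewrite mem_cat gC ?orbT. Qed.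

Lemma agree_uptoW m n S S' : (m <= n)%N -> agree_upto n S S' -> agree_upto m S S'.
Proof. by move=> mn h i im; apply: h; apply: le_trans im _; rewrite lez_nat. Qed.

Lemma word_ht_le u : (`|word_ht u| <= (size u)%:Z)%R.
Proof.
elim: u => [|x u IH]; first by rewrite /word_ht big_nil.
rewrite /word_ht big_cons -/(word_ht u) /= intS; apply: le_trans (ler_normD _ _) _.
by apply: lerD => //; case: x.2.
Qed.

Lemma word_ht_qletter N u :
  word_ht (map (qletter N) u) = word_ht u.
Proof. by rewrite /word_ht big_map. Qed.

Lemma qletter_eq N (nN : normal_subgroup N) x y :
  qletter N x = qletter N y -> exists2 h, N h & lact h x = y.
Proof.
case: x y => [v b] [w c] e; have /(qvP nN)[h Nh ew] : qv N v = qv N w by exact: (congr1 fst e).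
by exists h => //; have := congr1 snd e => /= <-; rewrite ew.
Qed.

Lemma ladj_qletter N (nN : normal_subgroup N) x y :
  ladj (qletter N x) (qletter N y) -> exists2 h, N h & ladj x (lact h y).
Proof. exact: (adjacent_qv nN). Qed.

(** A condition satisfied by at most one deck transformation is harmless once
    that one is kept out of [N]. *)
Lemma avoid_one (P : deck -> Prop) : (forall h k, P h -> P k -> h = k) ->
  exists2 C, nontrivial_seq C & forall N, avoids C N -> forall h, N h -> P h -> h = 1.
Proof.
move=> uniqP; have [[h [Ph nh]]|no] := pselect (exists h, P h /\ h <> 1).
  exists [:: h]; first by move=> g; rewrite inE => /eqP->.
  move=> N av k Nk Pk; case: (av h); first by rewrite inE.
  by rewrite (uniqP _ _ Ph Pk).
exists [::] => // N _ h _ Ph; apply: contrapT => nh; apply: no; by exists h.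
Qed.

(** That a letter cannot be moved to the end of a word is witnessed by finitely
    many deck transformations being non-trivial and by finitely many heights. *)
Lemma last_letter_open S g u y : ~ last_letter S (g, u) y ->
  exists2 C, nontrivial_seq C &
    forall N (nN : normal_subgroup N) S' (g' : Defs.deck (qp N)), avoids C N ->
      agree_upto (size u) S S' ->
      ~ last_letter S' (g', map (qletter N) u) (qletter N y).
Proof.
elim: u y => [|x u IH] y nD.
  by exists [::] => // N nN S' g' _ _; exact: last_letter_nil.
rewrite -[(g, _)]/(app (g, u) x) in nD.
have nDk k : frame_change S (fht (app (g, u) x)) k ->
    lact k y <> x /\ (ladj x (lact k y) -> ~ last_letter S (g, u) (lact k y)).
  move=> hk; split=> [e|xy D]; apply: nD; apply/last_letter_app; exists k; split=> //.
    by left.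
  by right.
have [C1 nt1 h1] := @avoid_one (fun h => lact h y = x) (fun h k e e' =>
  deck_eq_at cov conn (x := y.1) (congr1 fst (etrans e (esym e')))).
have edge h k : ladj x (lact h y) -> ladj x (lact k y) -> h = k.
  move=> xh xk; apply: (deck_eq_at cov conn (x := y.1)).
  by apply: (adjacent_lift_unique cov xh xk); rewrite /= !deck_over.
have [C2 nt2 h2] := avoid_one edge.
have [C3 nt3 h3] : exists2 C, nontrivial_seq C & forall k,
    ladj x (lact k y) -> frame_change S (fht (app (g, u) x)) k ->
    forall N (nN : normal_subgroup N) S' (g' : Defs.deck (qp N)), avoids C N ->
      agree_upto (size u) S S' ->
      ~ last_letter S' (g', map (qletter N) u) (qletter N (lact k y)).
  have [[k [xk hk]]|no] := pselect (exists k, ladj x (lact k y) /\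
      frame_change S (fht (app (g, u) x)) k).
    have [_ /(_ xk) /IH [C nC hC]] := nDk k hk.
    by exists C => // k' xk' _; rewrite (edge _ _ xk' xk); exact: hC.
  by exists [::] => // k xk hk; case: no; exists k.
(* [C1] keeps the image of [y] apart from that of [x], [C2] keeps the images
   from becoming adjacent, and [C3] deals with the part of the word before
   [x]. *)
exists (C1 ++ (C2 ++ C3)); first by do !apply: nontrivial_cat.
move=> N nN S' g' /avoids_cat[/h1 {}h1 /avoids_cat[/h2 {}h2 av]] agr.
have qcov := qcovering nN cov; have qconn := qconnected nN cov conn.
rewrite /= -[(g', _)]/(app (g', map (qletter N) u) (qletter N x)).
move=> /last_letter_app [k' [hk' h]].
have hS : S (fht (app (g, u) x)) <-> S' (fht (app (g', map (qletter N) u) (qletter N x))).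
  have -> : fht (app (g', map (qletter N) u) (qletter N x)) = fht (app (g, u) x).
    exact: (word_ht_qletter N (x :: u)).
  exact/agr/word_ht_le.
have {hk'} [k [hk ek]] : exists k, frame_change S (fht (app (g, u) x)) k /\ k' = qdeck nN k.
  case: hk' => [->|/hS Sh].
    by exists 1; split; [left|rewrite qdeck1].
  have [k ek] := qdeck_surj nN cov conn reg k' M_inhabited.
  by exists k; split=> //; right.
rewrite {k'}ek -qletter_act in h.
have fr b : N b -> frame_change S (fht (app (g, u) x)) (b * k) \/ k = 1 /\ ~ S (fht (app (g, u) x)).
  case: hk => [->|Sh]; last by left; right.
  have [Sh|nSh] := pselect (S (fht (app (g, u) x))); first by left; right.
  by right.
have agr' : agree_upto (size u) S S' by apply: agree_uptoW agr; exact: leqnSn.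
case: h => [/(qletter_eq nN)[b Nb e]|[/(ladj_qletter nN)[b Nb xy] D]].
  case: (fr b Nb) => [/nDk[ne _]|[k1 nS]]; first by apply: ne; rewrite lactM.
  rewrite k1 lact1 in e; have b1 := h1 b Nb e.
  by have [ne _] := nDk 1 (frame_change1 _ _ _); apply: ne; rewrite -b1.
rewrite -lactM in xy.
have eq : qletter N (lact (b * k) y) = qletter N (lact k y).
  by rewrite lactM qletter_act (qdeck_N nN Nb) lact1.
rewrite -eq in D.
case: (fr b Nb) => [hbk|[k1 nS]]; first exact: (h3 _ xy hbk) D.
have b1 : b = 1 by apply: h2 => //; rewrite -[b]mulg1 -k1.
rewrite b1 k1 mulg1 in xy D.
exact: (h3 _ xy (frame_change1 _ _ _)) D.
Qed.

Lemma reduced_open S g u : reduced S (g, u) ->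
  exists2 C, nontrivial_seq C &
    forall N (nN : normal_subgroup N) S' (g' : Defs.deck (qp N)), avoids C N ->
      agree_upto (size u) S S' -> reduced S' (g', map (qletter N) u).
Proof.
elim: u => [|x u IH]; first by exists [::].
move=> [/IH[C nC hC] /last_letter_open[C' nC' hC']].
exists (C ++ C'); first exact: nontrivial_cat.
move=> N nN S' g' /avoids_cat[av av'] agr.
have agr' : agree_upto (size u) S S' by apply: agree_uptoW agr; exact: leqnSn.
split; first exact: hC.
exact: (hC' N nN S' g').
Qed.

Definition qframed N (nN : normal_subgroup N) (s : framed p) : framed (qp N) :=
  (qdeck nN s.1, map (qletter N) s.2).

Lemma qmap_ev N (nN : normal_subgroup N) s : qmap nN (ev s) = ev (qframed nN s).
Proof.
case: s => g; elim=> [|x u IH].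
  by rewrite /ev /= !mulg1 qmap_deck.
rewrite -[(g, x :: u)]/(app (g, u) x) ev_app (qmapM nN cov) IH (qmap_relt nN cov).
by rewrite -ev_app.
Qed.

Hypothesis L_flag : flag L.

(** The normal form of [c] is non-empty, and stays reduced in the quotient by
    [reduced_open], or it is a non-trivial deck transformation [g] and [0] is
    not in [S], which persists as soon as [N] avoids [g]. *)
Theorem NS_open S c : ~ NS p S c ->
  exists2 C, nontrivial_seq C & exists n, forall N (nN : normal_subgroup N) S',
    avoids C N -> (S `<=` S')%classic -> agree_upto n S S' -> ~ NS (qp N) S' (qmap nN c).
Proof.
move=> nc; pose s := gact S (base p) c.
have rs : reduced S s by exact: (gact_reduced cov conn L_flag).
have cs : NSeq S c (ev s) by exact: ev_nf.
have qcs N (nN : normal_subgroup N) S' : (S `<=` S')%classic -> NS (qp N) S' (qmap nN c) ->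
    NSeq S' (ev (base (qp N))) (ev (qframed nN s)).
  move=> SS' h; rewrite ev_base -(qmap_ev nN).
  apply: (NSeq_trans (d := qmap nN c)); first by apply: NSeq_sym; apply/NSeq1.
  have := qmap_NS nN cov cs; rewrite /NSeq (qmapM nN cov) (qmapV nN cov).
  exact: NS_sub.
have [C nC hC] := reduced_open (g := s.1) (u := s.2) rs.
case es : (s.2) => [|x u].
  have evs : ev s = of_deck s.1 by rewrite /ev es /= mulg1.
  have s1 : s.1 <> 1.
    by move=> e; apply: nc; apply/NSeq1; move: cs; rewrite evs e.
  have S0 : ~ S 0%R.
    move=> S0; apply: nc; apply/NSeq1; apply: NSeq_trans cs _; rewrite evs.
    apply/NSeq1; have := @NS_gen _ _ p S 1 s.1.
    by rewrite mul1g invg1 mulg1 rd_ht1; apply.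
  exists [:: s.1]; first by move=> g; rewrite inE => /eqP->.
  exists 0%N => N nN S' av SS' agr /(qcs N nN _ SS') h.
  have h' : NS (qp N) S' (1 * of_deck (qdeck nN s.1) * 1^-1).
    rewrite mul1g invg1 mulg1; apply/NSeq1; apply: NSeq_sym; move: h.
    by rewrite ev_base /ev /qframed es /= mulg1.
  have := stabilizer_NS (qcovering nN cov) (qconnected nN cov conn) L_flag h'.
  rewrite rd_ht1 => -[/(qdeck_inj cov conn M_inhabited)|]; last first.
    by have := agr 0%R; rewrite normr0 => /(_ isT) [_ +] => /[apply].
  by apply: av; rewrite inE.
exists C => //; exists (size s.2) => N nN S' av SS' agr /(qcs N nN _ SS') h.
have r1 := hC N nN S' (qdeck nN s.1) av agr.
have qcov := qcovering nN cov; have qconn := qconnected nN cov conn.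
have := fequiv_size (normal_form qcov qconn L_flag (base_reduced _ _) r1 h).
by rewrite size_map es.
Qed.

End Openness.

(** * Subgroups of finite index *)

Section FiniteIndex.
Local Open Scope group_scope.
Variable G : groupType.
Implicit Types (A B C H : set G).

(** [B] has finite index in [A]: the left cosets of [B] that meet [A] are told
    apart by a function with finitely many values on [A]. Such functions are easily
    restricted, composed and paired. *)
Definition finite_index_in A B := exists (T : Type) (f : G -> T),
  finite_set (f @` A) /\ forall x y, A x -> A y -> f x = f y -> B (x^-1 * y).

Lemma finite_index_inT H : subgroup H -> finite_index H <-> finite_index_in setT H.
Proof.
move=> [H1 HM HV]; split=> [fH|[T [f [ff fP]]]].
  exists (set G), (fun x => lcoset x H); split=> // x y _ _ e.
  by apply/mem_lcoset; rewrite e; apply/mem_lcoset; rewrite mulVg.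
pose r (t : T) : G := if pselect (exists x, f x = t) is left e then projT1 (cid e) else 1.
apply: (sub_finite_set _ (finite_image (fun t => lcoset (r t) H) ff)) => _ [x _ <-].
exists (f x); first by exists x.
have frx : f (r (f x)) = f x.
  by rewrite /r; case: pselect => [e|]; [case: cid|case; exists x].
apply/seteqP; split=> y /mem_lcoset h; apply/mem_lcoset.
  by have := HM _ _ (fP x (r (f x)) I I (esym frx)) h; rewrite -mulgA mulVKg.
by have := HM _ _ (fP (r (f x)) x I I frx) h; rewrite -mulgA mulVKg.
Qed.

Lemma finite_index_in_sub A A' B : A' `<=` A ->
  finite_index_in A B -> finite_index_in A' B.
Proof.
move=> sA [T [f [ff fP]]]; exists T, f; split=> [|x y /sA Ax /sA Ay]; last exact: fP.
by apply: (sub_finite_set _ ff); exact: image_subset.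
Qed.

(** An element is located by its coset and then by its position relative to a
    representative of that coset. *)
Lemma finite_index_in_trans A B C : B `<=` A -> subgroup A ->
  finite_index_in A B -> finite_index_in B C -> finite_index_in A C.
Proof.
move=> BA [A1 AM AV] [T [f [ff fP]]] [U [h [fh hP]]].
pose r (t : T) : G :=
  if pselect (exists2 x, A x & f x = t) is left e then sval (cid2 e) else 1.
have rP x : A x -> A (r (f x)) /\ f (r (f x)) = f x.
  move=> Ax; rewrite /r; case: pselect => [e|]; last by case; exists x.
  by case: cid2 => y.
have Br x : A x -> B ((r (f x))^-1 * x).
  by move=> Ax; have [Ar er] := rP x Ax; exact: fP.
exists (T * U)%type, (fun x => (f x, h ((r (f x))^-1 * x))); split.
  apply: (sub_finite_set _ (finite_setX ff fh)) => _ [x Ax <-]; split=> /=.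
    by exists x.
  by exists ((r (f x))^-1 * x) => //; exact: Br.
move=> x y Ax Ay [exy]; rewrite exy => e.
have := Br _ Ax; rewrite exy => Bx.
have := hP _ _ Bx (Br _ Ay) e.
by rewrite invgM invgK -mulgA mulVKg.
Qed.

Lemma finite_index_inI A B C :
  finite_index_in A B -> finite_index_in A C -> finite_index_in A (B `&` C).
Proof.
move=> [T [f [ff fP]]] [U [h [fh hP]]].
exists (T * U)%type, (fun x => (f x, h x)); split.
  apply: (sub_finite_set _ (finite_setX ff fh)) => _ [x Ax <-].
  by split; exists x.
by move=> x y Ax Ay [/fP h1 /hP h2]; split; [exact: h1|exact: h2].
Qed.

Lemma finite_index_in_bigI A (I : eqType) (s : seq I) (B : I -> set G) :
  (forall i, i \in s -> finite_index_in A (B i)) ->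
  finite_index_in A [set x | forall i, i \in s -> B i x].
Proof.
elim: s => [|i s IH] fB.
  exists unit, (fun=> tt); split=> [|x y _ _ _ i //].
  by apply: (sub_finite_set _ (finite_set1 tt)) => -[].
have -> : [set x | forall j, j \in i :: s -> B j x] =
    B i `&` [set x | forall j, j \in s -> B j x].
  apply/seteqP; split=> x /= h.
    by split=> [|j js]; apply: h; rewrite inE ?eqxx // js orbT.
  by move=> j; rewrite inE => /orP[/eqP->|/(proj2 h)]; first by case: h.
apply: finite_index_inI; first by apply: fB; rewrite inE eqxx.
by apply: IH => j js; apply: fB; rewrite inE js orbT.
Qed.

(** The conjugate of [H] by [g] depends only on the coset of [g], so the core is
    a finite intersection. *)
Lemma normal_core H : subgroup H -> finite_index H ->
  exists C, [/\ normal_subgroup C, finite_index C & C `<=` H].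
Proof.
move=> sH fH; have [H1 HM HV] := sH; exists [set x | forall g, H (x ^ g)].
have sC : subgroup [set x | forall g, H (x ^ g)].
  split=> [g|x y hx hy g|x hx g] /=.
  - by rewrite conj1g.
  - by rewrite conjMg; apply: HM.
  - by rewrite conjVg; apply: HV.
split; last by move=> x /(_ 1); rewrite conjg1.
  by split=> // x y hx g; rewrite -conjgM; exact: hx.
apply/(finite_index_inT sC).
have [s es] := (finite_seqP _).1 fH.
pose r (D : set G) : G := if pselect (exists x, D x) is left e then projT1 (cid e) else 1.
have := @finite_index_in_bigI setT _ s (fun D => [set x | H (x ^ r D)]).
case=> [D _|T [f [ff fP]]].
  have [T [f [ff fP]]] := (finite_index_inT sH).1 fH.
  exists T, (fun x => f (x ^ r D)); split.
    by apply: (sub_finite_set _ ff) => _ [x _ <-]; exists (x ^ r D).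
  by move=> x y _ _ /fP => /(_ I I); rewrite -conjVg -conjMg.
exists T, f; split=> // x y _ _ /(fP _ _ I I) /= h g.
have Dg : lcoset g H \in s.
  have : [set lcoset x H | x in setT] (lcoset g H) by exists g.
  by rewrite es.
have := h _ Dg; set z := x^-1 * y; set k := r _.
have : lcoset g H k.
  rewrite /k /r; case: pselect => [e|]; first by case: cid.
  by case; exists g; apply/mem_lcoset; rewrite mulVg.
move=> /mem_lcoset Hgk Hz.
have -> : z ^ g = (z ^ k) ^ (k^-1 * g) by rewrite -conjgM mulVKg.
have Hkg : H (k^-1 * g) by have := HV _ Hgk; rewrite invgM invgK.
by rewrite conjgE; apply: (HM); [exact: HV|exact: HM].
Qed.

End FiniteIndex.

Section SubquotientSubgroups.
Local Open Scope group_scope.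
Variables (G : groupType) (Q : subquotient G) (P : set G).
Hypothesis sP : subgroup P.
Hypothesis dP : sq_den Q `<=` P.

(** As [P] contains [N], the cosets contained in [P] are those that meet it. *)
Definition sq_sub : set (sq_coset Q) := [set C | sval C `<=` P].

Lemma sq_sub_class x (Hx : sq_num Q x) : sq_sub (sq_class Hx) <-> P x.
Proof.
have [P1 PM PV] := sP; have [N1 NM NV] := sq_den_subgroup Q.
split=> [h|Px _ [n Nn <-]]; last exact/PM/dP.
by apply: h; exists 1; rewrite ?mulg1.
Qed.

Lemma sq_sub_subgroup : subgroup sq_sub.
Proof.
have [P1 PM PV] := sP; have [H1 HM HV] := sq_num_subgroup Q.
split=> [|C D|C].
- by rewrite [X in sq_sub X](sq_oneE H1); apply/sq_sub_class.
- have [x [Hx ->]] := sq_classP C; have [y [Hy ->]] := sq_classP D.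
  move=> /sq_sub_class Px /sq_sub_class Py.
  rewrite [X in sq_sub X](sq_mulE _ _ (HM _ _ Hx Hy)).
  by apply/sq_sub_class; exact: PM.
- have [x [Hx ->]] := sq_classP C => /sq_sub_class Px.
  rewrite [X in sq_sub X](sq_invE _ (HV _ Hx)).
  by apply/sq_sub_class; exact: PV.
Qed.

Lemma sq_sub_finite_index : finite_index_in (sq_num Q) P -> finite_index sq_sub.
Proof.
move=> [T [f [ff fP]]]; apply/(finite_index_inT sq_sub_subgroup).
have [H1 HM HV] := sq_num_subgroup Q.
pose r (C : sq_coset Q) := projT1 (cid (sq_classP C)).
have rP C : exists Hx : sq_num Q (r C), C = sq_class Hx by rewrite /r; case: cid.
exists T, (f \o r); split.
  by apply: (sub_finite_set _ ff) => _ [C _ <-]; exists (r C) => //; have [] := rP C.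
move=> C D _ _ /=; have [Hx eC] := rP C; have [Hy eD] := rP D.
move=> /(fP _ _ Hx Hy) h; rewrite [X in X^-1]eC [X in _ * X]eD.
rewrite [X in X * _](sq_invE _ (HV _ Hx)).
rewrite [X in sq_sub X](sq_mulE _ _ (HM _ _ (HV _ Hx) Hy)).
exact/sq_sub_class.
Qed.

End SubquotientSubgroups.

(** * Edges and squares of the cube complex *)

Section Parity.
Local Open Scope group_scope.
Variables (M : scomplex).
Implicit Types (f : M -> bool) (a b : raag M) (w : word M).

Definition word_parity f w := foldr (fun l acc => f l.1 (+) acc) false w.
(** The parity of the number of letters whose vertex satisfies [f]: the relators
    of [A_M] are even in each generator. *)
Definition parity f a := word_parity f (prepr a).

Lemma word_parity_cat f u v : word_parity f (u ++ v) = word_parity f u (+) word_parity f v.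
Proof. by elim: u => //= x u ->; rewrite addbA. Qed.

Lemma parityE f w : parity f (pclass _ w) = word_parity f w.
Proof.
rewrite /parity; move: (prepr_class (@raag_relators M) w); move: (prepr _) => w'.
elim=> {w w'} //.
- by move=> v u w _ -> _ ->.
- by move=> u u' v v' _ eu _ ev; rewrite !word_parity_cat eu ev.
- by move=> x b /=; case: (f x).
- by move=> _ [v [w [_ ->]]] /=; case: (f v); case: (f w).
Qed.

Lemma parityM f a b : parity f (a * b) = parity f a (+) parity f b.
Proof. by rewrite -(preprK a) -(preprK b) -pclassM !parityE word_parity_cat. Qed.

Lemma parity1 f : parity f 1 = false.
Proof. exact: (parityE f [::]). Qed.

Lemma parityV f a : parity f a^-1 = parity f a.
Proof.
have := parityM f a a^-1; rewrite mulgV parity1.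
by case: (parity f a); case: (parity _ _).
Qed.

Lemma parity_lelt f x : parity f (lelt x) = f x.1.
Proof. by rewrite parityE /= addbF. Qed.

Lemma lelt_inj : injective (@lelt M).
Proof.
move=> [v b] [w c] e.
have := parity_lelt (pred1 v) (v, b); rewrite e parity_lelt /= eqxx => /eqP ew.
rewrite ew; congr (v, _).
by have := congr1 (@raag_ht M) e; rewrite !raag_htE /word_ht !big_seq1 /=; case: b {e}; case: c.
Qed.

Lemma parity_deck (L : scomplex) (p : M -> L) (g : deck p) (P : pred L) a :
  parity (fun x => P (p x)) (deck_raag g a) = parity (fun x => P (p x)) a.
Proof.
rewrite -(preprK a) deck_raagE !parityE; elim: (prepr a) => //= x w ->.
by rewrite deck_over.
Qed.

End Parity.

Section Cells.
Local Open Scope group_scope.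
Variable M : scomplex.
Local Notation letter := (M * bool)%type.
Implicit Types (x y : letter) (a c : raag M).

Definition xor_fun k (m t : hcube k) : hcube k := [ffun i => t i (+) m i].

Lemma xor_isom k (m : hcube k) s t : hamming (xor_fun m s) (xor_fun m t) = hamming s t.
Proof.
apply: eq_card => i; rewrite !inE !ffunE.
by case: (s i); case: (t i); case: (m i).
Qed.

Definition xor_map k (m : hcube k) : cube_map k k := CubeMap (xor_isom m).

Definition lpow (b : bool) x : raag M := if b then lelt x else 1.

(** A cube is described from its bottom vertex with positive letters, an edge
    from its origin with a letter of either sign: this converts the second
    description into the first. *)
Lemma lpow_base b x : lpow b x = lpow (~~ x.2) x * lpow (b (+) ~~ x.2) (x.1, true).
Proof.
case: x => v [] /=; rewrite /lpow /= ?mul1g ?addbF //.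
have -> : lelt (v, false) = (lelt (v, true))^-1 by exact: (lelt_linvV (v, true)).
by case: b; rewrite /= ?mulg1 ?mulVg.
Qed.

Lemma lpow_comm b d x y : ladj x y -> lpow b x * lpow d y = lpow d y * lpow b x.
Proof.
by move=> xy; case: b; case: d; rewrite /lpow ?mul1g ?mulg1 //; exact: lelt_comm.
Qed.

Lemma raag_gen_lpow (b : bool) (v : M) : (if b then raag_gen v else 1) = lpow b (v, true).
Proof. by []. Qed.

Definition edge_fun c x (t : hcube 1) : raag M := c * lpow (t ord0) x.

Lemma edge_is_cube c x : is_cube (edge_fun c x).
Proof.
exists (c * lpow (~~ x.2) x), 1%N, (fun=> x.1), (xor_map [ffun=> ~~ x.2]).
split.
- by move=> i j _; rewrite !ord1.
- apply: simplexS (simplex1 x.1); apply/fsubsetP => v /imfsetP[i _ ->].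
  by rewrite inE.
- apply/funext => t; rewrite /edge_fun /cube_vertex /= big_mkcond big_ord_recl big_ord0 /=.
  by rewrite mulg1 !ffunE raag_gen_lpow -mulgA -lpow_base.
Qed.

Definition edge_cell c x : XM_cell M 1 := exist _ _ (edge_is_cube c x).

Definition square_fun c x y (t : hcube 2) : raag M :=
  c * (lpow (t ord0) x * lpow (t ord_max) y).

Lemma square_is_cube c x y : ladj x y -> is_cube (square_fun c x y).
Proof.
move=> xy.
exists (c * (lpow (~~ x.2) x * lpow (~~ y.2) y)), 2%N,
  (fun i => if i == ord0 then x.1 else y.1),
  (xor_map [ffun i => if i == ord0 then ~~ x.2 else ~~ y.2]).
split.
- move=> [[|[|//]] hi] [[|[|//]] hj]; rewrite -!val_eqE /= => e; try exact: val_inj.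
  + by case: xy.
  + by case: xy; rewrite e.
- have [_] := xy; apply: simplexS; apply/fsubsetP => v /imfsetP[i _ ->].
  by rewrite !inE; case: ifP => _; rewrite eqxx ?orbT.
- apply/funext => t; rewrite /square_fun /cube_vertex /= big_mkcond.
  rewrite !big_ord_recl big_ord0 /= mulg1 !ffunE /=.
  have -> : lift ord0 (ord0 : 'I_1) = ord_max :> 'I_2 by exact: val_inj.
  rewrite !raag_gen_lpow [lpow _ x in LHS]lpow_base [lpow (t ord_max) y in LHS]lpow_base.
  rewrite -!mulgA; congr (c * (_ * _)); rewrite !mulgA; congr (_ * _).
  exact: lpow_comm.
Qed.

Definition square_cell c x y (xy : ladj x y) : XM_cell M 2 :=
  exist _ _ (square_is_cube c xy).

Definition flip m (i : 'I_m) (t : hcube m) : hcube m := [ffun j => t j (+) (j == i)].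

Lemma hamming1_flip m (s t : hcube m) : hamming s t = 1%N -> exists i, t = flip i s.
Proof.
move=> /mem_card1[i hi]; exists i; apply/ffunP => j; rewrite ffunE.
have := hi j; rewrite !inE => <-; by case: (s j); case: (t j).
Qed.

(** The letters of a cube commute, so the one that changes can be moved to the
    end of the product. *)
Lemma cube_vertex_flip m a (s : 'I_m -> M) (t : hcube m) (i : 'I_m) :
  injective s -> simplex [fset s j | j in 'I_m]%fset ->
  cube_vertex a s (flip i t) = cube_vertex a s t * lelt (s i, ~~ t i).
Proof.
move=> sI sS; rewrite /cube_vertex -mulgA; congr (_ * _).
rewrite big_mkcond [X in _ = X * _]big_mkcond /=.
have adj j : j != i -> ladj (s j, true) (s i, ~~ t i).
  move=> ji; apply: (simplex_adjacent sS); [exact: in_imfset|exact: in_imfset|].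
  by move=> /sI e; rewrite e eqxx in ji.
have hi : i \in index_enum 'I_m by rewrite mem_index_enum.
elim: (index_enum _) (index_enum_uniq 'I_m) hi => // j r IH /= /andP[jr ur].
rewrite !big_cons /= !raag_gen_lpow ffunE inE => /orP[/eqP ij|ir].
  subst j; rewrite eqxx addbT.
  have -> : \prod_(k <- r) (if flip i t k then raag_gen (s k) else 1) =
            \prod_(k <- r) (if t k then raag_gen (s k) else 1).
    apply: eq_big_seq => k kr; rewrite ffunE.
    by case: eqP kr jr => [->|_ _ _]; [move=> ->|rewrite addbF].
  have cm : commute (lelt (s i, ~~ t i)) (\prod_(k <- r) (if t k then raag_gen (s k) else 1)).
    elim: r {IH ur} jr => [|k r IH]; first by rewrite big_nil /commute mulg1 mul1g.
    rewrite inE negb_or big_cons /= => /andP[ik ir]; apply: commuteM; last exact: IH.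
    rewrite raag_gen_lpow; apply/esym/(lpow_comm _ true)/adj; by rewrite eq_sym.
  rewrite -mulgA -cm mulgA; congr (_ * _).
  rewrite /lpow; case: (t i) => /=; last by rewrite mul1g.
  by rewrite -(lelt_linv (s i, true)).
rewrite IH // mulgA; have -> : (j == i) = false by apply/eqP => e; rewrite e ir in jr.
by rewrite addbF.
Qed.

Definition mk2 (b d : bool) : hcube 2 := [ffun k => if k == ord0 then b else d].

Lemma mk2E (t : hcube 2) : t = mk2 (t ord0) (t ord_max).
Proof.
apply/ffunP => -[[|[|//]] h]; rewrite ffunE -val_eqE /=; congr (t _); exact: val_inj.
Qed.

Lemma hamming_mk2 b d b' d' : hamming (mk2 b d) (mk2 b' d') = ((b != b') + (d != d'))%N.
Proof.
rewrite /hamming -sum1_card big_mkcond !big_ord_recl big_ord0 !inE !ffunE /= addn0.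
by case: (b != b'); case: (d != d').
Qed.

Lemma flipK m (i : 'I_m) t : flip i (flip i t) = t.
Proof. by apply/ffunP => j; rewrite !ffunE addbK. Qed.

Lemma hamming0 m (t : hcube m) : hamming t t = 0%N.
Proof. by apply: eq_card0 => i; rewrite !inE eqxx. Qed.

(** An isometric embedding of the square in a cube changes one coordinate along
    each of its two directions. *)
Lemma square_cellP (phi : XM_cell M 2) :
  exists c x y (xy : ladj x y), phi = square_cell c xy.
Proof.
case: phi => phi H; have [a [m [s [f [sI sS e]]]]] := H.
have hf b d b' d' : hamming (f (mk2 b d)) (f (mk2 b' d')) = ((b != b') + (d != d'))%N.
  by rewrite cube_isom hamming_mk2.
set t := f (mk2 false false).
have [i ei] : exists i, f (mk2 true false) = flip i t by apply: hamming1_flip; rewrite hf.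
have [j ej] : exists j, f (mk2 false true) = flip j t by apply: hamming1_flip; rewrite hf.
have [k ek] : exists k, f (mk2 true true) = flip k (flip i t).
  by apply: hamming1_flip; rewrite -ei hf.
have ij : i != j by apply/eqP => ij; have := hf true false false true; rewrite ei ej ij hamming0.
have ki : k != i.
  by apply/eqP => ki; have := hf false false true true; rewrite ek ki flipK hamming0.
have kj : k = j.
  apply/eqP/negPn/negP => kj.
  have := hf false true true true; rewrite ej ek => /mem_card1[l hl].
  have := hl i; have := hl k; rewrite !inE !ffunE !eqxx (negPf kj) (negPf ij).
  have ik : (i == k) = false by rewrite eq_sym (negPf ki).
  rewrite ?(negPf ki) ?ik !addbF !addbT.
  case: (t k); case: (t i) => /= /esym/eqP e1 /esym/eqP e2;
    by rewrite e1 e2 eqxx in ki.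
subst k.
have xy : ladj (s i, ~~ t i) (s j, ~~ t j).
  apply: (simplex_adjacent sS); [exact: in_imfset|exact: in_imfset|].
  by move=> /sI e'; rewrite e' eqxx in ij.
exists (cube_vertex a s t), (s i, ~~ t i), (s j, ~~ t j), xy.
apply: sig_eq; rewrite /= e; apply/funext => r; rewrite /= (mk2E r).
rewrite /square_fun !ffunE /=; case: (r ord0); case: (r ord_max); rewrite /lpow ?mul1g ?mulg1 //.
- rewrite ek !cube_vertex_flip // ffunE eq_sym (negPf ij) addbF.
  by rewrite mulgA.
- by rewrite ei cube_vertex_flip.
- by rewrite ej cube_vertex_flip.
Qed.

Lemma face_edge (t : hcube 1) b (i : 'I_2) : i = ord0 ->
  face i b t = mk2 b (t ord0).
Proof.
move=> ->; apply/ffunP => j; rewrite !ffunE; case: unliftP => [j'|] ->.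
  by rewrite (ord1 j').
by rewrite eqxx.
Qed.

Lemma face_edge1 (t : hcube 1) b (i : 'I_2) : i != ord0 ->
  face i b t = mk2 (t ord0) b.
Proof.
move=> i0; apply/ffunP => j; rewrite !ffunE; case: unliftP => [j'|] ->.
  rewrite (ord1 j'); have -> : lift i ord0 = ord0 by apply: val_inj; move: i0; case: i => -[|[|]].
  by rewrite eqxx.
by rewrite (negPf i0).
Qed.

Lemma square_side0 c x y (xy : ladj x y) (i : 'I_2) b : i = ord0 ->
  XM_restr (face i b) (square_cell c xy) = edge_cell (c * lpow b x) y.
Proof.
move=> i0; apply: sig_eq; apply/funext => t.
by rewrite /= /square_fun /edge_fun [face_fun _ _ _](face_edge t b i0) !ffunE /= mulgA.
Qed.

Lemma square_side1 c x y (xy : ladj x y) (i : 'I_2) b : i != ord0 ->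
  XM_restr (face i b) (square_cell c xy) = edge_cell (c * lpow b y) x.
Proof.
move=> i0; apply: sig_eq; apply/funext => t.
rewrite /= /square_fun /edge_fun [face_fun _ _ _](face_edge1 t b i0) !ffunE /=.
by rewrite -mulgA (lpow_comm _ _ xy).
Qed.

Definition edge_flip : cube_map 1 1 := xor_map [ffun=> true].

Lemma edge_flipE c x : XM_restr edge_flip (edge_cell c x) = edge_cell (c * lelt x) (linv x).
Proof.
apply: sig_eq; apply/funext => t; rewrite /= /edge_fun !ffunE addbT /lpow.
by case: (t ord0); rewrite /= ?mulg1 // lelt_linvV mulgK.
Qed.

Lemma edge_end_eq c x c' x' : c * lelt x = c' * lelt x' ->
  XM_restr (face ord0 true) (edge_cell c x) = XM_restr (face ord0 true) (edge_cell c' x').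
Proof.
move=> e; apply: sig_eq; apply/funext => t; rewrite /= /edge_fun /face_fun !ffunE.
by rewrite unlift_none.
Qed.

Lemma edge_cell_inj c x c' x' : edge_cell c x = edge_cell c' x' -> c = c' /\ x = x'.
Proof.
move=> /(congr1 sval) /= e.
have := congr1 (@^~ [ffun=> false]) e; rewrite /edge_fun !ffunE /lpow /= !mulg1 => ec.
have := congr1 (@^~ [ffun=> true]) e; rewrite /edge_fun !ffunE /lpow /= ec.
by move=> /mulgI/lelt_inj.
Qed.

End Cells.

(** * Hyperplanes of a special quotient *)

Section Subquotients.
Local Open Scope group_scope.
Variables (G : groupType) (Q : subquotient G).

Lemma sq_class_eqP x y (Hx : sq_num Q x) (Hy : sq_num Q y) :
  sq_class Hx = sq_class Hy <-> sq_den Q (x^-1 * y).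
Proof.
have [N1 NM NV] := sq_den_subgroup Q.
split=> [/(congr1 sval) /= e|h].
  by apply/mem_lcoset; rewrite e; apply/mem_lcoset; rewrite mulVg.
apply: sig_eq => /=; apply/seteqP; split=> z /mem_lcoset hz; apply/mem_lcoset.
  by have := NM _ _ (NV _ h) hz; rewrite invgM invgK -mulgA mulVKg.
by have := NM _ _ h hz; rewrite -mulgA mulVKg.
Qed.

Lemma sq_class_eq1 x (Hx : sq_num Q x) :
  sq_class Hx = 1 :> sq_coset Q <-> sq_den Q x.
Proof.
have [H1 _ _] := sq_num_subgroup Q; have [_ _ NV] := sq_den_subgroup Q.
rewrite [X in _ = X](sq_oneE H1) sq_class_eqP mulg1.
by split=> /NV //; rewrite invgK.
Qed.

Lemma sq_class_expg x (Hx : sq_num Q x) m :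
  exists Hm : sq_num Q (x ^+ m), (sq_class Hx : sq_coset Q) ^+ m = sq_class Hm.
Proof.
have [H1 HM _] := sq_num_subgroup Q.
elim: m => [|m [Hm IH]]; first by exists H1; rewrite expg0 [LHS](sq_oneE H1).
have Hm' : sq_num Q (x ^+ m.+1) by rewrite expgS; exact: HM.
exists Hm'; rewrite expgS IH [LHS](sq_mulE _ _ (HM _ _ Hx Hm)).
by apply: sq_class_eq; rewrite expgS.
Qed.

Lemma orbit_act (X : cube_complex) (a : cube_action G X) (K : set G) k g (c : cell X k) :
  subgroup K -> K g -> Defs.orbit a K (cact a g c) = Defs.orbit a K c.
Proof.
move=> [K1 KM KV] Kg; apply/seteqP; split=> d [h Kh <-].
  by exists (h * g); [exact: KM|rewrite cactM].
by exists (h * g^-1); [apply: KM => //; exact: KV|rewrite -cactM mulgVK].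
Qed.

End Subquotients.

Section SpecialQuotient.
Local Open Scope group_scope.
Variables (M L : scomplex) (p : M -> L).
Local Notation letter := (M * bool)%type.
Implicit Types (x y : letter) (g k : deck p) (c d : raag M) (kappa : raag_deck p).

Hypothesis cov : covering p.
Hypothesis conn : sconnected M.
Hypothesis L_flag : flag L.
Hypothesis deck_finite : finite_set [set: deck p].
Variables (S : set int) (n : int) (hS : shift_invariant S n) (K : set (GLMZ p hS)).
Hypothesis sK : subgroup K.
Hypothesis tK : torsion_free K.
Local Notation Y := (quot_complex (XLM_action p hS) K).
Hypothesis spK : special Y.

Definition preimageK : set (raag_deck p) :=
  [set c | exists Hc : sq_num (GLMZ_sq p hS) c, K (sq_class Hc)].

Lemma preimageK_Hn : preimageK `<=` Hn p n.
Proof. by move=> c [Hc _]. Qed.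

Lemma preimageK_subgroup : subgroup preimageK.
Proof.
have [K1 KM KV] := sK; have [H1 HM HV] := sq_num_subgroup (GLMZ_sq p hS).
split=> [|c d [Hc Kc] [Hd Kd]|c [Hc Kc]].
- by exists H1; have := K1; rewrite [X in K X](sq_oneE H1).
- exists (HM _ _ Hc Hd); have := KM _ _ Kc Kd.
  by rewrite [X in K X](sq_mulE _ _ (HM _ _ Hc Hd)).
- exists (HV _ Hc); have := KV _ Kc.
  by rewrite [X in K X](sq_invE _ (HV _ Hc)).
Qed.

Lemma NS_preimageK : NS p S `<=` preimageK.
Proof.
have [K1 _ _] := sK => c Nc; have Hc := sq_den_sub (s := GLMZ_sq p hS) Nc; exists Hc.
suff -> : sq_class Hc = 1 :> GLMZ p hS by [].
exact/sq_class_eq1.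
Qed.

Lemma preimageK_torsion kappa m : preimageK kappa -> (0 < m)%N ->
  NS p S (kappa ^+ m) -> NS p S kappa.
Proof.
move=> [Hc Kc] m0 Nm; have [Hm e] := sq_class_expg Hc m.
apply/(sq_class_eq1 (Q := GLMZ_sq p hS) Hc)/(tK Kc m0).
by rewrite [LHS]e; apply/sq_class_eq1.
Qed.

Lemma preimageK_finite_index : finite_index K -> finite_index_in (Hn p n) preimageK.
Proof.
move=> fK; exists (set (GLMZ p hS)), (fun c : raag_deck p =>
  if pselect (sq_num (GLMZ_sq p hS) c) is left Hc
  then lcoset (sq_class Hc : GLMZ p hS) K else set0).
split; first by apply: (sub_finite_set _ fK) => _ [c Hc <-]; case: pselect.
move=> c d Hc Hd; case: pselect => // Hc'; case: pselect => // Hd' e.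
have [_ HM HV] := sq_num_subgroup (GLMZ_sq p hS).
exists (HM _ _ (HV _ Hc') Hd'); have [K1 _ _] := sK.
have : lcoset (sq_class Hd' : GLMZ p hS) K (sq_class Hd').
  by apply/mem_lcoset; rewrite mulVg.
rewrite -e => /mem_lcoset; rewrite [X in X * _](sq_invE Hc' (HV _ Hc')).
by rewrite [X in K X](sq_mulE _ _ (HM _ _ (HV _ Hc') Hd')).
Qed.

(** The powers of [k] cannot all differ in a finite group. *)
Lemma deck_torsion k : exists2 m, (0 < m)%N & k ^+ m = 1.
Proof.
have [s es] := (finite_seqP _).1 deck_finite.
have sub : {subset [seq k ^+ i | i <- iota 0 (size s).+1] <= s}.
  by move=> h _; have : [set: deck p] h by []; rewrite es.
have /uniqPn : ~~ uniq [seq k ^+ i | i <- iota 0 (size s).+1].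
  apply/negP => /uniq_leq_size /(_ sub); by rewrite size_map size_iota ltnn.
move=> /(_ 1) [i [j [ij]]]; rewrite size_map size_iota => js.
rewrite !(nth_map 0%N) ?size_iota ?(ltn_trans ij) // !nth_iota ?(ltn_trans ij) // !add0n.
move=> e; exists (j - i)%N; first by rewrite subn_gt0.
by apply: (@mulgI _ (k ^+ i)); rewrite -expgnDr subnKC ?mulg1 ?(ltnW ij).
Qed.

Lemma vertex_act_stab kappa c : vertex_act kappa c = c ->
  kappa = of_raag p c * of_deck (rd_deck kappa) * (of_raag p c)^-1.
Proof.
case: kappa => a k; rewrite /vertex_act /= => e.
rewrite -of_raagV -mulgA of_deck_raag mulgA -of_raagM !rdM /= !deck_raag1 !mulg1 mul1g.
have -> : a = c * deck_raag k c^-1.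
  by rewrite -{1}e -mulgA -deck_raagM mulgV deck_raag1 mulg1.
by [].
Qed.

(** Such an element is conjugate to a deck transformation, which has finite
    order; but [K] is torsion-free. This is how the quotient inherits the local
    structure of [X_M / N(S)]. *)
Lemma preimageK_stab kappa c : preimageK kappa -> vertex_act kappa c = c -> NS p S kappa.
Proof.
move=> Kk /vertex_act_stab e; have [m m0 km] := deck_torsion (rd_deck kappa).
apply: (preimageK_torsion Kk m0); have [N1 _ _] := NS_subgroup p S.
suff -> : kappa ^+ m = 1 by [].
have -> : kappa = of_deck (rd_deck kappa) ^ (of_raag p c)^-1.
  by rewrite conjgE invgK mulgA.
by rewrite /= -conjXg -of_deckX km conj1g.
Qed.

Lemma preimageK_frame kappa c : preimageK kappa -> vertex_act kappa c = c ->
  frame_change S (raag_ht c) (rd_deck kappa).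
Proof.
move=> Kk e; have := preimageK_stab Kk e; rewrite {1}(vertex_act_stab e).
exact: stabilizer_NS.
Qed.

Definition xcls m (phi : XM_cell M m) : cell (XLM p S) m :=
  exist _ _ (ex_intro _ phi erefl).
(** The cell of the quotient that is represented by a cell of [X_M]. *)
Definition ycls m (phi : XM_cell M m) : cell Y m :=
  exist _ _ (ex_intro _ (xcls phi) erefl).

Lemma ycls_surj m (e : cell Y m) : exists phi, e = ycls phi.
Proof.
case: e => O [[O' [phi e']] e]; exists phi; apply: sig_eq; rewrite /= e.
by apply: (congr1 (fun z => Defs.orbit (XLM_action p hS) K z)); apply: sig_eq.
Qed.

Lemma restr_ycls i m (f : cube_map i m) phi : restr f (ycls phi) = ycls (XM_restr f phi).
Proof.
apply: sig_eq; apply: etrans (restr_orbit (XLM_action p hS) K f (xcls phi)) _.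
apply: (congr1 (fun z => Defs.orbit (XLM_action p hS) K z)); apply: sig_eq.
exact: (restr_orbit (XM_action p) (NS p S) f phi).
Qed.

Lemma sq_act_xcls kappa (H : sq_num (GLMZ_sq p hS) kappa) m (phi : XM_cell M m) :
  cact (XLM_action p hS) (sq_class H) (xcls phi) = xcls (XM_act kappa phi).
Proof.
by apply: sig_eq; rewrite /= (set_act_coset (Q := GLMZ_sq p hS) (XM_action p)).
Qed.

Lemma ycls_eqP m (phi psi : XM_cell M m) :
  ycls phi = ycls psi <-> exists2 kappa, preimageK kappa & psi = XM_act kappa phi.
Proof.
have [K1 KM KV] := sK; split=> [/(congr1 sval) /= e|[kappa [H Kk] ->]]; last first.
  apply: sig_eq; rewrite /= -(sq_act_xcls H); apply/esym.
  exact: (orbit_act (XLM_action p hS) (xcls phi) sK Kk).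
have : Defs.orbit (XLM_action p hS) K (xcls psi) (xcls psi) by exists 1 => //; rewrite cact1.
rewrite -e => -[C KC]; have [c [Hc eC]] := sq_classP C.
rewrite eC in KC *; rewrite sq_act_xcls => /(congr1 sval) /= e'.
have [N1 NM NV] := NS_subgroup p S.
have : Defs.orbit (XM_action p) (NS p S) psi psi by exists 1 => //; rewrite cact1.
rewrite -e' => -[d Nd <-]; exists (d * c); last by rewrite XM_actM.
by have [_ PM _] := preimageK_subgroup; apply: PM; [exact: NS_preimageK|exists Hc].
Qed.

Definition yedge c x : cell Y 1 := ycls (edge_cell c x).

Lemma XM_act_edge kappa c x :
  XM_act kappa (edge_cell c x) = edge_cell (vertex_act kappa c) (lact (rd_deck kappa) x).
Proof.
apply: sig_eq; apply/funext => t; rewrite /= /vertex_act /edge_fun deck_raagM mulgA.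
congr (_ * _); case: (t ord0); rewrite /lpow ?deck_raag1 //; exact: deck_raag_lelt.
Qed.

Lemma yedge_eqP c x c' x' : yedge c x = yedge c' x' <->
  exists kappa, [/\ preimageK kappa, c' = vertex_act kappa c & x' = lact (rd_deck kappa) x].
Proof.
split=> [/ycls_eqP[kappa Kk]|[kappa [Kk -> ->]]].
  by rewrite XM_act_edge => /edge_cell_inj[-> ->]; exists kappa.
by apply/ycls_eqP; exists kappa => //; rewrite XM_act_edge.
Qed.

Lemma side_square c x y (xy : ladj x y) (i : 'I_2) b :
  side (ycls (square_cell c xy)) i b =
  if i == ord0 then yedge (c * lpow b x) y else yedge (c * lpow b y) x.
Proof.
rewrite /side restr_ycls; case: ifPn => [/eqP i0|i0].
  by rewrite square_side0.
by rewrite square_side1.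
Qed.

Lemma opposite_sidesP (e e' : cell Y 1) : opposite_sides e e' <->
  exists c x y, [/\ ladj x y, e = yedge c x & e' = yedge (c * lelt y) x].
Proof.
split=> [[q [i [-> ->]]]|[c [x [y [xy -> ->]]]]].
  have [phi ->] := ycls_surj q; have [c [x [y [xy ->]]]] := square_cellP phi.
  rewrite !side_square /lpow mulg1; case: ifP => _.
    by exists c, y, x; split=> //; exact: ladjC.
  by exists c, x, y.
exists (ycls (square_cell c xy)), ord_max; rewrite !side_square /=.
by rewrite /lpow mulg1.
Qed.

Lemma lelt_linvK c x : c * lelt x * lelt (linv x) = c.
Proof. by rewrite -mulgA lelt_linv mulg1. Qed.
Lemma lelt_commA c x y : ladj x y -> c * lelt x * lelt y = c * lelt y * lelt x.
Proof. by move=> xy; rewrite -mulgA (lelt_comm xy) mulgA. Qed.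

Lemma adjacent_at_terminalP (e e' : cell Y 1) : adjacent_at_terminal e e' <->
  exists d u v, [/\ ladj u v, e = yedge (d * lelt u) (linv u) & e' = yedge (d * lelt v) (linv v)].
Proof.
split=> [[q [i [j [ij -> ->]]]]|[d [u [v [uv -> ->]]]]].
  have [phi ->] := ycls_surj q; have [c [x [y [xy ->]]]] := square_cellP phi.
  rewrite !side_square /lpow.
  have e1 : c * lelt x = c * lelt x * lelt y * lelt (linv y) by rewrite lelt_linvK.
  have e2 : c * lelt y = c * lelt x * lelt y * lelt (linv x).
    by rewrite (lelt_commA _ xy) lelt_linvK.
  move: ij; case: (eqVneq i ord0) => [->|i0]; case: (eqVneq j ord0) => [_|j0] //= ij.
  - exists (c * lelt x * lelt y), (linv y), (linv x); rewrite !linvK -e1 -e2.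
    by split=> //; exact: ladjC.
  - by exists (c * lelt x * lelt y), (linv x), (linv y); rewrite !linvK -e1 -e2.
  - case/eqP: ij; move: i0 j0; case: i => -[|[|//]] ? //; case: j => -[|[|//]] ? // _ _.
    exact: val_inj.
have uv' : ladj (linv u) (linv v) by [].
exists (ycls (square_cell (d * lelt u * lelt v) uv')), ord_max, ord0.
rewrite !side_square /= /lpow; split=> //; first by rewrite lelt_linvK.
by rewrite (lelt_commA _ uv) lelt_linvK.
Qed.

Definition yrev (e : cell Y 1) : cell Y 1 := restr edge_flip e.

Lemma yrevE c x : yrev (yedge c x) = yedge (c * lelt x) (linv x).
Proof. by rewrite /yrev restr_ycls edge_flipE. Qed.

Lemma parallel_rev e e' : parallel e e' -> parallel (yrev e) (yrev e').
Proof.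
elim=> {e e'} [e e' /opposite_sidesP[c [x [y [xy -> ->]]]]|e|e e' _ h|e e' e'' _ h _ h'].
- apply: rst_step; apply/opposite_sidesP; exists (c * lelt x), (linv x), y.
  by rewrite !yrevE lelt_commA; [|exact: ladjC].
- exact: rst_refl.
- exact: rst_sym.
- exact: rst_trans h h'.
Qed.

Definition hyp c x : set (cell Y 1) := [set e | parallel (yedge c x) e].

Lemma hypP c x : hyperplane (hyp c x).
Proof. by exists (yedge c x). Qed.
Lemma hyp_mem c x : hyp c x (yedge c x).
Proof. exact: rst_refl. Qed.

Lemma hyp_eqP c x c' x' : hyp c x = hyp c' x' <-> parallel (yedge c x) (yedge c' x').
Proof.
split=> [e|h]; first by have := hyp_mem c' x'; rewrite -e.
apply/seteqP; split=> e he; [apply: rst_trans he; exact: rst_sym|exact: rst_trans h he].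
Qed.

Lemma hyp_edge c x c' x' : yedge c x = yedge c' x' -> hyp c x = hyp c' x'.
Proof. by rewrite /hyp => ->. Qed.

Lemma hyp_rev c x c' x' : hyp c x = hyp c' x' ->
  hyp (c * lelt x) (linv x) = hyp (c' * lelt x') (linv x').
Proof. by move=> /hyp_eqP/parallel_rev h; apply/hyp_eqP; rewrite -!yrevE. Qed.

Lemma hyp_adj c x y : ladj x y -> hyp (c * lelt y) x = hyp c x.
Proof.
by move=> xy; apply/esym/hyp_eqP/rst_step/opposite_sidesP; exists c, x, y.
Qed.

Lemma adjacent_terminal_sides (e e' : cell Y 1) :
  adjacent_at_terminal e e' -> adjacent_sides e e'.
Proof. by move=> [q [i [j [ij -> ->]]]]; exists q, i, j, true, true. Qed.

Lemma terminal_rev c x x' :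
  terminal (yedge (c * lelt x) (linv x)) = terminal (yedge (c * lelt x') (linv x')).
Proof.
rewrite /terminal !restr_ycls; congr (ycls _); apply: edge_end_eq.
by rewrite !lelt_linvK.
Qed.

(** Two edges of one hyperplane with the same origin coincide, since the
    hyperplane neither osculates nor intersects itself. Reversing them puts the
    common vertex at their ends, where osculation is measured. *)
Lemma hyp_inj c x x' : hyp c x = hyp c x' ->
  exists2 k : deck p, frame_change S (raag_ht c) k & lact k x = x'.
Proof.
move=> h; set e := yedge (c * lelt x) (linv x); set e' := yedge (c * lelt x') (linv x').
have [e1|ne] := pselect (e = e').
  have : yedge c x = yedge c x'.
    have := congr1 yrev e1; by rewrite !yrevE !linvK !lelt_linvK.
  move=> /yedge_eqP[kappa [Kk /esym ec ex]]; exists (rd_deck kappa) => //.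
  exact: preimageK_frame.
exfalso; have [/(_ _ (hypP (c * lelt x) (linv x)))[nsi nso] _] := spK.
have he' : hyp (c * lelt x) (linv x) e' by rewrite (hyp_rev h); exact: hyp_mem.
apply: nso; exists e, e'; split; [exact: hyp_mem|exact: he'|].
split=> //; first exact: terminal_rev.
move=> /adjacent_terminal_sides adj; apply: nsi; exists e, e'.
by split=> //; exact: hyp_mem.
Qed.

(** The two hyperplanes cross at [c], so they do not inter-osculate at [c']; the
    edges there span a square of the quotient, which is lifted by
    [preimageK_frame]. *)
Lemma hyp_square c x y c' x' y' : ladj x y -> hyp c x = hyp c' x' -> hyp c y = hyp c' y' ->
  exists2 k : deck p, frame_change S (raag_ht c') k & ladj x' (lact k y').
Proof.
move=> xy hx hy; pose H1 := hyp (c' * lelt x') (linv x'); pose H2 := hyp (c' * lelt y') (linv y').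
have int : intersect H1 H2.
  exists (yedge (c * lelt x) (linv x)), (yedge (c * lelt y) (linv y)).
  rewrite /H1 /H2 -(hyp_rev hx) -(hyp_rev hy); split; try exact: hyp_mem.
  by apply/adjacent_terminal_sides/adjacent_at_terminalP; exists c, x, y.
have [sp1 sp2] := spK.
have [nsi _] := sp1 _ (hypP (c' * lelt x') (linv x')).
set e1 := yedge (c' * lelt x') (linv x'); set e2 := yedge (c' * lelt y') (linv y').
have ne : e1 <> e2.
  by move=> e; apply: nsi; move: int; rewrite /H2 -(hyp_edge e).
have adj : adjacent_at_terminal e1 e2.
  apply: contrapT => nadj; apply: (sp2 H1 H2 (hypP _ _) (hypP _ _)); split=> //.
  exists e1, e2; split; try exact: hyp_mem.
  by split=> //; exact: terminal_rev.
have [d [u [v [uv /(congr1 yrev) ex /(congr1 yrev) ey]]]] := (adjacent_at_terminalP _ _).1 adj.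
rewrite !yrevE !linvK !lelt_linvK in ex ey.
have [k1 [K1 ec1 ex1]] := (yedge_eqP _ _ _ _).1 (esym ex).
have [k2 [K2 ec2 ey2]] := (yedge_eqP _ _ _ _).1 (esym ey).
have [_ PM PV] := preimageK_subgroup.
have Kk : preimageK (k1 * k2^-1) by apply: PM => //; exact: PV.
have act : vertex_act (k1 * k2^-1) c' = c'.
  have va (g h : raag_deck p) (b : raag M) : vertex_act (g * h) b = vertex_act g (vertex_act h b).
    by rewrite /vertex_act /= deck_raag_mul deck_raagM mulgA.
  rewrite {1}ec2 -va mulgVK; exact: esym.
exists (rd_deck (k1 * k2^-1)); first exact: preimageK_frame.
rewrite /= ex1 ey2 lactM lactK; exact: ladj_act.
Qed.

(** The label of an unoriented edge: its hyperplane, with the upward orientation,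
    its image in [L], and the parity of the number of letters over that vertex of
    [L] at its bottom. The last component, which is constant along a hyperplane,
    tells apart two consecutive edges of the same hyperplane. *)
Definition label c x : set (cell Y 1) * L * bool :=
  let: (c', x') := if x.2 then (c, x) else (c * lelt x, linv x) in
  (hyp c' x', p x.1, parity (fun v => p v == p x.1) c').

Lemma label_rev c x : label (c * lelt x) (linv x) = label c x.
Proof.
rewrite /label; case: x => v [] /=; last by [].
by rewrite lelt_linvK.
Qed.

Lemma hyp_label c x c' x' : x.2 = x'.2 -> label c x = label c' x' -> hyp c x = hyp c' x'.
Proof.
move=> ex; rewrite /label -ex; case: x.2; first by case.
by case=> /hyp_rev + _ _; rewrite !linvK !lelt_linvK.
Qed.

Lemma label_adj c x y : ladj x y -> label (c * lelt y) x = label c x.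
Proof.
move=> xy; have [npxy _] := covering_adjacent cov xy.
have par (d : raag M) : parity (fun v => p v == p x.1) (d * lelt y) =
    parity (fun v => p v == p x.1) d.
  rewrite parityM parity_lelt; have -> : (p y.1 == p x.1) = false by apply/eqP => /esym.
  by rewrite addbF.
rewrite /label; case: ifP => _; first by rewrite hyp_adj // par.
by rewrite -(lelt_commA _ xy) hyp_adj // par.
Qed.

(** The parity condition makes this subgroup preserve the last component of
    [label]. *)
Definition evenK : set (raag_deck p) :=
  [set kappa | preimageK kappa /\ forall v, parity (fun w => p w == v) (rd_raag kappa) = false].

Lemma evenK_subgroup : subgroup evenK.
Proof.
have [P1 PM PV] := preimageK_subgroup; split=> [|c d [Kc ec] [Kd ed]|c [Kc ec]].
- by split=> // v; exact: parity1.
- by split=> [|v]; [exact: PM|rewrite /= parityM (parity_deck _ (pred1 v)) ec ed].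
- by split=> [|v]; [exact: PV|rewrite /= (parity_deck _ (pred1 v)) parityV ec].
Qed.

Lemma NS_evenK : NS p S `<=` evenK.
Proof.
move=> c Nc; split; first exact: NS_preimageK.
move=> v; apply: (Nc [set c | parity (fun w => p w == v) (rd_raag c) = false]); split.
  split=> [|d e|d] /=; first exact: parity1.
    by move=> hd he; rewrite parityM (parity_deck _ (pred1 v)) hd he.
  by move=> hd; rewrite (parity_deck _ (pred1 v)) parityV hd.
move=> _ [b [g [_ ->]]] /=; rewrite !(parityM, parity_deck _ (pred1 v)) parityV.
by rewrite parity1 addbF addbb.
Qed.

Lemma label_act kappa c x : evenK kappa ->
  label (vertex_act kappa c) (lact (rd_deck kappa) x) = label c x.
Proof.
move=> [Kk ek].
have par v d : parity (fun w => p w == v) (vertex_act kappa d) = parity (fun w => p w == v) d.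
  by rewrite /vertex_act parityM (parity_deck _ (pred1 v)) ek.
have hy d y : hyp (vertex_act kappa d) (lact (rd_deck kappa) y) = hyp d y.
  by apply/esym/hyp_edge/yedge_eqP; exists kappa.
rewrite /label /= deck_over; case: ifP => _; first by rewrite hy par.
have -> : vertex_act kappa c * lelt (lact (rd_deck kappa) x) = vertex_act kappa (c * lelt x).
  by rewrite /vertex_act deck_raagM deck_raag_lelt mulgA.
by rewrite -lact_inv hy par.
Qed.

Lemma label_inj c x x' : label c x = label c x' ->
  exists2 k : deck p, frame_change S (raag_ht c) k & lact k x = x'.
Proof.
move=> e; apply: hyp_inj; apply: hyp_label => //; move: e.
rewrite /label; case: x x' => v [] [w []] //= [_ ev]; rewrite ev.
  by rewrite parityM parity_lelt /= eqxx addbT; case: parity.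
by rewrite parityM parity_lelt /= ev eqxx addbT; case: parity.
Qed.

(** If the orientations disagree, the edges at [c] are replaced by the reversed
    ones, which span the same square. *)
Lemma label_square c x y c' x' y' : ladj x y ->
  label c x = label c' x' -> label c y = label c' y' ->
  exists2 k : deck p, frame_change S (raag_ht c') k & ladj x' (lact k y').
Proof.
have turn (d : raag M) u w d' u' : ladj u w -> label d u = label d' u' ->
    exists d1 u1, [/\ ladj u1 w, hyp d1 u1 = hyp d' u' &
      label d1 w = label d w /\ hyp d1 w = hyp d w].
  move=> uw e; have [eb|nb] := eqVneq u.2 u'.2.
    by exists d, u; split=> //; exact: hyp_label.
  exists (d * lelt u), (linv u); split=> //.
    apply: hyp_label; last by rewrite label_rev.
    by move: nb; rewrite /=; case: u.2; case: u'.2.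
  by split; [apply: label_adj|apply: hyp_adj]; exact: ladjC.
move=> xy /(turn _ _ _ _ _ xy)[c1 [x1 [xy1 hx1 [<- _]]]] ey.
have [c2 [y2 [yx2 hy2 [_ hx2]]]] := turn _ _ _ _ _ (ladjC xy1) ey.
by apply: (hyp_square (ladjC yx2) _ hy2); rewrite hx2.
Qed.

End SpecialQuotient.

(** * Finite permutation actions from special quotients *)

Lemma finite_words (T : Type) (A : set T) (m : nat) : finite_set A ->
  finite_set [set s : seq T | (size s <= m)%N /\ forall i x, (i < size s)%N -> A (nth x s i)].
Proof.
move=> fA; elim: m => [|m IH].
  apply: (sub_finite_set _ (finite_set1 [::])) => s [].
  by case: s.
have f2 := finite_image2 cons fA IH.
have fU : finite_set ([set [::]] `|` [set x :: s | x in A & s in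
    [set s : seq T | (size s <= m)%N /\ forall i x, (i < size s)%N -> A (nth x s i)]]).
  by rewrite finite_setU; split=> //; exact: finite_set1.
apply: (sub_finite_set _ fU) => -[|x s] [sm hs]; first by left.
right; exists x; first exact: (hs 0%N x).
exists s => //; split=> // i y; exact: (hs i.+1 y).
Qed.

Section Length.
Local Open Scope group_scope.
Variables (M L : scomplex) (p : M -> L).
Local Notation letter := (M * bool)%type.
Implicit Types (x y : letter) (g k : deck p) (a b c : raag M) (d e kappa : raag_deck p).
Hypothesis cov : covering p.
Hypothesis conn : sconnected M.
Hypothesis L_flag : flag L.

Lemma len_word S w g : (len S (of_raag p (pclass _ w) * of_deck g)%g <= size w)%N.
Proof.
rewrite (len_deckr cov conn L_flag).
have := gact_word cov conn L_flag w 1 (base_reduced p S).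
move=> /fequiv_size; rewrite size_reframe => e; rewrite /len e.
exact: leq_trans (size_wact _ _ _) _.
Qed.

(** The triangle inequality, from the base vertex through [d]. *)
Lemma len_mul S d e : (len S (d * e)%g <= len S d + len (shiftS S (rd_ht d)) e)%N.
Proof.
pose t := gact (shiftS S (rd_ht d)) (base p) e.
have et : NSeq (shiftS S (rd_ht d)) e (ev t) by exact: ev_nf.
have det : NSeq S (d * e) (d * ev t).
  apply/(NS_conjE _ d); move: et; rewrite /NSeq; congr (NS p _ _).
  have cj (G : groupType) (u v w : G) : (u * v / (u * w)) ^ u = v / w.
    by rewrite conjgE invgM !mulgA mulVg mul1g mulgVK.
  exact/esym/cj.
rewrite (len_NSeq cov conn L_flag det) /len (size_gactM cov conn L_flag) //.
apply: leq_trans (size_gact_ev cov conn L_flag _ _) _ => //.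
exact: gact_reduced.
Qed.

(** The distance is symmetric: the inverse of the shortest word is a word of the
    same length read from the other end. *)
Lemma len_inv S e : (len (shiftS S (rd_ht e)) (e^-1)%g <= len S e)%N.
Proof.
pose t := gact S (base p) e.
have et : NSeq S e (ev t) by exact: ev_nf.
have et' : NSeq (shiftS S (rd_ht e)) e^-1 (ev t)^-1.
  rewrite /NSeq invgK; have [_ _ NV] := NS_subgroup p (shiftS S (rd_ht e)).
  have := NV _ ((NS_conjE _ e _).2 et); congr (NS p _ _).
  have cj (G : groupType) (u v : G) : ((u / v) ^ u)^-1 = u^-1 * v.
    by rewrite conjgE !invgM !invgK !mulgA mulgVK.
  exact: cj.
rewrite (len_NSeq cov conn L_flag et') [X in (_ <= X)%N](_ : _ = size t.2) //.
rewrite /ev invgM -of_deckV -of_raagV -[(pclass _ _)^-1]/(pres_inv _).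
have -> : pres_inv (pclass _ (rev t.2)) = pclass _ (word_inv (rev t.2)) :> raag M.
  apply: (@mulgI _ (pclass _ (rev t.2) : raag M)).
  rewrite [LHS]mulgV -pclassM; apply/esym/pclassP.
  by have := word_invV (@raag_relators M) (word_inv (rev t.2)); rewrite word_invK.
apply: leq_trans (len_word _ _ _) _.
by rewrite /word_inv size_rev size_map size_rev.
Qed.

End Length.

Section Walk.
Local Open Scope group_scope.
Variables (M L : scomplex) (p : M -> L).
Local Notation letter := (M * bool)%type.
Implicit Types (x y : letter) (g k : deck p) (a b c : raag M) (d e kappa : raag_deck p).
Hypothesis cov : covering p.
Hypothesis conn : sconnected M.
Hypothesis L_flag : flag L.
Hypothesis M_finite : finite_set [set: M].
Variable S : set int.

(** The labelling of edges by hyperplanes, reduced to the properties on which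
    the construction of a finite permutation action relies. *)
Variables (E : set (raag_deck p)) (T : Type) (label : raag M -> letter -> T).
Hypothesis sE : subgroup E.
Hypothesis NS_E : NS p S `<=` E.
Hypothesis label_rev : forall c x, label (c * lelt x) (linv x) = label c x.
Hypothesis label_adj : forall c x y, ladj x y -> label (c * lelt y) x = label c x.
Hypothesis label_act : forall kappa c x, E kappa ->
  label (vertex_act kappa c) (lact (rd_deck kappa) x) = label c x.
Hypothesis label_inj : forall c x x', label c x = label c x' ->
  exists2 k : deck p, frame_change S (raag_ht c) k & lact k x = x'.
Hypothesis label_square : forall c x y c' x' y', ladj x y ->
  label c x = label c' x' -> label c y = label c' y' ->
  exists2 k : deck p, frame_change S (raag_ht c') k & ladj x' (lact k y').

(** These orbits are the vertices of [X_M / N(S)]. *)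
Definition orb b : set (raag M) := [set vertex_act kappa b | kappa in NS p S].

Lemma vertex_actM d e b : vertex_act (d * e) b = vertex_act d (vertex_act e b).
Proof. by rewrite /vertex_act /= deck_raag_mul deck_raagM mulgA. Qed.

Lemma vertex_act1 b : vertex_act (1 : raag_deck p) b = b.
Proof. by rewrite /vertex_act /= deck_raag_one mul1g. Qed.

Lemma vertex_act_raag a b : vertex_act (of_raag p a) b = a * b.
Proof. by rewrite /vertex_act /= deck_raag_one. Qed.

Lemma vertex_act_deck g b : vertex_act (of_deck g) b = deck_raag g b.
Proof. by rewrite /vertex_act /= mul1g. Qed.

Lemma vertex_act_lelt d b x :
  vertex_act d (b * lelt x) = vertex_act d b * lelt (lact (rd_deck d) x).
Proof. by rewrite /vertex_act deck_raagM deck_raag_lelt mulgA. Qed.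

Lemma of_raag_act d b : of_raag p (vertex_act d b) = d * of_raag p b * of_deck (rd_deck d)^-1.
Proof.
by case: d => a g; rewrite /vertex_act !rdM /= !mulg1 deck_raag1 !mulg1 mulgV.
Qed.

Lemma orb_eqP b c : orb b = orb c <-> exists2 kappa, NS p S kappa & c = vertex_act kappa b.
Proof.
have [N1 NM NV] := NS_subgroup p S.
split=> [e|[d Nd ->]].
  have : orb c c by exists 1; rewrite ?vertex_act1.
  by rewrite -e => -[d Nd <-]; exists d.
apply/seteqP; split=> z [e Ne <-].
  exists (e * d^-1); first by apply: NM => //; exact: NV.
  by rewrite -vertex_actM mulgVK.
by exists (e * d); [exact: NM|rewrite vertex_actM].
Qed.

Lemma orb_frame b k x : frame_change S (raag_ht b) k ->
  orb (b * lelt (lact k x)) = orb (b * lelt x).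
Proof.
move=> hk; apply/esym/orb_eqP; exists (of_raag p b * of_deck k * (of_raag p b)^-1).
  have [N1 _ _] := NS_subgroup p S.
  case: hk => [->|Sb]; last exact: NS_gen.
  by rewrite [of_deck 1](_ : _ = 1) // mulg1 mulgV.
rewrite !vertex_actM -of_raagV !vertex_act_raag vertex_act_deck mulKg.
by rewrite deck_raag_lelt.
Qed.

Variable c0 : raag M.
(** The minimum of this function, the distance between the vertices given by [1]
    and [c0], is attained on the interval between them. *)
Definition dist b := (len S (of_raag p b) +
  len (shiftS S (raag_ht c0)) (of_raag p (c0^-1 * b)%g))%N.

Lemma len_orb S' d b : NS p S' d -> len S' (of_raag p (vertex_act d b)) = len S' (of_raag p b).
Proof.
move=> Nd; rewrite of_raag_act (len_deckr cov conn L_flag).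
apply: (len_NSeq cov conn L_flag); exact: NSeq_mull.
Qed.

Lemma dist_orb b c : orb b = orb c -> dist b = dist c.
Proof.
move=> /orb_eqP[d Nd ->]; rewrite /dist len_orb //; congr addn.
have Nd' : NS p (shiftS S (raag_ht c0)) (d ^ of_raag p c0).
  exact: (NS_conjE S (of_raag p c0) d).2.
rewrite -(len_orb (c0^-1 * b) Nd'); congr (len _ (of_raag p _)).
rewrite conjgE !vertex_actM -of_raagV.
by rewrite !vertex_act_raag mulVKg.
Qed.

Lemma dist_square b x y : ladj x y ->
  (dist b + dist (b * lelt x * lelt y)%g = dist (b * lelt x)%g + dist (b * lelt y)%g)%N.
Proof.
move=> xy; have add S' c : (len S' (of_raag p c) + len S' (of_raag p (c * lelt x * lelt y)%g) =
    len S' (of_raag p (c * lelt x)%g) + len S' (of_raag p (c * lelt y)%g))%N.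
  by rewrite !of_raagM; exact: len_square.
rewrite /dist !mulgA addnACA add add [RHS]addnACA.
by [].
Qed.

Lemma dist_ge b : (len S (of_raag p c0) <= dist b)%N.
Proof.
have h1 := len_mul cov conn L_flag S (of_raag p b) (of_raag p (b^-1 * c0)).
rewrite -of_raagM mulVKg in h1; apply: leq_trans h1 _; rewrite leq_add2l.
have := len_inv cov conn L_flag (shiftS S (raag_ht c0)) (of_raag p (c0^-1 * b)).
rewrite -of_raagV invgM invgK shiftSD /rd_ht /= -raag_htM mulVKg.
exact.
Qed.

Let m := len S (of_raag p c0).
Definition in_interval (P : set (raag M)) := exists2 b, P = orb b & dist b = m.

Lemma in_interval_orb b : in_interval (orb b) <-> dist b = m.
Proof.
by split=> [[c /dist_orb e <-]|h]; [rewrite e|exists b].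
Qed.

(** A function that is additive on squares and equal to [m] at three corners is
    equal to [m] at the fourth. *)
Lemma in_interval_square b x y : ladj x y ->
  in_interval (orb b) -> in_interval (orb (b * lelt x)) ->
  in_interval (orb (b * lelt y)) -> in_interval (orb (b * lelt x * lelt y)).
Proof.
move=> xy /in_interval_orb h /in_interval_orb hx /in_interval_orb hy; apply/in_interval_orb.
by have := dist_square b xy; rewrite h hx hy => /addnI.
Qed.

Lemma in_interval_finite : finite_set in_interval.
Proof.
have fl : finite_set [set: letter].
  have := finite_setX M_finite (@finite_finset _ [set: bool]).
  by apply: sub_finite_set.
have fw := finite_words m fl.
apply: (sub_finite_set _ (finite_image (fun w => orb (pclass _ w)) fw)) => P [b -> db].
pose t := gact S (base p) (of_raag p b).
have bt : NSeq S (of_raag p b) (ev t) by exact: ev_nf.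
have st : (size t.2 <= m)%N by rewrite -db /dist -/(len S (of_raag p b)) leq_addr.
exists (word_map t.1 (rev t.2)); first by split=> //; rewrite size_map size_rev.
apply/orb_eqP; exists (of_raag p b * (ev t)^-1) => //.
rewrite -deck_raagE; set c := deck_raag _ _.
have -> : ev t = of_raag p c * of_deck t.1 by exact: of_deck_raag.
rewrite invgM -of_raagV -of_deckV !vertex_actM !vertex_act_raag vertex_act_deck.
by rewrite mulVg deck_raag1 mulg1.
Qed.

Definition edge (l : T) (P Q : set (raag M)) :=
  exists b x, [/\ P = orb b, Q = orb (b * lelt x) & label b x = l].

Lemma edge_sym l P Q : edge l P Q -> edge l Q P.
Proof.
move=> [b [x [-> -> <-]]]; exists (b * lelt x), (linv x).
by rewrite label_rev -mulgA lelt_linv mulg1.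
Qed.

Lemma edge_at l b Q : edge l (orb b) Q -> exists x, Q = orb (b * lelt x) /\ label b x = l.
Proof.
move=> [c [x [/esym/orb_eqP[d Nd ->] -> <-]]]; exists (lact (rd_deck d) x).
rewrite label_act; last exact: NS_E.
by split=> //; apply/orb_eqP; exists d => //; rewrite vertex_act_lelt.
Qed.

Lemma edge_functional l P Q Q' : edge l P Q -> edge l P Q' -> Q = Q'.
Proof.
move=> [b [x [-> -> ex]]] /edge_at[x' [-> ex']].
have [k hk <-] := label_inj (etrans ex (esym ex')).
by rewrite orb_frame.
Qed.

(** Here the absence of inter-osculation is used: labels that cross somewhere
    cross wherever they meet. *)
Lemma edge_square c x y P Q R : ladj x y ->
  edge (label c x) P Q -> edge (label c y) P R ->
  exists2 V, edge (label c y) Q V /\ edge (label c x) R V &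
    in_interval P -> in_interval Q -> in_interval R -> in_interval V.
Proof.
move=> xy [b [x' [-> -> ex]]] /edge_at[y' [-> ey]].
have [k hk xy'] := label_square xy (esym ex) (esym ey).
have eyk : label b (lact k y') = label b y'.
  have Nk : NS p S (of_raag p b * of_deck k * (of_raag p b)^-1).
    have [N1 _ _] := NS_subgroup p S.
    case: hk => [->|Sb]; last exact: NS_gen.
    by rewrite [of_deck 1](_ : _ = 1) // mulg1 mulgV.
  have := label_act b y' (NS_E Nk).
  rewrite !vertex_actM -of_raagV !vertex_act_raag vertex_act_deck.
  by rewrite mulVg deck_raag1 mulg1 !rdM /= mul1g mulg1.
rewrite -(orb_frame y' hk); move: (lact k y') xy' eyk => z xz ez.
exists (orb (b * lelt x' * lelt z)).
  split; first by exists (b * lelt x'), z; split=> //; rewrite label_adj ?ez //; exact: ladjC.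
  exists (b * lelt z), x'; split=> //; last by rewrite label_adj.
  by rewrite -!mulgA (lelt_comm xz).
exact: in_interval_square.
Qed.

(** By [edge_functional] the edges labelled [l] form a partial matching; the
    vertices of the interval without a partner in it are fixed. *)
Definition swap (l : T) (P : set (raag M)) : set (raag M) :=
  if pselect (exists Q, [/\ in_interval P, in_interval Q & edge l P Q]) is left h
  then projT1 (cid h) else P.

Lemma swap_edge l P Q : in_interval P -> in_interval Q -> edge l P Q -> swap l P = Q.
Proof.
move=> hP hQ PQ; rewrite /swap; case: pselect => [h|]; last by case; exists Q.
by case: cid => R /= [_ _ PR]; exact: edge_functional PR PQ.
Qed.

Lemma swapN l P : ~ (exists2 Q, in_interval Q & edge l P Q) -> swap l P = P.
Proof.
move=> nh; rewrite /swap; case: pselect => // h; exfalso; apply: nh.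
by have [Q [_ hQ PQ]] := h; exists Q.
Qed.

Lemma swapP l P : in_interval P ->
  (in_interval (swap l P) /\ edge l P (swap l P)) \/
  swap l P = P /\ ~ (exists2 Q, in_interval Q & edge l P Q).
Proof.
move=> hP; have [[Q hQ PQ]|h] := pselect (exists2 Q, in_interval Q & edge l P Q).
  by left; rewrite (swap_edge hP hQ PQ).
by right; rewrite swapN.
Qed.

Lemma swap_in_interval l P : in_interval P -> in_interval (swap l P).
Proof. by move=> hP; case: (swapP l hP) => [[]|[->]]. Qed.

Lemma swapK l P : in_interval P -> swap l (swap l P) = P.
Proof.
move=> hP; case: (swapP l hP) => [[hQ PQ]|[-> h]]; last exact: swapN.
by apply: swap_edge => //; exact: edge_sym.
Qed.

(** The interval contains the fourth corner of a square as soon as it contains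
    three, so the partners of two crossing labels exist together or not at
    all. *)
Lemma swapC c x y P : ladj x y -> in_interval P ->
  swap (label c x) (swap (label c y) P) = swap (label c y) (swap (label c x) P).
Proof.
have half x' y' : ladj x' y' -> in_interval P ->
    in_interval (swap (label c x') P) -> edge (label c x') P (swap (label c x') P) ->
    ~ (exists2 Q, in_interval Q & edge (label c y') P Q) ->
    swap (label c y') (swap (label c x') P) = swap (label c x') P.
  move=> xy hP hQ PQ nR; apply: swapN => -[V hV QV]; apply: nR.
  have [R [RV PR] hR] := edge_square xy (edge_sym PQ) QV.
  by exists R; [exact: hR|exact: RV].
move=> xy hP; have yx := ladjC xy.
case: (swapP (label c x) hP) => [[hQ PQ]|[eQ nQ]];
  case: (swapP (label c y) hP) => [[hR PR]|[eR nR]].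
- have [V [QV RV] hV] := edge_square xy PQ PR.
  have {}hV := hV hP hQ hR.
  by rewrite (swap_edge hQ hV QV) (swap_edge hR hV RV).
- by rewrite eR half.
- by rewrite eQ half.
- by rewrite eQ eR eQ.
Qed.

(** The labels along the path that starts at [b] and spells [w] act in turn by
    their involutions. *)
Fixpoint walk b (w : word M) P :=
  if w is x :: w' then walk (b * lelt x) w' (swap (label b x) P) else P.

Lemma walk_in_interval b w P : in_interval P -> in_interval (walk b w P).
Proof. by elim: w b P => //= x w IH b P hP; apply: IH; exact: swap_in_interval. Qed.

Lemma walk_cat b u v P : walk b (u ++ v) P = walk (b * pclass _ u) v (walk b u P).
Proof.
elim: u b P => [|x u IH] b P /=; first by rewrite [X in b * X](_ : _ = 1) // mulg1.
by rewrite IH -cat1s pclassM mulgA.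
Qed.

Lemma walk_word_eq u v : word_eq (@raag_relators M) u v ->
  forall b P, in_interval P -> walk b u P = walk b v P.
Proof.
elim=> {u v} //.
- by move=> u v _ IH b P hP; rewrite IH.
- by move=> v u w _ IH _ IH' b P hP; rewrite IH // IH'.
- move=> u u' v v' uu' IH _ IH' b P hP; rewrite !walk_cat.
  have /pclassP -> := uu'; rewrite IH // IH' //; exact: walk_in_interval.
- by move=> x b c P hP /=; rewrite (label_rev c (x, b)) swapK.
- move=> _ [v [w [vw ->]]] b P hP /=.
  have vw' : ladj (v, false) (w, false) by [].
  have e0 : label (b * lelt (v, false)) (w, false) = label b (w, false).
    by rewrite label_adj //; exact: ladjC.
  have ec : b * lelt (v, false) * lelt (w, false) = b * lelt (w, false) * lelt (v, false).
    by rewrite -!mulgA (lelt_comm vw').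
  have e1 : label (b * lelt (v, false) * lelt (w, false)) (v, true) = label b (v, false).
    by rewrite ec (label_rev _ (v, false)) label_adj.
  have e2 : label (b * lelt (v, false) * lelt (w, false) * lelt (v, true)) (w, true) =
      label b (w, false).
    by rewrite label_adj ?(label_rev _ (w, false)) // ; exact: ladjC.
  rewrite e0 e1 e2 -(swapC _ vw' hP) swapK ?swapK //; exact: swap_in_interval.
Qed.

Definition gwalk b a P := walk b (prepr a) P.

Lemma gwalk_word b w P : in_interval P -> gwalk b (pclass _ w) P = walk b w P.
Proof. by move=> hP; apply: walk_word_eq => //; exact: prepr_class. Qed.

Lemma gwalkM b a c P : in_interval P -> gwalk b (a * c) P = gwalk (b * a) c (gwalk b a P).
Proof.
move=> hP; rewrite -{1}(preprK a) -{1}(preprK c) -pclassM gwalk_word //.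
by rewrite walk_cat preprK.
Qed.

Lemma gwalk1 b P : in_interval P -> gwalk b 1 P = P.
Proof. exact: (gwalk_word b [::]). Qed.

Lemma gwalk_in_interval b a P : in_interval P -> in_interval (gwalk b a P).
Proof. exact: walk_in_interval. Qed.

Lemma gwalk_act kappa b a P : E kappa -> in_interval P ->
  gwalk (vertex_act kappa b) (deck_raag (rd_deck kappa) a) P = gwalk b a P.
Proof.
move=> Ek hP; rewrite /deck_raag gwalk_word // /gwalk; move: (prepr a) => w.
elim: w b P hP => //= x w IH b P hP.
rewrite -vertex_act_lelt -(label_act b x Ek) IH //; exact: swap_in_interval.
Qed.

Definition monodromy kappa P := gwalk 1 (rd_raag kappa) P.

Lemma monodromy_in_interval kappa P : in_interval P -> in_interval (monodromy kappa P).
Proof. exact: gwalk_in_interval. Qed.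

(** The labels are invariant under [E], so the path of [e] acts in the same way
    after it is carried to the end of the path of [d]. *)
Lemma monodromyM d e P : E d -> in_interval P ->
  monodromy (d * e) P = monodromy e (monodromy d P).
Proof.
move=> Ed hP; rewrite /monodromy /= gwalkM // mul1g.
have hP' := gwalk_in_interval 1 (rd_raag d) hP.
rewrite -(gwalk_act 1 (rd_raag e) Ed hP'); congr gwalk.
by rewrite /vertex_act deck_raag1 mulg1.
Qed.

(** A generator is a path out and a translate of the same path back. *)
Lemma monodromy_NS d : NS p S d -> forall P, in_interval P -> monodromy d P = P.
Proof.
have [E1 EM EV] := sE => Nd.
suff [] : [set d | E d /\ forall P, in_interval P -> monodromy d P = P] d by [].
apply: Nd; split.
  split=> [|e1 e2 [E1' h1] [E2' h2]|e1 [E1' h1]].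
  - by split=> // P hP; exact: gwalk1.
  - by split=> [|P hP]; [exact: EM|rewrite monodromyM // h1 // h2].
  - split=> [|P hP]; first exact: EV.
    by rewrite -{1}(h1 P hP) -monodromyM // mulgV; exact: gwalk1.
move=> {d} _ [b [g [Sb ->]]]; set d := _ * _ * _.
have Ed : E d by apply: NS_E; apply: NS_gen.
split=> // P hP; rewrite /monodromy.
have -> : rd_raag d = b * deck_raag g b^-1.
  by rewrite /d -of_raagV -mulgA of_deck_raag mulgA -of_raagM rdM /= deck_raag1 mulg1.
rewrite gwalkM // mul1g.
have act : vertex_act d b = b.
  rewrite /d !vertex_actM -of_raagV !vertex_act_raag vertex_act_deck.
  by rewrite mulVg deck_raag1 mulg1.
have gd : rd_deck d = g by rewrite /d -of_raagV !rdM /= mul1g mulg1.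
rewrite -{1}act -gd gwalk_act //; last exact: gwalk_in_interval.
by rewrite -{1}[b]mul1g -gwalkM // mulgV gwalk1.
Qed.

(** By the triangle inequality every vertex of a shortest path is in the
    interval, and along an edge inside the interval [swap] moves to the other
    end. *)
Lemma walk_geodesic w : c0 = pclass _ w -> size w = m ->
  in_interval (orb 1) /\ monodromy (of_raag p c0) (orb 1) = orb c0.
Proof.
move=> ec sw.
have pre u v : w = u ++ v -> in_interval (orb (pclass _ u)).
  move=> ew; apply/in_interval_orb/eqP; rewrite eqn_leq dist_ge andbT -/m -sw ew size_cat.
  apply: leq_add.
    by have := len_word cov conn L_flag S u 1; rewrite (len_deckr cov conn L_flag).
  have -> : c0^-1 * pclass _ u = pclass _ (word_inv v).
    have -> : c0 = pclass _ u * pclass _ v by rewrite ec ew pclassM.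
    rewrite invgM mulgVK; apply: (@mulgI _ (pclass _ v : raag M)); rewrite mulgV.
    rewrite -pclassM; apply/esym/pclassP.
    by have := word_invV (@raag_relators M) (word_inv v); rewrite word_invK.
  have := len_word cov conn L_flag (shiftS S (raag_ht c0)) (word_inv v) 1.
  by rewrite (len_deckr cov conn L_flag) size_rev size_map.
have h1 : in_interval (orb 1) by exact: (pre [::] w).
split=> //; rewrite /monodromy /= {1}ec gwalk_word //.
suff : forall v u, w = u ++ v -> walk (pclass _ u) v (orb (pclass _ u)) = orb c0.
  by move=> /(_ w [::] erefl).
elim=> [|x v IH] u ew /=; first by rewrite ec ew cats0.
have ux : pclass _ u * lelt x = pclass _ (rcons u x) :> raag M.
  by rewrite -cats1 pclassM.
rewrite ux (swap_edge (Q := orb (pclass _ (rcons u x)))).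
- by apply: IH; rewrite cat_rcons.
- exact: pre ew.
- by apply: pre; rewrite cat_rcons; exact: ew.
- by exists (pclass _ u), x; rewrite ux.
Qed.

(** The monodromy permutes a finite set of vertices, so the stabilizer of one of
    them has finite index. *)
Lemma stabilizer_separates : in_interval (orb 1) -> exists P, [/\ subgroup P, NS p S `<=` P,
  P `<=` E, finite_index_in E P & forall kappa, P kappa -> monodromy kappa (orb 1) = orb 1].
Proof.
move=> h1; have [E1 EM EV] := sE.
exists [set kappa | E kappa /\ monodromy kappa (orb 1) = orb 1].
have sP : subgroup [set kappa | E kappa /\ monodromy kappa (orb 1) = orb 1].
  split=> [|d e [Ed hd] [Ee he]|d [Ed hd]].
  - by split=> //; exact: gwalk1.
  - by split; [exact: EM|rewrite monodromyM // hd he].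
  - split; first exact: EV.
    by rewrite -{1}hd -monodromyM // mulgV; exact: gwalk1.
split=> //.
- by move=> d Nd; split; [exact: NS_E|exact: monodromy_NS].
- by move=> d [].
- exists (set (raag M)), (fun d => monodromy d^-1 (orb 1)); split.
    apply: (sub_finite_set _ in_interval_finite) => _ [d Ed <-]; exact: monodromy_in_interval.
  move=> d e Ed Ee h; split; first by apply: EM => //; exact: EV.
  rewrite monodromyM ?h -?monodromyM ?mulVg //; [exact: gwalk1| |]; exact: EV.
- by move=> d [].
Qed.

End Walk.

Section Separation.
Local Open Scope group_scope.
Variables (M L : scomplex) (p : M -> L).
Hypothesis cov : covering p.
Hypothesis conn : sconnected M.
Hypothesis L_flag : flag L.
Hypothesis L_finite : finite_set [set: L].
Hypothesis deck_finite : finite_set [set: deck p].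
Hypothesis reg : regular_covering p.

Lemma finite_cover : finite_set [set: M].
Proof.
have [sp _ _ _] := cov.
pose r (v : L) := projT1 (cid (sp v)).
have rP v : p (r v) = v by rewrite /r; case: cid.
apply: (sub_finite_set _ (finite_image2 (fun (g : deck p) v => g (r v)) deck_finite L_finite)).
move=> x _; have /(proj2 reg)[g e] : p (r (p x)) = p x by rewrite rP.
by exists g => //; exists (p x).
Qed.

(** If [kappa] lies in the subgroup [evenK], take the interval between the base
    vertex and its image by [kappa]: the monodromy of [kappa] moves one end to
    the other, and these differ because [K] acts freely. *)
Lemma special_separates S n (hS : shift_invariant S n) kappa :
  virtually_special p hS -> BB_deck kappa -> ~ NS p S kappa ->
  exists P, [/\ subgroup P, NS p S `<=` P, finite_index_in (@BB_deck _ _ p) P & ~ P kappa].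
Proof.
move=> [K [sK tK fK spK]] BBk nNk.
(* Elements outside [evenK] are separated by [evenK] itself. *)
pose E : set (raag_deck p) := evenK K.
have sE : subgroup E by exact: evenK_subgroup.
have fiH := preimageK_finite_index sK fK.
have [sL eL] := (finite_seqP _).1 L_finite.
have fiK : finite_index_in (preimageK K) E.
  pose par (c : raag_deck p) := [seq parity (fun w => p w == v) (rd_raag c) | v <- sL].
  exists (seq bool), par; split.
    have fb : finite_set [set: bool] by exact: finite_finset.
    apply: (sub_finite_set _ (finite_words (size sL) fb)) => _ [c _ <-].
    by split=> //; rewrite size_map.
  move=> c d Kc Kd /eq_in_map e; have [_ PM PV] := preimageK_subgroup sK.
  split=> [|v]; first by apply: PM => //; exact: PV.
  have vs : v \in sL by have : [set: L] v by []; rewrite eL.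
  rewrite /= parityM !(parity_deck _ (pred1 v)) parityV /=.
  by have := e v vs => /= ->; rewrite addbb.
have fiE : finite_index_in (Hn p n) E.
  apply: finite_index_in_trans fiH fiK; [exact: preimageK_Hn|exact: ht_subgroup].
have BBH : @BB_deck _ _ p `<=` Hn p n.
  by move=> c; rewrite /BB_deck /Hn /bestvina_brady /= /rd_ht => ->; exact: dvdz0.
have [Ek|nEk] := pselect (E kappa); last first.
  by exists E; split=> //; [exact: NS_evenK|exact: finite_index_in_sub BBH fiE].
pose s := gact S (base p) kappa.
have rs : reduced S s by apply: gact_reduced.
have ks : NSeq S kappa (ev s) by exact: ev_nf.
pose w := word_map s.1 (rev s.2); pose c0 : raag M := pclass _ w.
have evs : ev s = of_raag p c0 * of_deck s.1.
  by rewrite /ev of_deck_raag deck_raagE.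
have sw : size w = len S (of_raag p c0).
  rewrite -(len_deckr cov conn L_flag _ _ s.1) -evs (len_ev cov conn L_flag) //.
  by rewrite size_map size_rev.
have E_free d : E d -> vertex_act d 1 = 1 -> NS p S d.
  by move=> [Kd _]; exact: (preimageK_stab deck_finite tK).
have NS_E : NS p S `<=` E by exact: NS_evenK.
have Edecomp : exists2 d, NS p S d & kappa = d * (of_raag p c0 * of_deck s.1).
  by exists (kappa * (ev s)^-1) => //; rewrite -evs mulgVK.
have [in_interval1 walk1] := walk_geodesic cov conn L_flag NS_E (label_rev K) (label_adj cov K)
  (label_act sK) (label_inj cov conn L_flag deck_finite sK tK spK)
  (label_square cov conn L_flag deck_finite sK tK spK) (erefl c0) sw.
have [P [sP NP PE fP hP]] := stabilizer_separates cov conn L_flag finite_cover sE NS_E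
  (label_rev K) (label_adj cov K) (label_act sK)
  (label_inj cov conn L_flag deck_finite sK tK spK)
  (label_square cov conn L_flag deck_finite sK tK spK) in_interval1.
exists P; split=> //.
  apply: (finite_index_in_sub BBH); apply: finite_index_in_trans fiE fP.
    by move=> c [Kc _]; exact: preimageK_Hn Kc.
  exact: ht_subgroup.
(* If [kappa] fixes the base vertex in the monodromy, it fixes it in [X_M /
   N(S)]. *)
move=> Pk; have [d Nd ek] := Edecomp; have [E1 EM EV] := sE; have [P1 PM PV] := sP.
have [N1 NM NV] := NS_subgroup p S.
pose e := of_raag p c0 * of_deck s.1.
have Pe : P e.
  have -> : e = d^-1 * kappa by rewrite ek mulKg.
  by apply: PM => //; apply: NP; exact: NV.
have : orb p S 1 = orb p S c0.
  rewrite -walk1 -{1}(hP _ Pe) /monodromy /e rdM /=.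
  by rewrite deck_raag1 mulg1.
move=> /orb_eqP[d' Nd' ec]; apply: nNk; rewrite ek -/e; apply: (NM) => //.
have -> : e = d' * (d'^-1 * e) by rewrite mulVKg.
apply: (NM) => //; apply: E_free.
  by apply: EM; [apply/EV/NS_E|exact: PE].
by rewrite vertex_actM /e vertex_actM vertex_act_deck deck_raag1 vertex_act_raag mulg1
  ec -vertex_actM mulVg vertex_act1.
Qed.

End Separation.

(** * Periodic approximation of closed sets *)

Section ProfiniteTopology.

Lemma shift_invariantI (A B : set int) (n m : int) :
  shift_invariant A n -> shift_invariant B m -> shift_invariant (A `&` B) (m * n).
Proof.
move=> hA hB; apply/seteqP; split=> [_ [y [Ay By] <-]|y [Ay By]].
  by split; [exact: shift_invariantM|rewrite mulrC; exact: shift_invariantM].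
exists (y - m * n); last by rewrite subrK.
by split; [rewrite -mulNr|rewrite mulrC -mulNr]; exact: shift_invariantM.
Qed.

Lemma shift_invariantC (A : set int) (n : int) : shift_invariant A n -> shift_invariant (~` A) n.
Proof.
move=> hA; have h1 s : A s -> A (s + n) by move=> /(shift_invariantM 1 hA); rewrite mul1r.
have h2 s : A s -> A (s - n) by move=> /(shift_invariantM (-1) hA); rewrite mulN1r.
apply/seteqP; split=> [_ [y Ay <-] /h2|y Ay]; first by rewrite addrK.
by exists (y - n); [move/h1; rewrite subrK|rewrite subrK].
Qed.

(** Each of the finitely many missing integers has a periodic neighbourhood
    disjoint from [S]; the complement of their union is periodic. *)
Lemma closed_periodic_approx (S : set int) : closed (S : set profinite_int) ->
  forall m : nat, exists S' (n : int), [/\ 0 < n, shift_invariant S' n, S `<=` S' &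
    agree_upto m S S'].
Proof.
move=> cS m; have [D sD eD] := closed_openC cS.
have sep x : ~ S x -> exists B (n : int), [/\ 0 < n, shift_invariant B n, B x & B `<=` ~` S].
  move=> nSx; have [B DB Bx] : (\bigcup_(B in D) B) x by rewrite eD.
  have [n [n0 hB]] := sD _ DB; exists B, n; split=> // y By.
  by have : (\bigcup_(B' in D) B') y; [exists B|rewrite eD].

have app (hs : seq int) : exists S' (n : int), [/\ 0 < n, shift_invariant S' n, S `<=` S' &
    forall x : int, x \in hs -> S' x -> S x].
  elim: hs => [|x hs [S' [n [n0 hS' SS' hhs]]]].
    exists setT, 1; split=> //; apply/seteqP; split=> // y _.
    by exists (y - 1); rewrite ?subrK.
  have [Sx|nSx] := pselect (S x).
    by exists S', n; split=> // y; rewrite inE => /orP[/eqP-> //|]; exact: hhs.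
  have [B [k [k0 hB Bx BS]]] := sep x nSx.
  exists (S' `&` ~` B), (k * n); split; first exact: mulr_gt0.
  - exact/shift_invariantI/shift_invariantC.
  - by move=> y Sy; split; [exact: SS'|move=> /BS].
  - by move=> y; rewrite inE => /orP[/eqP->|/hhs h] [S'y nBy] //; exact: h.
have [S' [n [n0 hS' SS' h]]] := app [seq (i%:Z - m%:Z)%R | i <- iota 0 (m + m).+1].
exists S', n; split=> // x xm; split; first exact: SS'.
apply: h; apply/mapP; exists (absz (x + m%:Z)%R); last first.
  by rewrite gez0_abs ?addrK //; move: xm; rewrite ler_norml => /andP[]; lia.
by rewrite mem_iota; move: xm; rewrite ler_norml => /andP[]; lia.
Qed.

End ProfiniteTopology.

Section Pullback.
Local Open Scope group_scope.
Variables (M L : scomplex) (p : M -> L) (N : set (deck p)) (nN : normal_subgroup N).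
Hypothesis cov : covering p.

Lemma pullback_subgroup (P : set (raag_deck (qp N))) : subgroup P ->
  subgroup [set c | P (qmap nN c)].
Proof.
move=> [P1 PM PV]; split=> [|c d|c] /=; rewrite ?qmap1 ?(qmapM nN cov) ?(qmapV nN cov) //.
  exact: PM.
exact: PV.
Qed.

Lemma pullback_finite_index (P : set (raag_deck (qp N))) :
  finite_index_in (@BB_deck _ _ (qp N)) P ->
  finite_index_in (@BB_deck _ _ p) [set c | P (qmap nN c)].
Proof.
have BBq c : BB_deck c -> BB_deck (qmap nN c).
  by move=> h; have := qmap_ht nN cov c; rewrite /BB_deck /bestvina_brady /= /rd_ht => ->.
move=> [T [f [ff fP]]]; exists T, (f \o qmap nN); split.
  by apply: (sub_finite_set _ ff) => _ [c Bc <-]; exists (qmap nN c) => //; exact: BBq.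
move=> c d Bc Bd e; rewrite /= (qmapM nN cov) (qmapV nN cov).
by apply: fP => //; exact: BBq.
Qed.

End Pullback.

(** * The two finiteness properties *)

Section Main.
Local Open Scope group_scope.
Variable L : scomplex.
Hypothesis L_nonempty : [set: L] !=set0.
Hypothesis L_finite : finite_set [set: L].
Hypothesis L_flag : flag L.
Hypothesis H_special : forall (M : scomplex) (p : M -> L),
  sconnected M -> regular_covering p -> finite_set [set: deck p] ->
  forall (n : int) (S : set int), (0 < n)%R ->
  forall hS : shift_invariant S n, virtually_special p hS.
Variables (M : scomplex) (p : M -> L).
Hypothesis conn : sconnected M.
Hypothesis reg : regular_covering p.
Let cov : covering p := proj1 reg.

Let M_inhabited : inhabited M.
Proof.
have [v _] := L_nonempty; have [sp _ _ _] := cov.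
by have [x _] := sp v; exists.
Qed.

(** Let [N] be a torsion-free normal subgroup of finite index in [pi] and [P]
    the preimage of a torsion-free subgroup of finite index for the finite
    covering [M / N]. A torsion element of [P] is conjugate to some [g] in [pi],
    by [torsion_elliptic]; its image vanishes, so that [g] is in [N] and
    trivial, unless it sits at a height in [S], where it is trivial as well. *)
Theorem GLM_virtually_torsion_free (S : set int) : periodic S ->
  virtually_torsion_free (deck p) -> virtually_torsion_free (GLM p S).
Proof.
move=> [n [n0 hS]] [H [sH fH tH]].
have [N [nN fN NH]] := normal_core sH fH.
have qfin := qfinite nN cov conn reg M_inhabited fN.
have qcov := qcovering nN cov; have qconn := qconnected nN cov conn.
have [K [sK tK fK spK]] := H_special qconn (qregular nN cov reg) qfin n0 hS.
pose P : set (raag_deck p) := [set c | preimageK K (qmap nN c)].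
have sP : subgroup P by apply: pullback_subgroup => //; exact: preimageK_subgroup.
have NP : NS p S `<=` P by move=> c /(qmap_NS nN cov) /(NS_preimageK sK).
have fP : finite_index_in (@BB_deck _ _ p) P.
  apply: pullback_finite_index => //; apply: (finite_index_in_sub (A := Hn (qp N) n)).
    by move=> c; rewrite /BB_deck /Hn /bestvina_brady /= /rd_ht => ->; exact: dvdz0.
  exact: preimageK_finite_index.
exists (sq_sub (Q := GLM_sq p S) P); split.
- exact: sq_sub_subgroup.
- exact: sq_sub_finite_index.
move=> C m; have [c [Hc ->]] := sq_classP C => /(sq_sub_class (Q := GLM_sq p S) sP NP Hc) Pc m0.
have [Hm e] := sq_class_expg Hc m.
rewrite [X in X = _]e => /(sq_class_eq1 (Q := GLM_sq p S)) cm.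
apply/(sq_class_eq1 (Q := GLM_sq p S) Hc).
have [d [g cd]] := torsion_elliptic cov conn L_flag (Hc : rd_ht c = 0%R) m0 cm.
have [N1 NM NV] := NS_subgroup p S.
(* [c] is, up to [NS p S], the conjugate of [g] by [d]. *)
suff [Sd|g1] : S (rd_ht d) \/ g = 1.
- by have := NM _ _ cd (NS_gen g Sd); rewrite mulgVK.
- by have := cd; rewrite /NSeq g1 [of_deck 1](_ : _ = 1) // mulg1 mulgV invg1 mulg1.
have he : rd_ht (d * of_deck g * d^-1) = 0%R.
  by rewrite !rd_htM rd_ht_deck rd_htV addr0 addrN.
have pw (k : nat) : (d * of_deck g * d^-1) ^+ k = d * of_deck (g ^+ k) * d^-1.
  elim: k => [|k IH]; first by rewrite expg0 [of_deck _](_ : _ = 1) // mulg1 mulgV.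
  by rewrite expgS IH expgS of_deckM !mulgA mulgVK.
have em : NS p S ((d * of_deck g * d^-1) ^+ m).
  apply/NSeq1; apply: (NSeq_trans (d := c ^+ m)); last exact/NSeq1.
  by apply: NSeqX => //; exact: NSeq_sym.
have : frame_change S (rd_ht d) (g ^+ m).
  by apply: (stabilizer_NS cov conn L_flag); rewrite -pw.
move=> [gm|]; last by left.
have Ke : preimageK K (qmap nN (d * of_deck g * d^-1)).
  have -> : d * of_deck g * d^-1 = (c * (d * of_deck g * d^-1)^-1)^-1 * c.
    by rewrite invgM invgK mulgVK.
  have [P1 PM PV] := sP; apply: (PM) => //; apply: PV; exact: NP.
have : NS (qp N) S (qmap nN (d * of_deck g * d^-1)).
  apply: (preimageK_torsion tK Ke m0).
  have qX (k : nat) x : qmap nN (x ^+ k) = qmap nN x ^+ k.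
    by elim: k => [|k IH]; rewrite ?expg0 ?(qmap1 nN cov) // !expgS (qmapM nN cov) IH.
  by rewrite -qX; exact: qmap_NS.
rewrite !(qmapM nN cov) (qmapV nN cov) (qmap_deck nN cov).
move=> /(stabilizer_NS qcov qconn L_flag); rewrite (qmap_ht nN cov).
move=> [/(qdeck_inj cov conn M_inhabited) /NH Hg|]; last by left.
by right; exact: tH Hg m0 gm.
Qed.

(** A non-trivial element stays non-trivial in the group of a finite covering
    and a periodic set, by [NS_open] and [closed_periodic_approx]; there it is
    detected by a finite quotient, by [special_separates]. *)
Theorem GLM_residually_finite (S : set int) : closed (S : set profinite_int) ->
  residually_finite (deck p) -> residually_finite (GLM p S).
Proof.
move=> cS rf C; have [c [Hc ->]] := sq_classP C => nC1.
have nc : ~ NS p S c by move=> Nc; apply: nC1; apply/sq_class_eq1.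
have [D ntD [m hD]] := NS_open conn reg M_inhabited L_flag nc.
have [S' [n [n0 hS' SS' agr]]] := closed_periodic_approx cS m.
have [N [nN fN av]] : exists N : set (deck p),
    [/\ normal_subgroup N, finite_index N & avoids D N].
  pose F (g : deck p) : set (deck p) :=
    if pselect (exists H, [/\ normal_subgroup H, finite_index H & ~ H g]) is left e
    then projT1 (cid e) else setT.
  have FP g : g \in D -> [/\ normal_subgroup (F g), finite_index (F g) & ~ F g g].
    by move=> /ntD/rf h; rewrite /F; case: pselect => // e; case: cid.
  have nF : normal_subgroup [set x | forall g, g \in D -> F g x].
    have FN g : g \in D -> normal_subgroup (F g) by case/FP.
    split=> [|x y hx g /[dup] gD /FN [_]]; last by apply; exact: hx.
    split=> [g /FN[[]] //|x y hx hy g /[dup] gD /FN[[_ + _] _]|x hx g /[dup] gD /FN[[_ _ +] _]].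
      by apply; [exact: hx|exact: hy].
    by apply; exact: hx.
  exists [set x | forall g, g \in D -> F g x]; split=> //.
    apply/(finite_index_inT nF.1); apply: finite_index_in_bigI => g /FP[[sF _] fF _].
    exact/(finite_index_inT sF).
  by move=> g gD /(_ g gD); have [_ _] := FP g gD.
have qfin := qfinite nN cov conn reg M_inhabited fN.
have qcov := qcovering nN cov; have qconn := qconnected nN cov conn.
have qreg := qregular nN cov reg.
have qnc := hD N nN S' av SS' agr.
have qBB : BB_deck (qmap nN c).
  by have := qmap_ht nN cov c; rewrite /BB_deck /bestvina_brady /= /rd_ht => ->.
have [P' [sP' NP' fP' nP']] := special_separates qcov qconn L_flag L_finite qfin qreg
  (H_special qconn qreg qfin n0 hS') qBB qnc.
pose P : set (raag_deck p) := [set c | P' (qmap nN c)].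
have sP : subgroup P by exact: pullback_subgroup.
have NP : NS p S `<=` P.
  by move=> d Nd; apply: NP'; apply: (NS_sub SS'); exact: qmap_NS.
have fP : finite_index_in (@BB_deck _ _ p) P by exact: pullback_finite_index.
have [H [nH fH HP]] := normal_core (sq_sub_subgroup (Q := GLM_sq p S) sP NP)
  (sq_sub_finite_index (Q := GLM_sq p S) sP NP fP).
by exists H; split=> // /HP /(sq_sub_class (Q := GLM_sq p S) sP NP Hc).
Qed.

End Main.

Theorem proposition1p9 (L : scomplex)
  (L_nonempty : [set: L] !=set0)
  (L_finite : finite_set [set: L])
  (L_connected : sconnected L)
  (L_flag : flag L)
  (H_special : forall (M : scomplex) (p : M -> L),
     sconnected M -> regular_covering p -> finite_set [set: deck p] ->
     forall (n : int) (S : set int), 0 < n ->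
     forall hS : shift_invariant S n, virtually_special p hS) :
  forall (M : scomplex) (p : M -> L),
    sconnected M -> regular_covering p ->
    forall S : set int,
      (periodic S -> virtually_torsion_free (deck p) ->
         virtually_torsion_free (GLM p S))
      /\
      (closed (S : set profinite_int) -> residually_finite (deck p) ->
         residually_finite (GLM p S)).
Proof.
move=> M p conn reg S; split.
  exact: GLM_virtually_torsion_free.
exact: GLM_residually_finite.
Qed.
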